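(* Let $k$ be a field and let $\mathcal L=\mathcal L_k(V)$ be the free $k$-category over a set $\mathcal L_0$ and over a family of $k$-vector spaces $V=\{{}_yV_x\}_{x,y\in\mathcal L_0}$. Let $G$ be a finite group acting homogeneously on $\mathcal L$ (equivalently, each vector space ${}_yV_x$ is provided with a structure of $kG$-module). If $\mathcal L$ is finitely-objects of finite (respectively tame) representation type, then $\mathcal L^G$ is finitely-objects of finite (respectively tame) representation type.
   Context: A $k$-category is a small category whose morphism sets are $k$-vector spaces and whose composition is $k$-bilinear; ${}_y\mathcal C_x$ is the space of morphisms from $x$ to $y$. It is object-finite if its set of objects is finite. Free $k$-category: $\mathcal L_k(V)$ has set of objects $\mathcal L_0$ and morphisms from $x$ to $y$ given by $\bigoplus_u W(u)$, where $u=(y=u_n,\dots,u_0=x)$ runs over all finite sequences in $\mathcal L_0$ from $x$ to $y$, $W(u)={}_{u_n}V_{u_{n-1}}\otimes_k\cdots\otimes_k{}_{u_1}V_{u_0}$, and $W(u_0)=k$ for a singleton sequence; composition is given by tensoring $W(v)\otimes W(u)\to W(vu)$ along concatenation of sequences. A bases-quiver of $\mathcal L_k(V)$ has vertices $\mathcal L_0$ and, as set of arrows from $x$ to $y$, a chosen basis of ${}_yV_x$. Homogeneous action: given linear actions of $G$ on each ${}_yV_x$, $G$ acts by invertible $k$-linear endofunctors of $\mathcal L_k(V)$, identity on objects, diagonally on each $W(u)$ (trivially on $W(u_0)=k$). $\mathcal L^G$ has the same objects as $\mathcal L$ and morphism spaces the $G$-fixed morphisms. Representation type: a $\mathcal C$-module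 is a $k$-linear functor from $\mathcal C$ to finite dimensional $k$-vector spaces; it is indecomposable if it is nonzero and not a direct sum of two nonzero submodules. For object-finite $\mathcal C$, the dimension of a $\mathcal C$-module $\mathcal M$ is $\sum_x\dim_k\mathcal M(x)$, over representatives $x$ of the isomorphism classes of objects. $\mathcal C$ is of finite representation type if it has finitely many isomorphism classes of indecomposable modules. An object-finite $\mathcal C$ is of tame representation type if for each positive integer $d$ the isomorphism classes of indecomposable $\mathcal C$-modules of dimension at most $d$ are contained in a finite number of one-parameter families, except possibly a finite number of them; by convention finite representation type is also tame. For free object-finite $k$-categories this notion is understood so that the classical characterization of Donovan and Freislich, which the paper recalls over its arbitrary field $k$, holds: $\mathcal L_k(V)$ is of tame representation type if and only if the underlying graph of a bases-quiver is a finite disjoint union of Dynkin diagrams $A_n\,(n\ge1)$, $D_n\,(n\ge4)$, $E_6,E_7,E_8$ and extended Dynkin diagrams $\widetilde A_n\,(n\ge0)$ ($\widetilde A_0$ being one vertex with one loop), $\widetilde D_n\,(n\ge4)$, $\widetilde E_6,\widetilde E_7,\widetilde E_8$. A $k$-category $\mathcal C$ (with possibly infinitely many objects) is finitely-objects of finite (respectively tame) representation type if every object-finite full $k$-subcategory of $\mathcal C$ is of finite (respectively tame) representation type. *)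

(* Defs.v *)
From HB Require Import structures.
From mathcomp Require Import all_boot all_order all_fingroup all_algebra.
From mathcomp Require Import finmap.
From mathcomp Require Import boolp classical_sets functions cardinality fsbigop.

Set Implicit Arguments.
Unset Strict Implicit.
Unset Printing Implicit Defensive.

Import GRing.Theory.
Local Open Scope classical_set_scope.
Local Open Scope ring_scope.

(* No finite-dimensionality and no countability is assumed anywhere on the    *)
(* spaces of a k-category: they are arbitrary [lmodType]s over a field.       *)

Lemma linear0P (k : fieldType) (M N : lmodType k) (f : M -> N) :
  linear f -> f 0 = 0.
Proof.
by move=> lin; rewrite -[X in f X](addNr 0) -scaleN1r lin scaleN1r addNr.
Qed.

Section DirectSum.
Variables (k : fieldType) (I : choiceType) (W : I -> lmodType k).

Record dsum := Dsum {
  dval : forall i, W i;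
  dfin : finite_set [set i | dval i <> 0] }.

Lemma dsumP (f g : dsum) : (forall i, dval f i = dval g i) -> f = g.
Proof.
case: f g => [f ff] [g fg] /= e.
have efg : f = g by apply: functional_extensionality_dep.
by case: _ / efg fg => fg; rewrite (Prop_irrelevance ff fg).
Qed.

HB.instance Definition _ := gen_eqMixin dsum.
HB.instance Definition _ := gen_choiceMixin dsum.

Fact dsum0_fin : finite_set [set i | (0 : W i) <> 0].
Proof. by rewrite (_ : [set _ | _] = set0) //; apply/seteqP; split => i. Qed.
Definition dsum0 := Dsum dsum0_fin.

Fact dsumN_fin (f : dsum) : finite_set [set i | - dval f i <> 0].
Proof.
apply: sub_finite_set (dfin f) => i /= h e; apply: h.
by rewrite e oppr0.
Qed.
Definition dsumN f := Dsum (dsumN_fin f).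

Fact dsumD_fin (f g : dsum) : finite_set [set i | dval f i + dval g i <> 0].
Proof.
have /sub_finite_set : [set i | dval f i + dval g i <> 0] `<=`
    [set i | dval f i <> 0] `|` [set i | dval g i <> 0].
  move=> i /= h; have [e|] := pselect (dval f i = 0); last by left.
  by right => e'; apply: h; rewrite e e' addr0.
by apply; rewrite finite_setU; split; exact: dfin.
Qed.
Definition dsumD f g := Dsum (dsumD_fin f g).

Fact dsumZ_fin (a : k) (f : dsum) : finite_set [set i | a *: dval f i <> 0].
Proof.
apply: sub_finite_set (dfin f) => i /= h e; apply: h.
by rewrite e scaler0.
Qed.
Definition dsumZ a f := Dsum (dsumZ_fin a f).

Fact dsumDA : associative dsumD.
Proof. by move=> f g h; apply: dsumP => i /=; rewrite addrA. Qed.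
Fact dsumDC : commutative dsumD.
Proof. by move=> f g; apply: dsumP => i /=; rewrite addrC. Qed.
Fact dsum0D : left_id dsum0 dsumD.
Proof. by move=> f; apply: dsumP => i /=; rewrite add0r. Qed.
Fact dsumND : left_inverse dsum0 dsumN dsumD.
Proof. by move=> f; apply: dsumP => i /=; rewrite addNr. Qed.
HB.instance Definition _ := GRing.isZmodule.Build dsum dsumDA dsumDC dsum0D dsumND.

Fact dsumZA a b f : dsumZ a (dsumZ b f) = dsumZ (a * b) f.
Proof. by apply: dsumP => i /=; rewrite scalerA. Qed.
Fact dsum1Z : left_id 1 dsumZ.
Proof. by move=> f; apply: dsumP => i /=; rewrite scale1r. Qed.
Fact dsumZDr : right_distributive dsumZ +%R.
Proof. by move=> a f g; apply: dsumP => i /=; rewrite scalerDr. Qed.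
Fact dsumZDl f : {morph dsumZ^~ f : a b / a + b}.
Proof. by move=> a b; apply: dsumP => i /=; rewrite scalerDl. Qed.
HB.instance Definition _ :=
  GRing.Zmodule_isLmodule.Build k dsum dsumZA dsum1Z dsumZDr dsumZDl.

Lemma dvalP a (f g : dsum) i : dval (a *: f + g) i = a *: dval f i + dval g i.
Proof. by []. Qed.

Definition dinj_fun i (w : W i) j : W j :=
  if pselect (i = j) is left e then eq_rect i W w j e else 0.
Fact dinj_fin i (w : W i) : finite_set [set j | dinj_fun w j <> 0].
Proof.
apply: (@sub_finite_set _ _ [set i]); last exact: finite_set1.
by move=> j /=; rewrite /dinj_fun; case: pselect.
Qed.
Definition dinj i (w : W i) : dsum := Dsum (dinj_fin w).

Lemma dinjE i (w : W i) : dval (dinj w) i = w.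
Proof.
rewrite /= /dinj_fun; case: pselect => // e.
by rewrite (Prop_irrelevance e erefl).
Qed.

Lemma dinj_neq i j (w : W i) : i <> j -> dval (dinj w) j = 0.
Proof. by rewrite /= /dinj_fun; case: pselect. Qed.

Lemma dinj_linear i : linear (@dinj i).
Proof.
move=> a v w; apply: dsumP => j; rewrite dvalP /= /dinj_fun.
case: pselect => [e|_]; last by rewrite scaler0 addr0.
by case: _ / e.
Qed.

Variable N : lmodType k.

Definition dlift (phi : forall i, W i -> N) (f : dsum) : N :=
  \sum_(i \in [set: I]) phi i (dval f i).

Variable phi : forall i, W i -> N.
Hypothesis phi_lin : forall i, linear (@phi i).

Let phi0 i : @phi i 0 = 0.
Proof. exact: linear0P. Qed.

Lemma dliftE (f : dsum) (X : {fset I}) :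
  (forall i, i \notin X -> dval f i = 0) ->
  dlift phi f = \sum_(i <- X) phi (dval f i).
Proof. by move=> h; apply: fsbigTE => i /h ->. Qed.

Lemma dsuppP (f : dsum) :
  exists X : {fset I}, forall i, i \notin X -> dval f i = 0.
Proof.
exists (fset_set [set i | dval f i <> 0]) => i.
have [//|h] := pselect (dval f i = 0).
by rewrite in_fset_set ?inE; [rewrite notin_setE|exact: dfin].
Qed.

Lemma dlift_linear : linear (dlift phi).
Proof.
move=> a f g; have [X hX] := dsuppP f; have [Y hY] := dsuppP g.
have in_l i : i \notin (X `|` Y)%fset -> i \notin X.
  by rewrite in_fsetU negb_or => /andP[].
have in_r i : i \notin (X `|` Y)%fset -> i \notin Y.
  by rewrite in_fsetU negb_or => /andP[].
rewrite !(@dliftE _ (X `|` Y)%fset).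
- rewrite scaler_sumr -big_split /=; apply: eq_bigr => i _.
  exact: phi_lin.
- by move=> i /in_r/hY.
- by move=> i /in_l/hX.
- by move=> i hi; rewrite dvalP hX ?in_l// hY ?in_r// scaler0 addr0.
Qed.

Lemma dlift_inj i (w : W i) : dlift phi (dinj w) = phi w.
Proof.
rewrite (@dliftE _ [fset i]%fset); first by rewrite big_seq_fset1 dinjE.
by move=> j; rewrite in_fset1 => /eqP h; rewrite dinj_neq // => e; apply: h.
Qed.

End DirectSum.

Section DirectSumInd.
Variables (k : fieldType) (I : choiceType) (W : I -> lmodType k).

Lemma dsum_sum (f : dsum W) (X : {fset I}) :
  (forall i, i \notin X -> dval f i = 0) -> f = \sum_(i <- X) dinj (dval f i).
Proof.
move=> hX; apply: dsumP => j.
have dval_sum (s : seq I) (F : I -> dsum W) :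
    dval (\sum_(i <- s) F i) j = \sum_(i <- s) dval (F i) j.
  by elim: s => [|i s IH]; rewrite ?big_nil // !big_cons -IH.
rewrite dval_sum; have [jX|jX] := boolP (j \in X).
  rewrite (big_fsetD1 j) // dinjE big1_seq => [|i /andP[_]]; first exact/esym/addr0.
  by rewrite in_fsetD1 => /andP[/eqP ij _]; rewrite dinj_neq.
rewrite hX // big1_seq // => i /andP[_ iX]; rewrite dinj_neq // => e.
by move: jX; rewrite -e iX.
Qed.

Lemma dsum_ind (P : dsum W -> Prop) :
  P 0 -> (forall f g, P f -> P g -> P (f + g)) ->
  (forall i (w : W i), P (dinj w)) -> forall f, P f.
Proof.
move=> P0 PD Pi f; have [X hX] := dsuppP f; rewrite (dsum_sum hX).
by elim/big_ind: _.
Qed.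

End DirectSumInd.

Section Quotient.
Variables (k : fieldType) (M : lmodType k) (R : set M).

Inductive span_of : M -> Prop :=
  | span_of0 : span_of 0
  | span_ofZD a r m of R r & span_of m : span_of (a *: r + m).

Lemma span_of_lin a m n : span_of m -> span_of n -> span_of (a *: m + n).
Proof.
move=> hm hn; elim: hm => [|b r m' Rr _ IH]; first by rewrite scaler0 add0r.
by rewrite scalerDr scalerA -addrA; apply: span_ofZD.
Qed.

Definition span_pred : {pred M} := fun m => `[< span_of m >].

Fact span_zmod_closed : zmod_closed span_pred.
Proof.
split=> [|m n]; first by apply/asboolP; exact: span_of0.
move=> /asboolP hm /asboolP hn; apply/asboolP.
by rewrite addrC -scaleN1r; exact: span_of_lin.
Qed.
HB.instance Definition _ := GRing.isZmodClosed.Build M span_pred span_zmod_closed.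

Definition qmod := Quotient.quot span_pred.
HB.instance Definition _ := GRing.Zmodule.on qmod.

Definition qpi (m : M) : qmod := (\pi_(Quotient.quot span_pred) m)%qT.
Definition qrepr (x : qmod) : M := generic_quotient.repr (x : Quotient.quot span_pred).

Lemma qreprK x : qpi (qrepr x) = x. Proof. exact: reprK. Qed.

Lemma qpi_eq m n : qpi m = qpi n <-> span_of (m - n).
Proof.
split=> [/eqP|h]; last apply/eqP; rewrite -Quotient.idealrBE; first by move/asboolP.
exact/asboolP.
Qed.

Lemma qpiD m n : qpi (m + n) = qpi m + qpi n.
Proof. exact: Quotient.pi_add. Qed.

Definition qscale (a : k) (x : qmod) : qmod := qpi (a *: qrepr x).

Lemma qpiZ a m : qpi (a *: m) = qscale a (qpi m).
Proof.
apply/qpi_eq; rewrite -scalerBr -[_ *: _]addr0; apply: span_of_lin.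
  by apply/qpi_eq; rewrite qreprK.
exact: span_of0.
Qed.

Fact qscaleA a b x : qscale a (qscale b x) = qscale (a * b) x.
Proof. by rewrite -[x]qreprK -!qpiZ scalerA. Qed.
Fact qscale1 : left_id 1 qscale.
Proof. by move=> x; rewrite -[x]qreprK -!qpiZ scale1r. Qed.
Fact qscaleDr : right_distributive qscale +%R.
Proof.
by move=> a x y; rewrite -[x]qreprK -[y]qreprK -qpiD -!qpiZ -qpiD scalerDr.
Qed.
Fact qscaleDl x : {morph qscale^~ x : a b / a + b}.
Proof. by move=> a b; rewrite -[x]qreprK -!qpiZ -qpiD scalerDl. Qed.
HB.instance Definition _ :=
  GRing.Zmodule_isLmodule.Build k qmod qscaleA qscale1 qscaleDr qscaleDl.

Lemma qpi_linear : linear qpi.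
Proof. by move=> a m n; rewrite qpiD qpiZ. Qed.

Lemma qpi_rel r : R r -> qpi r = qpi 0.
Proof.
move=> Rr; apply/qpi_eq; rewrite subr0 -[r]scale1r -[_ *: _]addr0.
exact: span_ofZD Rr span_of0.
Qed.

Lemma span_of_lift (N : lmodType k) (phi : M -> N) :
  linear phi -> (forall r, R r -> phi r = 0) -> forall m, span_of m -> phi m = 0.
Proof.
move=> lin kill m; elim=> [|a r m' Rr _ IH].
  exact: linear0P.
by rewrite lin kill // IH scaler0 addr0.
Qed.

Lemma qlift_pi (N : lmodType k) (phi : M -> N) :
  linear phi -> (forall r, R r -> phi r = 0) ->
  forall m, phi (qrepr (qpi m)) = phi m.
Proof.
move=> lin kill m; apply/eqP; rewrite -subr_eq0 addrC -scaleN1r -lin addrC scaleN1r.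
apply/eqP; apply: (span_of_lift lin kill); apply/qpi_eq; exact: qreprK.
Qed.

End Quotient.

Arguments qpi {k M} R m.
Arguments qrepr {k M R} x.

Record kCat (k : fieldType) := KCat {
  obj : Type;
  hom : obj -> obj -> lmodType k;  (* [hom C x y] is the space from x to y *)
  idc : forall x, hom x x;
  comp : forall x y z, hom y z -> hom x y -> hom x z;
  comp_linear_r : forall x y z (f : hom y z), linear (@comp x y z f);
  comp_linear_l : forall x y z (g : hom x y),
    linear (fun f : hom y z => comp f g);
  compA : forall x y z t (h : hom z t) (f : hom y z) (g : hom x y),
    comp h (comp f g) = comp (comp h f) g;
  comp1l : forall x y (f : hom x y), comp (idc y) f = f;
  comp1r : forall x y (f : hom x y), comp f (idc x) = f }.

Arguments hom {k} C x y : rename.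
Arguments idc {k C} x : rename.
Arguments comp {k C x y z} f g : rename.

Section FreeCategory.
Variables (k : fieldType) (L0 : Type) (V : L0 -> L0 -> lmodType k).
(* [V x y] is the space written _yV_x.                                        *)

(* [useq x y] is the type of the finite sequences (y = u_n, ..., u_0 = x).    *)
Inductive useq (x : L0) : L0 -> Type :=
  | useq0 : useq x x
  | useqS (y z : L0) of useq x y : useq x z.

HB.instance Definition _ x y := gen_eqMixin (useq x y).
HB.instance Definition _ x y := gen_choiceMixin (useq x y).

Fixpoint ucat x y z (v : useq y z) : useq x y -> useq x z :=
  match v in useq _ z return useq x y -> useq x z with
  | useq0 => fun u => u
  | useqS y' z v' => fun u => useqS z (ucat v' u)
  end.

Fixpoint vecs x y (u : useq x y) : choiceType :=
  match u with
  | useq0 => unit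
  | useqS y z u' => (V y z * vecs u')%type
  end.

(* [slot a r s t]: for some index i the i-th entries satisfy                  *)
(* r_i = a s_i + t_i, and r, s, t agree at all the other indices.             *)
Fixpoint slot x y (u : useq x y) (a : k) : vecs u -> vecs u -> vecs u -> Prop :=
  match u return vecs u -> vecs u -> vecs u -> Prop with
  | useq0 => fun _ _ _ => False
  | useqS y z u' => fun r s t =>
      [/\ r.1 = a *: s.1 + t.1, r.2 = s.2 & r.2 = t.2] \/
      [/\ r.1 = s.1, r.1 = t.1 & slot a r.2 s.2 t.2]
  end.

Section Tensor.
Variables (x y : L0) (u : useq x y).

Definition fvecs : lmodType k := dsum (fun _ : vecs u => k^o).
Definition fvec (s : vecs u) : fvecs := dinj (W := fun _ => k^o) (i := s) 1.
Definition multilinear_relators : set fvecs :=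
  [set m | exists a r s t, slot a r s t /\ m = fvec r - (a *: fvec s + fvec t)].

(* The tensor product W(u), as the quotient of the vector space with basis    *)
(* [vecs u] by the multilinearity relations; there is no relation if u is a   *)
(* singleton, and then W(u) = k.                                              *)
Definition tensor : lmodType k := qmod multilinear_relators.
Definition tens (s : vecs u) : tensor := qpi _ (fvec s).

Definition tlift (N : lmodType k) (phi : vecs u -> N) (w : tensor) : N :=
  dlift (fun s (c : k^o) => c *: phi s) (qrepr w).

Definition multilinear (N : lmodType k) (phi : vecs u -> N) :=
  forall a r s t, slot a r s t -> phi r = a *: phi s + phi t.

Lemma tens_multilinear : multilinear tens.
Proof.
move=> a r s t h; rewrite -qpi_linear; apply/qpi_eq.
rewrite -[_ - _]scale1r -[_ *: _]addr0; apply: span_ofZD; last exact: span_of0.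
by exists a, r, s, t.
Qed.

Section Lift.
Variables (N : lmodType k) (phi : vecs u -> N) (phi_ml : multilinear phi).

Let flin : linear (dlift (fun s (c : k^o) => c *: phi s) : fvecs -> N).
Proof. by apply: dlift_linear => s a b c; rewrite scalerDl -scalerA. Qed.

Let fvecE s : dlift (fun s (c : k^o) => c *: phi s) (fvec s) = phi s.
Proof.
by rewrite dlift_inj ?scale1r // => i a b c; rewrite scalerDl -scalerA.
Qed.

Let fkill r : multilinear_relators r ->
  dlift (fun s (c : k^o) => c *: phi s) r = 0.
Proof.
move=> [a [r' [s [t [h ->]]]]].
by rewrite addrC -scaleN1r flin scaleN1r flin !fvecE (phi_ml h) addNr.
Qed.

Lemma tlift_linear : linear (tlift phi).
Proof.
move=> a v w; rewrite -[v]qreprK -[w]qreprK -qpi_linear /tlift.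
by rewrite !(qlift_pi flin fkill) flin.
Qed.

Lemma tlift_tens s : tlift phi (tens s) = phi s.
Proof. by rewrite /tlift (qlift_pi flin fkill) fvecE. Qed.
End Lift.

Lemma tensor_ind (P : tensor -> Prop) :
  (forall a v w, P v -> P w -> P (a *: v + w)) -> P 0 ->
  (forall s, P (tens s)) -> forall w, P w.
Proof.
move=> PL P0 Pt w; rewrite -[w]qreprK.
elim/dsum_ind: (qrepr w) => [|f g Pf Pg|s c].
- by rewrite (linear0P (@qpi_linear _ _ _)).
- by rewrite -[f]scale1r qpi_linear; apply: PL.
- have -> : dinj (i := s) c = c *: fvec s + 0.
    rewrite addr0; apply: (@dsumP _ _ (fun _ => k^o)) => j; rewrite /= /dinj_fun.
    case: pselect => [e|_]; last by rewrite scaler0.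
    by case: _ / e; rewrite /GRing.scale /= mulr1.
  rewrite qpi_linear; apply: PL; first exact: Pt.
  by rewrite (linear0P (@qpi_linear _ _ _)).
Qed.

End Tensor.

Fixpoint vcat x y z (v : useq y z) (u : useq x y) :
    vecs v -> vecs u -> vecs (ucat v u) :=
  match v return vecs v -> vecs u -> vecs (ucat v u) with
  | useq0 => fun _ t => t
  | useqS y' z v' => fun s t => (s.1, vcat s.2 t)
  end.

Lemma slot_catl x y z (v : useq y z) (u : useq x y) a (r s t : vecs v)
  (q : vecs u) : slot a r s t -> slot a (vcat r q) (vcat s q) (vcat t q).
Proof.
elim: v u r s t q => [//|y' z' v IH] u r s t q /=.
case=> [[-> -> ->]|[-> -> h]]; first by left.
by right; split=> //; exact: IH.
Qed.

Lemma slot_catr x y z (v : useq y z) (u : useq x y) a (r s t : vecs u)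
  (q : vecs v) : slot a r s t -> slot a (vcat q r) (vcat q s) (vcat q t).
Proof.
elim: v u r s t q => [//|y' z' v IH] u r s t q /= h.
by right; split=> //; exact: IH.
Qed.

(* The map W(v) (x) W(u) -> W(vu), as a bilinear map.                         *)
Definition tcat x y z (v : useq y z) (u : useq x y) (w : tensor v)
    (w' : tensor u) : tensor (ucat v u) :=
  tlift (fun s => tlift (fun t => tens (vcat s t)) w') w.

Section TensorCat.
Variables (x y z : L0) (v : useq y z) (u : useq x y).

Let ml_r (s : vecs v) : multilinear (fun t : vecs u => tens (vcat s t)).
Proof. by move=> a r p q h; apply/tens_multilinear/slot_catr. Qed.

Let ml_l (w' : tensor u) :
  multilinear (fun s : vecs v => tlift (fun t => tens (vcat s t)) w').
Proof.
move=> a r p q h; elim/tensor_ind: w' => [b w1 w2 e1 e2||t].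
- rewrite !(tlift_linear (@ml_r _)) e1 e2 !scalerDr !scalerA addrACA.
  by rewrite [a * b]mulrC.
- by rewrite !(linear0P (tlift_linear (@ml_r _))) scaler0 addr0.
- by rewrite !(tlift_tens (@ml_r _)); apply/tens_multilinear/slot_catl.
Qed.

Lemma tcat_linear_l w' : linear (fun w : tensor v => tcat w w' : tensor (ucat v u)).
Proof. exact: tlift_linear. Qed.

Lemma tcat_tens s t : tcat (tens s) (tens t) = tens (vcat s t) :> tensor (ucat v u).
Proof. by rewrite /tcat tlift_tens ?tlift_tens. Qed.

Lemma tcat_linear_r w : linear (fun w' : tensor u => tcat w w' : tensor (ucat v u)).
Proof.
move=> a w1 w2; elim/tensor_ind: w => [b p q ep eq||s].
- rewrite !tcat_linear_l ep eq !scalerDr !scalerA addrACA.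
  by rewrite [a * b]mulrC.
- by rewrite !(linear0P (@tcat_linear_l _)) scaler0 addr0.
- by rewrite /tcat !(tlift_tens (@ml_l _)) (tlift_linear (@ml_r _)).
Qed.
End TensorCat.

Definition fhom x y : lmodType k := dsum (fun u : useq x y => tensor u).

Definition word x y (u : useq x y) (s : vecs u) : fhom x y :=
  dinj (W := fun u => tensor u) (tens s).

Lemma fhom_ind x y (P : fhom x y -> Prop) :
  P 0 -> (forall a f g, P f -> P g -> P (a *: f + g)) ->
  (forall u (s : vecs u), P (word s)) -> forall f, P f.
Proof.
move=> P0 PL Pw; apply: dsum_ind => [//|f g Pf Pg|u w].
  by rewrite -[f]scale1r; apply: PL.
elim/tensor_ind: w => [a v w Pv Pq||s]; last exact: Pw.
  by rewrite dinj_linear; apply: PL.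
by rewrite (linear0P (@dinj_linear _ _ _ _)).
Qed.

Definition fcomp x y z (f : fhom y z) (g : fhom x y) : fhom x z :=
  dlift (fun v w => dlift (fun u w' =>
    dinj (W := fun u => tensor u) (tcat w w') : fhom x z) g) f.

Section Comp.
Variables x y z : L0.

Let lin_r (v : useq y z) (w : tensor v) (u : useq x y) :
  linear (fun w' : tensor u =>
    dinj (W := fun u => tensor u) (tcat w w') : fhom x z).
Proof. by move=> a p q; rewrite tcat_linear_r dinj_linear. Qed.

Let lin_l (g : fhom x y) (v : useq y z) :
  linear (fun w : tensor v => dlift (fun u w' =>
    dinj (W := fun u => tensor u) (tcat w w') : fhom x z) g).
Proof.
move=> a p q; elim/fhom_ind: g => [|b g h eg eh|u s].
- by rewrite !(linear0P (dlift_linear (lin_r _))) scaler0 addr0.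
- rewrite !(dlift_linear (lin_r _)) eg eh !scalerDr !scalerA addrACA.
  by rewrite [a * b]mulrC.
- by rewrite /word !(dlift_inj (lin_r _)) tcat_linear_l dinj_linear.
Qed.

Lemma fcomp_linear_l (g : fhom x y) : linear (fun f : fhom y z => fcomp f g).
Proof. exact: dlift_linear. Qed.

Lemma fcomp_word (v : useq y z) (u : useq x y) (s : vecs v) (t : vecs u) :
  fcomp (word s) (word t) = word (vcat s t).
Proof.
by rewrite /fcomp /word (dlift_inj (lin_l _)) (dlift_inj (lin_r _)) tcat_tens.
Qed.

Lemma fcomp_linear_r (f : fhom y z) : linear (fun g : fhom x y => fcomp f g).
Proof.
move=> a p q; elim/fhom_ind: f => [|b f g ef eg|v s].
- by rewrite !(linear0P (@fcomp_linear_l _)) scaler0 addr0.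
- rewrite !fcomp_linear_l ef eg !scalerDr !scalerA addrACA.
  by rewrite [a * b]mulrC.
- by rewrite /fcomp /word !(dlift_inj (lin_l _)) (dlift_linear (lin_r _)).
Qed.
End Comp.

Lemma fcomp0l x y z (g : fhom x y) : fcomp (0 : fhom y z) g = 0.
Proof. exact: linear0P (@fcomp_linear_l x y z g). Qed.

Lemma fcomp0r x y z (f : fhom y z) : fcomp f (0 : fhom x y) = 0.
Proof. exact: linear0P (@fcomp_linear_r x y z f). Qed.

Definition fid x : fhom x x := word (u := useq0 x) tt.

Let wordT x y (p : {u : useq x y & vecs u}) : fhom x y := word (projT2 p).

Lemma vcatA x y z t (h : useq z t) (v : useq y z) (u : useq x y)
    (q : vecs h) (r : vecs v) (s : vecs u) :
  existT (fun u => vecs u) _ (vcat q (vcat r s)) =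
  existT (fun u => vecs u) _ (vcat (vcat q r) s).
Proof.
elim: h v q r => [//|t' z' h IH] v q r /=.
have := IH v q.2 r.
by move=> /(congr1 (fun p : {u : useq x t' & vecs u} =>
  existT (fun u : useq x z' => Choice.sort (vecs u)) (useqS z' (projT1 p)) (q.1, projT2 p))).
Qed.

Lemma vcat1r x y (v : useq x y) (s : vecs v) (t : vecs (useq0 x)) :
  existT (fun u => vecs u) _ (vcat s t) = existT (fun u => vecs u) _ s.
Proof.
elim: v s => [|y' z v IH] s; first by case: s; case: t.
have := IH s.2.
move=> /(congr1 (fun p : {u : useq x y' & vecs u} =>
  existT (fun u : useq x z => Choice.sort (vecs u)) (useqS z (projT1 p)) (s.1, projT2 p))) /=.
by case: s.
Qed.

Lemma fcompA x y z t (h : fhom z t) (f : fhom y z) (g : fhom x y) :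
  fcomp h (fcomp f g) = fcomp (fcomp h f) g.
Proof.
elim/fhom_ind: h => [|a h h' e e'|w q].
- by rewrite !fcomp0l.
- by rewrite !fcomp_linear_l e e'.
elim/fhom_ind: f => [|a f f' e e'|v r].
- by rewrite fcomp0l !fcomp0r fcomp0l.
- by rewrite !(fcomp_linear_l, fcomp_linear_r) e e'.
elim/fhom_ind: g => [|a g g' e e'|u s].
- by rewrite !fcomp0r.
- by rewrite !fcomp_linear_r e e'.
by rewrite !fcomp_word; have /(congr1 (@wordT _ _)) := vcatA q r s.
Qed.

Lemma fcomp1l x y (f : fhom x y) : fcomp (fid y) f = f.
Proof.
elim/fhom_ind: f => [|a f f' e e'|u s].
- exact: fcomp0r.
- by rewrite fcomp_linear_r e e'.
- exact: fcomp_word.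
Qed.

Lemma fcomp1r x y (f : fhom x y) : fcomp f (fid x) = f.
Proof.
elim/fhom_ind: f => [|a f f' e e'|u s].
- exact: fcomp0l.
- by rewrite fcomp_linear_l e e'.
- by rewrite fcomp_word; have /(congr1 (@wordT _ _)) := vcat1r s tt.
Qed.

Definition freecat : kCat k :=
  KCat (fun x y z => @fcomp_linear_r x y z) (fun x y z => @fcomp_linear_l x y z)
    fcompA fcomp1l fcomp1r.

End FreeCategory.

Section LinearAction.
Variables (k : fieldType) (G : finGroupType).

Record linact (M : lmodType k) := LinAct {
  lact : G -> M -> M;
  lact_linear : forall g, linear (lact g);
  lact1 : forall m, lact 1%g m = m;
  lactM : forall g h m, lact (g * h)%g m = lact g (lact h m) }.

(* An action on C by invertible k-linear endofunctors which are the identity  *)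
(* on objects.                                                                *)
Record cataction (C : kCat k) := CatAction {
  cact : forall x y : obj C, linact (hom C x y);
  cact_id : forall g (x : obj C), lact (cact x x) g (idc x) = idc x;
  cact_comp : forall g (x y z : obj C) (f : hom C y z) (f' : hom C x y),
    lact (cact x z) g (comp f f') = comp (lact (cact y z) g f) (lact (cact x y) g f') }.

Section FixedSpace.
Variables (M : lmodType k) (a : linact M).

Definition fixed_pred : {pred M} := fun m => `[< forall g, lact a g m = m >].

Fact fixed_submod_closed : submod_closed fixed_pred.
Proof.
split=> [|c m n /asboolP hm /asboolP hn]; apply/asboolP => g.
  exact: linear0P (lact_linear a g).
by rewrite lact_linear hm hn.
Qed.
HB.instance Definition _ :=
  GRing.isSubmodClosed.Build k M fixed_pred fixed_submod_closed.

Record fixmod := FixMod { fixval : M; fixvalP : fixval \in fixed_pred }.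
HB.instance Definition _ := [isSub for fixval].
HB.instance Definition _ := [Choice of fixmod by <:].
HB.instance Definition _ := [SubChoice_isSubLmodule of fixmod by <:].
End FixedSpace.

Variables (C : kCat k) (a : cataction C).

Let fx (x y : obj C) : lmodType k := fixmod (cact a x y).

Fact fixid_in (x : obj C) : idc x \in fixed_pred (cact a x x).
Proof. by apply/asboolP => g; exact: cact_id. Qed.
Definition fixid x : fx x x := FixMod (fixid_in x).

Fact fixcomp_in (x y z : obj C) (f : fx y z) (g : fx x y) :
  comp (fixval f) (fixval g) \in fixed_pred (cact a x z).
Proof.
have /asboolP hf := fixvalP f; have /asboolP hg := fixvalP g.
by apply/asboolP => h; rewrite cact_comp hf hg.
Qed.
Definition fixcomp x y z (f : fx y z) (g : fx x y) : fx x z :=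
  FixMod (fixcomp_in f g).

Fact fixcomp_linear_r x y z (f : fx y z) : linear (@fixcomp x y z f).
Proof. by move=> c g h; apply: val_inj; exact: comp_linear_r. Qed.
Fact fixcomp_linear_l x y z (g : fx x y) :
  linear (fun f : fx y z => fixcomp f g).
Proof. by move=> c f h; apply: val_inj; exact: comp_linear_l. Qed.
Fact fixcompA x y z t (h : fx z t) (f : fx y z) (g : fx x y) :
  fixcomp h (fixcomp f g) = fixcomp (fixcomp h f) g.
Proof. by apply: val_inj; exact: compA. Qed.
Fact fixcomp1l x y (f : fx x y) : fixcomp (fixid y) f = f.
Proof. by apply: val_inj; exact: comp1l. Qed.
Fact fixcomp1r x y (f : fx x y) : fixcomp f (fixid x) = f.
Proof. by apply: val_inj; exact: comp1r. Qed.

Definition fixcat : kCat k :=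
  KCat fixcomp_linear_r fixcomp_linear_l fixcompA fixcomp1l fixcomp1r.

End LinearAction.

Section HomogeneousAction.
Variables (k : fieldType) (L0 : Type) (V : L0 -> L0 -> lmodType k).
Variables (G : finGroupType) (rho : forall x y, linact G (V x y)).

Fixpoint vact (g : G) x y (u : useq x y) : vecs V u -> vecs V u :=
  match u return vecs V u -> vecs V u with
  | useq0 => id
  | useqS y' z u' => fun s => (lact (rho y' z) g s.1, vact g s.2)
  end.

Lemma slot_act g x y (u : useq x y) a (r s t : vecs V u) :
  slot a r s t -> slot a (vact g r) (vact g s) (vact g t).
Proof.
elim: u r s t => [//|y' z u IH] r s t /=.
case=> [[-> -> ->]|[-> -> h]]; first by left; rewrite lact_linear.
by right; split=> //; exact: IH.
Qed.

Lemma vact1 x y (u : useq x y) (s : vecs V u) : vact 1%g s = s.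
Proof. by elim: u s => [//|y' z u IH] [s t] /=; rewrite lact1 IH. Qed.

Lemma vactM g h x y (u : useq x y) (s : vecs V u) :
  vact (g * h)%g s = vact g (vact h s).
Proof. by elim: u s => [//|y' z u IH] [s t] /=; rewrite lactM IH. Qed.

Lemma vact_cat g x y z (v : useq y z) (u : useq x y) (s : vecs V v)
    (t : vecs V u) : vact g (vcat s t) = vcat (vact g s) (vact g t).
Proof. by elim: v u s t => [//|y' z' v IH] u s t /=; rewrite IH. Qed.

Definition tact g x y (u : useq x y) (w : tensor V u) : tensor V u :=
  tlift (fun s => tens (vact g s)) w.

Let ml_act g x y (u : useq x y) : multilinear (fun s : vecs V u => tens (vact g s)).
Proof. by move=> a r s t h; apply/tens_multilinear/slot_act. Qed.

Definition hact g x y (f : fhom V x y) : fhom V x y :=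
  dlift (fun u w => dinj (W := fun u => tensor V u) (tact g w) : fhom V x y) f.

Let lin_act g x y (u : useq x y) :
  linear (fun w => dinj (W := fun u => tensor V u) (i := u) (tact g w) : fhom V x y).
Proof. by move=> a v w; rewrite /tact (tlift_linear (@ml_act _ _ _ _)) dinj_linear. Qed.

Lemma hact_linear g x y : linear (@hact g x y).
Proof. exact: dlift_linear. Qed.

Lemma hact0 g x y : hact g (0 : fhom V x y) = 0.
Proof. exact: linear0P (@hact_linear g x y). Qed.

Lemma hact_word g x y (u : useq x y) (s : vecs V u) :
  hact g (word s) = word (vact g s).
Proof.
by rewrite /hact /word (dlift_inj (@lin_act _ _ _)) /tact (tlift_tens (@ml_act _ _ _ _)).
Qed.

Lemma hact1 x y (f : fhom V x y) : hact 1%g f = f.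
Proof.
elim/fhom_ind: f => [|a f f' e e'|u s].
- exact: hact0.
- by rewrite hact_linear e e'.
- by rewrite hact_word vact1.
Qed.

Lemma hactM g h x y (f : fhom V x y) : hact (g * h)%g f = hact g (hact h f).
Proof.
elim/fhom_ind: f => [|a f f' e e'|u s].
- by rewrite !hact0.
- by rewrite !hact_linear e e'.
- by rewrite !hact_word vactM.
Qed.

Definition hact_linact x y : linact G (fhom V x y) :=
  LinAct (fun g => @hact_linear g x y) (@hact1 x y) (fun g h => @hactM g h x y).

Lemma hact_comp g x y z (f : fhom V y z) (f' : fhom V x y) :
  hact g (fcomp f f') = fcomp (hact g f) (hact g f').
Proof.
elim/fhom_ind: f => [|a f h e e'|v r].
- by rewrite !(hact0, fcomp0l).
- by rewrite !(hact_linear, fcomp_linear_l) e e'.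
elim/fhom_ind: f' => [|a f h e e'|u s].
- by rewrite !(hact0, fcomp0r).
- by rewrite !(hact_linear, fcomp_linear_r) e e'.
- by rewrite !(hact_word, fcomp_word) vact_cat.
Qed.

Definition homogeneous : cataction G (freecat V) :=
  @CatAction k G (freecat V) hact_linact
    (fun g x => hact_word g (u := useq0 x) tt) hact_comp.

End HomogeneousAction.

Definition object_finite (k : fieldType) (C : kCat k) : Prop :=
  finite_set [set: obj C].

Definition fullsub (k : fieldType) (C : kCat k) (A : set (obj C)) : kCat k :=
  @KCat k {x | A x} (fun x y => hom C (sval x) (sval y))
    (fun x => idc (sval x)) (fun x y z f g => comp f g)
    (fun x y z f => comp_linear_r f) (fun x y z g => comp_linear_l g)
    (fun x y z t h f g => compA h f g)
    (fun x y f => comp1l f) (fun x y f => comp1r f).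

Definition kiso (k : fieldType) (C D : kCat k) : Prop :=
  exists (F : obj C -> obj D) (F1 : forall x y, hom C x y -> hom D (F x) (F y)),
  [/\ bijective F,
      forall x y, linear (F1 x y) /\ bijective (F1 x y),
      forall x, F1 x x (idc x) = idc (F x) &
      forall x y z (f : hom C y z) (g : hom C x y),
        F1 x z (comp f g) = comp (F1 y z f) (F1 x y g)].

Definition obj_iso (k : fieldType) (C : kCat k) (x y : obj C) : Prop :=
  exists (f : hom C x y) (g : hom C y x), comp g f = idc x /\ comp f g = idc y.

Section Modules.
Variables (k : fieldType) (C : kCat k).

Record cmod := CMod {
  mobj : obj C -> vectType k;
  mmap : forall x y, hom C x y -> 'Hom(mobj x, mobj y);
  mmap_linear : forall x y, linear (@mmap x y);
  mmap_id : forall x, mmap (idc x) = \1%VF;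
  mmap_comp : forall x y z (f : hom C y z) (g : hom C x y),
    mmap (comp f g) = (mmap f \o mmap g)%VF }.

Definition mod_iso (M N : cmod) : Prop :=
  exists phi : forall x, 'Hom(mobj M x, mobj N x),
    (forall x, bijective (phi x)) /\
    forall x y (f : hom C x y), (phi y \o mmap M f)%VF = (mmap N f \o phi x)%VF.

Definition is_submod (M : cmod) (U : forall x, {vspace mobj M x}) : Prop :=
  forall x y (f : hom C x y), (mmap M f @: U x <= U y)%VS.

Definition nonzero_sub (M : cmod) (U : forall x, {vspace mobj M x}) : Prop :=
  exists x, U x <> 0%VS.

Definition indecomposable (M : cmod) : Prop :=
  nonzero_sub (fun x => {: mobj M x}%VS) /\
  ~ exists U U' : forall x, {vspace mobj M x},
      [/\ is_submod U /\ is_submod U', nonzero_sub U, nonzero_sub U' &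
          forall x, (U x + U' x)%VS = {: mobj M x}%VS /\ (U x :&: U' x)%VS = 0%VS].

Definition finite_rep_type : Prop :=
  exists (n : nat) (N : 'I_n -> cmod),
    forall M, indecomposable M -> exists i, mod_iso M (N i).

(* The dimension of M is d: r enumerates representatives of the isomorphism   *)
(* classes of objects (the value does not depend on r).                       *)
Definition has_dim (M : cmod) (d : nat) : Prop :=
  exists (n : nat) (r : 'I_n -> obj C),
    [/\ forall i j, obj_iso (r i) (r j) -> i = j,
        forall x, exists i, obj_iso x (r i) &
        d = (\sum_(i < n) \dim {: mobj M (r i)})%N].

(* A one-parameter family: a k-linear functor to finitely generated free      *)
(* k[T]-modules, whose members are its specializations at T = c, c in k.      *)
Record family := Family {
  frank : obj C -> nat;
  fmap : forall x y, hom C x y -> 'M[{poly k}]_(frank y, frank x);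
  fmap_linear : forall x y a (f g : hom C x y),
    fmap (a *: f + g) = a%:P *: fmap f + fmap g;
  fmap_id : forall x, fmap (idc x) = 1%:M;
  fmap_comp : forall x y z (f : hom C y z) (g : hom C x y),
    fmap (comp f g) = fmap f *m fmap g }.

Definition in_family (F : family) (c : k) (M : cmod) : Prop :=
  exists phi : forall x, mobj M x -> 'cV[k]_(frank F x),
    (forall x, linear (phi x) /\ bijective (phi x)) /\
    forall x y (f : hom C x y) (m : mobj M x),
      phi y (mmap M f m) = map_mx (horner_eval c) (fmap F f) *m phi x m.

Definition one_parameter_tame : Prop :=
  forall d : nat, (0 < d)%N ->
    exists (n : nat) (F : 'I_n -> family) (m : nat) (N : 'I_m -> cmod),
      forall (M : cmod) (e : nat), indecomposable M -> has_dim M e -> (e <= d)%N ->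
        (exists i c, in_family (F i) c M) \/ (exists j, mod_iso M (N j)).

End Modules.

(* A multigraph: [ends e] are the two ends of the edge e, their order being   *)
(* irrelevant; a loop is an edge with equal ends.                             *)
Record mgraph := MGraph {
  vertex : Type;
  edge : Type;
  ends : edge -> vertex * vertex }.

Definition giso (Q R : mgraph) : Prop :=
  exists (phi : vertex Q -> vertex R) (psi : edge Q -> edge R),
  [/\ bijective phi, bijective psi &
      forall e, let: (x, y) := ends e in
        ends (psi e) = (phi x, phi y) \/ ends (psi e) = (phi y, phi x)].

Definition gunion (n : nat) (Q : 'I_n -> mgraph) : mgraph :=
  @MGraph {i : 'I_n & vertex (Q i)} {i : 'I_n & edge (Q i)}
    (fun e => let: existT i e := e in
      (existT _ i (ends e).1, existT _ i (ends e).2)).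

Inductive diagram :=
  | A_ of nat | D_ of nat | E6 | E7 | E8
  | extA of nat | extD of nat | extE6 | extE7 | extE8.

(* The vertices of d are 0, ..., [top d].                                     *)
Definition top (d : diagram) : nat :=
  match d with
  | A_ n => n.-1 | D_ n => n.-1 | E6 => 5 | E7 => 6 | E8 => 7
  | extA n => n | extD n => n | extE6 => 6 | extE7 => 7 | extE8 => 8
  end.

Definition chain (n : nat) : seq (nat * nat) := [seq (i, i.+1) | i <- iota 0 n].

Definition edges (d : diagram) : seq (nat * nat) :=
  match d with
  | A_ n => chain n.-1
  | D_ n => (n - 3, n.-1)%N :: chain (n - 2)
  | E6 => (2, 5) :: chain 4
  | E7 => (2, 6) :: chain 5
  | E8 => (2, 7) :: chain 6
  | extA n => (n, 0) :: chain n
  | extD n => [:: (1, n.-1), (n - 3, n) & chain (n - 2)]%N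
  | extE6 => [:: (2, 5), (5, 6) & chain 4]
  | extE7 => (3, 7) :: chain 6
  | extE8 => (2, 8) :: chain 7
  end.

Definition dynkin_or_extended (d : diagram) : bool :=
  match d with
  | A_ n => (1 <= n)%N
  | D_ n | extD n => (4 <= n)%N
  | _ => true
  end.

Definition diagram_graph (d : diagram) : mgraph :=
  @MGraph 'I_(top d).+1 'I_(size (edges d))
    (fun e => let: (x, y) := nth (0, 0)%N (edges d) e in (inord x, inord y)).

Definition is_dynkin_union (Q : mgraph) : Prop :=
  exists (n : nat) (d : 'I_n -> diagram),
    (forall i, dynkin_or_extended (d i)) /\
    giso Q (gunion (fun i => diagram_graph (d i))).

Definition is_basis (k : fieldType) (M : lmodType k) (B : set M) : Prop :=
  (forall n (b : 'I_n -> M) (c : 'I_n -> k), injective b -> (forall i, B (b i)) ->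
     \sum_(i < n) c i *: b i = 0 -> forall i, c i = 0) /\
  (forall m : M, exists n (b : 'I_n -> M) (c : 'I_n -> k),
     (forall i, B (b i)) /\ m = \sum_(i < n) c i *: b i).

(* The underlying graph of the bases-quiver given by bases B x y of _yV_x.    *)
Definition bases_graph (k : fieldType) (L0 : Type) (V : L0 -> L0 -> lmodType k)
    (B : forall x y, set (V x y)) : mgraph :=
  @MGraph L0 {x : L0 & {y : L0 & {v : V x y | B x y v}}}
    (fun e => (projT1 e, projT1 (projT2 e))).

Definition free_tame (k : fieldType) (L0 : Type) (V : L0 -> L0 -> lmodType k) :
    Prop :=
  exists B : forall x y, set (V x y),
    (forall x y, is_basis (B x y)) /\ is_dynkin_union (bases_graph B).

Definition is_free (k : fieldType) (C : kCat k) : Prop :=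
  exists (L0 : Type) (V : L0 -> L0 -> lmodType k), kiso C (freecat V).

(* The definition by one-parameter families depends on the ground field: over *)
(* a finite field it would hold for every finitely generated category.  For   *)
(* free categories tameness is therefore normalized, over any field, by the   *)
(* Donovan-Freislich list, which contains all the free categories of finite   *)
(* representation type; the definition by families is used for the others.    *)
Definition tame_rep_type (k : fieldType) (C : kCat k) : Prop :=
  (exists (L0 : Type) (V : L0 -> L0 -> lmodType k),
     kiso C (freecat V) /\ free_tame V) \/
  (~ is_free C /\ one_parameter_tame C).

Definition finitely_objects (k : fieldType) (P : kCat k -> Prop) (C : kCat k) :
    Prop :=
  forall A : set (obj C), object_finite (fullsub A) -> P (fullsub A).

(* Main.v *)
(* Choose in each V x y a basis containing a basis of the fixed vectors; the category     *)
(* becomes the path category of a quiver Q, and its full subcategories are the free       *)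
(* categories on their irreducible paths. A free category determines its quiver, since    *)
(* the arrows from x to y count derivations.                                              *)
(*   If an edge of Q is not a bridge, a family of modules built from Jordan blocks, with  *)
(* that edge acting by the block and the other edges by identities, shows that L is not of *)
(* finite type; if L is tame, inspecting the diagrams shows that the component of this     *)
(* edge has all its degrees at most 2.                                                    *)
(*   On a component where all the edges are bridges, the spaces V x y have dimension at    *)
(* most 1, and the characters by which G acts on them derive from a potential on the      *)
(* vertices. So the fixed category is the disjoint union of the full subcategories of L   *)
(* on the level sets of the potential, and it inherits the representation type.           *)
(*   On the other components, the fixed category is spanned by the fixed paths. These are  *)
(* freely generated by the irreducible ones, because a fixed path whose beginning is fixed *)
(* has a fixed remainder. An irreducible fixed path is determined by its first arrow, and *)
(* by its last one, so its quiver also has degrees at most 2: its components are of type  *)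
(* A_n or extA n.                                                                         *)

From HB Require Import structures.
From mathcomp Require Import all_boot all_fingroup all_algebra.
From mathcomp Require Import finmap zify.
From mathcomp Require Import boolp classical_sets cardinality.
Require Import Defs.

Set Implicit Arguments.
Unset Strict Implicit.
Unset Printing Implicit Defensive.

Import GRing.Theory.
Local Open Scope classical_set_scope.
Local Open Scope ring_scope.

(** * Paths and free bases *)

(** Freeness is handled through [free_basis]: the values of the paths of a quiver form a basis of
    each morphism space. A subcategory spanned by a unitary set of paths is free on its irreducible
    paths ([irr_free_basis]). This applies to full subcategories and, because a fixed morphism is a
    combination of fixed paths ([fixed_support]), to the full subcategories of the fixed category.
    The quiver is an invariant ([free_basis_graph]), so tameness can be read on the basis adapted to
    the action.

    In the tame case a circuit makes its whole component of degree at most 2 ([core_absorb],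
    [nonbridge_deg_le2]). The vertices of the fixed quiver then split in two kinds. On forests, the
    level sets of the potential are full subcategories of the free category ([forest_fix_dynkin]).
    Elsewhere the fixed quiver also has degree at most 2 ([nonforest_fix_deg]), and [component_deg2]
    recognizes its components.

    In the finite case Jordan modules exclude circuits ([finite_type_bridge]), so everything is a
    forest, and an indecomposable module over the fixed category lives on a single level set
    ([fix_finite_type]). *)

Lemma sig_eq (T : Type) (P : T -> Prop) (u v : {x | P x}) : sval u = sval v -> u = v.
Proof.
case: u v => [x hx] [y hy] /= e; case: _ / e hy => hy.
by rewrite (Prop_irrelevance hx hy).
Qed.

Lemma existT_inj (T : Type) (P : T -> Type) x (a b : P x) :
  existT P x a = existT P x b -> a = b.
Proof.
move=> h; have := projT2_eq h.
by rewrite (Prop_irrelevance (projT1_eq h) erefl).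
Qed.

Lemma inj_surj_bij (S T : Type) (f : S -> T) :
  injective f -> (forall y, exists x, f x = y) -> bijective f.
Proof.
move=> f_inj f_surj; exists (fun y => sval (cid (f_surj y))) => [x|y].
  by apply: f_inj; case: cid.
by case: cid.
Qed.

Lemma bij_surj (S T : Type) (f : S -> T) : bijective f -> forall y, exists x, f x = y.
Proof. by case=> g _ gK y; exists (g y). Qed.

Section Linear.
Variables (k : fieldType) (M N : lmodType k) (f : M -> N).
Hypothesis f_lin : linear f.

Lemma lin0 : f 0 = 0. Proof. exact: linear0P. Qed.
Lemma linZ a m : f (a *: m) = a *: f m.
Proof. by rewrite -[a *: m]addr0 f_lin lin0 addr0. Qed.
Lemma linD m n : f (m + n) = f m + f n.
Proof. by rewrite -{1}[m]scale1r f_lin scale1r. Qed.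
Lemma linB m n : f (m - n) = f m - f n.
Proof. by rewrite -scaleN1r addrC f_lin scaleN1r addrC. Qed.
Lemma lin_sum (I : Type) (s : seq I) (F : I -> M) :
  f (\sum_(i <- s) F i) = \sum_(i <- s) f (F i).
Proof. by elim: s => [|i s IH]; rewrite ?big_nil ?lin0 // !big_cons linD IH. Qed.
Lemma lin_inj : (forall m, f m = 0 -> m = 0) -> injective f.
Proof. by move=> h m n e; apply/subr0_eq/h; rewrite linB e subrr. Qed.
End Linear.

Section FreeModule.
Variables (k : fieldType) (I : choiceType).

Definition kfun : lmodType k := dsum (fun _ : I => k^o).
Definition kbase (i : I) : kfun := dinj (W := fun _ => k^o) (i := i) 1.

Lemma dval_kbase i j : dval (kbase i) j = (i == j)%:R :> k.
Proof.
case: eqP => [<-|ne]; first by rewrite dinjE.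
by rewrite dinj_neq.
Qed.

Lemma kbase_inj : injective kbase.
Proof.
move=> i j /(congr1 (fun f : kfun => dval f j)); rewrite !dval_kbase eqxx.
by case: eqP => [//|_] /eqP; rewrite eq_sym oner_eq0.
Qed.

Lemma dinj_kbase i (c : k) : dinj (W := fun _ : I => k^o) (i := i) c = c *: kbase i.
Proof.
apply: (@dsumP _ _ (fun _ => k^o)) => j /=; rewrite /dinj_fun.
case: pselect => [e|_]; last by rewrite scaler0.
by case: _ / e; rewrite /= /GRing.scale /= mulr1.
Qed.

Lemma kfun_ind (P : kfun -> Prop) :
  P 0 -> (forall a f g, P f -> P g -> P (a *: f + g)) -> (forall i, P (kbase i)) ->
  forall f, P f.
Proof.
move=> P0 PL Pb f; elim/dsum_ind: f => [//|f g Pf Pg|i w].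
  by rewrite -[f]scale1r; apply: PL.
by rewrite dinj_kbase -[_ *: _]addr0; apply: PL.
Qed.

Lemma dval_lin i : linear (fun f : kfun => dval f i : k^o).
Proof. by []. Qed.

Lemma dvalZ i a (f : kfun) : dval (a *: f) i = a * (dval f i : k) :> k.
Proof. by []. Qed.

Lemma dval_sum i (J : Type) (r : seq J) (F : J -> kfun) :
  dval (\sum_(j <- r) F j) i = \sum_(j <- r) (dval (F j) i : k) :> k.
Proof. exact: (lin_sum (@dval_lin i)). Qed.

Section Extend.
Variables (N : lmodType k) (psi : I -> N).

Definition kext (f : kfun) : N := dlift (fun i (c : k^o) => c *: psi i) f.

Lemma kext_linear : linear kext.
Proof. by apply: dlift_linear => i a b c; rewrite scalerDl -scalerA. Qed.

Lemma kext_base i : kext (kbase i) = psi i.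
Proof.
by rewrite /kext dlift_inj ?scale1r // => j a b c; rewrite scalerDl -scalerA.
Qed.
End Extend.

Lemma lin_ext (N : lmodType k) (f g : kfun -> N) :
  linear f -> linear g -> (forall i, f (kbase i) = g (kbase i)) -> f =1 g.
Proof.
move=> fl gl h; apply: kfun_ind => [|a u v eu ev|//]; first by rewrite !lin0.
by rewrite fl gl eu ev.
Qed.

Lemma kext_supp (N : lmodType k) (psi : I -> N) (P : N -> Prop) :
  P 0 -> (forall a m n, P m -> P n -> P (a *: m + n)) ->
  forall f : kfun, (forall i, dval f i <> 0 -> P (psi i)) -> P (kext psi f).
Proof.
move=> P0 PL f h; have [X hX] := dsuppP f.
rewrite /kext (@dliftE _ _ _ _ _ _ _ X) //; last by move=> i a b c; rewrite scalerDl -scalerA.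
elim: (enum_fset X) => [|i s IH]; first by rewrite big_nil.
rewrite big_cons; have [->|/h Pi] := pselect (dval f i = 0); last exact: PL.
by rewrite scale0r add0r.
Qed.

Lemma kext_kbase (f : kfun) : kext kbase f = f.
Proof.
apply: (lin_ext (f := kext kbase) (g := id)) => //; first exact: kext_linear.
exact: kext_base.
Qed.
End FreeModule.

Arguments kbase {k I} i.

Lemma kext_map_dval (k : fieldType) (I J : choiceType) (m : I -> J) (f : kfun k I) i :
  injective m -> dval (kext (fun i => kbase (m i)) f) (m i) = dval f i.
Proof.
move=> m_inj; elim/kfun_ind: f => [|a f g ef eg|j].
- by rewrite (lin0 (kext_linear _)).
- by rewrite kext_linear !dvalP ef eg.
- by rewrite kext_base !dval_kbase (inj_eq m_inj).
Qed.

Section Walks.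
Variables (X T : Type) (s t : T -> X).

(** The end maps are parameters, so that the same notion covers oriented paths ([src], [tgt] on
    arrows) and unoriented walks in a graph ([hs], [ht] on half-edges). *)
Fixpoint walk (x y : X) (l : seq T) : Prop :=
  if l is e :: l' then s e = x /\ walk (t e) y l' else x = y.

Lemma walk_cat x y z l l' : walk x y l -> walk y z l' -> walk x z (l ++ l').
Proof. by elim: l x => [|e l IH] x /=; [move=> -> | move=> [-> /IH]; auto]. Qed.

Lemma walk_split x z l l' : walk x z (l ++ l') -> exists y, walk x y l /\ walk y z l'.
Proof.
elim: l x => [|e l IH] x /=; first by exists x.
by move=> [-> /IH[y [h1 h2]]]; exists y.
Qed.

Lemma walk_end x y z l : walk x y l -> walk x z l -> y = z.
Proof. by elim: l x => [|e l IH] x /=; [move=> -> | move=> [_ h] [_]; exact: IH]. Qed.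

Lemma walk_start x y z l : l <> [::] -> walk x z l -> walk y z l -> x = y.
Proof. by case: l => [//|e l] _ /= [<- _] [<- _]. Qed.
End Walks.

Section Paths.
Variables (X : Type) (E : X -> X -> Type).

Definition arrow := {x : X & {y : X & E x y}}.
HB.instance Definition _ := gen_eqMixin arrow.
HB.instance Definition _ := gen_choiceMixin arrow.
Definition src (e : arrow) : X := projT1 e.
Definition tgt (e : arrow) : X := projT1 (projT2 e).
Definition mkarrow x y (e : E x y) : arrow := existT _ x (existT _ y e).

Lemma mkarrow_inj x y : injective (@mkarrow x y).
Proof. by move=> e e' h; exact: existT_inj (existT_inj h). Qed.

(* The arrows of a path are listed in order of traversal, so that [pcat p q] is p *)
(* followed by q; its value in a category is [comp (pval q) (pval p)].            *)
Definition qpath x y := {l : seq arrow | walk src tgt x y l}.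
HB.instance Definition _ x y := gen_eqMixin (qpath x y).
HB.instance Definition _ x y := gen_choiceMixin (qpath x y).

Definition pid x : qpath x x := exist (walk src tgt x x) [::] erefl.
Definition pcat x y z (p : qpath x y) (q : qpath y z) : qpath x z :=
  exist (walk src tgt x z) (sval p ++ sval q) (walk_cat (svalP p) (svalP q)).
Definition pone x y (e : E x y) : qpath x y :=
  exist (walk src tgt x y) [:: mkarrow e] (conj erefl erefl).

Lemma pcatA x y z t (p : qpath x y) (q : qpath y z) (r : qpath z t) :
  pcat p (pcat q r) = pcat (pcat p q) r.
Proof. by apply: sig_eq; rewrite /= catA. Qed.
Lemma pcat1p x y (p : qpath x y) : pcat (pid x) p = p.
Proof. exact: sig_eq. Qed.
Lemma pcatp1 x y (p : qpath x y) : pcat p (pid y) = p.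
Proof. by apply: sig_eq; rewrite /= cats0. Qed.

Lemma qpath_ind (P : forall x y, qpath x y -> Prop) :
  (forall x, P x x (pid x)) ->
  (forall x y z (e : E x y) (p : qpath y z), P y z p -> P x z (pcat (pone e) p)) ->
  forall x y p, P x y p.
Proof.
move=> P0 PS x y [l h]; elim: l x h => [|[x' [z e]] l IH] x h.
  by destruct h; rewrite (_ : exist _ _ _ = pid x) //; apply: sig_eq.
destruct h as [ex h']; destruct ex.
rewrite (_ : exist _ _ _ = pcat (pone e) (exist _ l h')); first exact: PS.
exact: sig_eq.
Qed.

Variable k : fieldType.
Let kp x y := kfun k (qpath x y).

Definition kcomp x y z (f : kp y z) (g : kp x y) : kp x z :=
  kext (fun q => kext (fun p => kbase (pcat p q)) g) f.

Lemma kcomp_base x y z (p : qpath x y) (q : qpath y z) :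
  kcomp (kbase q) (kbase p) = kbase (pcat p q).
Proof. by rewrite /kcomp !kext_base. Qed.

Lemma kcomp_linl x y z (g : kp x y) : linear (fun f : kp y z => kcomp f g).
Proof. exact: kext_linear. Qed.

Lemma kcomp_linr x y z (f : kp y z) : linear (fun g : kp x y => kcomp f g).
Proof.
move=> a g g'; elim/kfun_ind: f => [|b f f' ef ef'|q].
- by rewrite !(lin0 (@kcomp_linl _ _ _ _)) scaler0 addr0.
- rewrite !kcomp_linl ef ef' !scalerDr !scalerA addrACA.
  by rewrite [a * b]mulrC.
- by rewrite /kcomp !kext_base kext_linear.
Qed.

Lemma bilin_ext (N : lmodType k) x y z (F G : kp y z -> kp x y -> N) :
  (forall g, linear (F^~ g)) -> (forall f, linear (F f)) ->
  (forall g, linear (G^~ g)) -> (forall f, linear (G f)) ->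
  (forall p q, F (kbase q) (kbase p) = G (kbase q) (kbase p)) ->
  forall f g, F f g = G f g.
Proof.
move=> Fl Fr Gl Gr h f g.
apply: (lin_ext (f := F^~ g) (g := G^~ g)) => // q.
by apply: (lin_ext (f := F _) (g := G _)).
Qed.

Lemma kcompA x y z t (h : kp z t) (f : kp y z) (g : kp x y) :
  kcomp h (kcomp f g) = kcomp (kcomp h f) g.
Proof.
elim/kfun_ind: h => [|a h h' e e'|w].
- by rewrite !(lin0 (@kcomp_linl _ _ _ _)).
- by rewrite !kcomp_linl e e'.
apply: (bilin_ext (F := fun f g => kcomp _ (kcomp f g))
                  (G := fun f g => kcomp (kcomp _ f) g)) => //.
- by move=> g' a f1 f2; rewrite kcomp_linl kcomp_linr.
- by move=> g' a f1 f2; rewrite kcomp_linr kcomp_linr.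
- by move=> g' a f1 f2; rewrite kcomp_linr kcomp_linl.
- by move=> g' a f1 f2; rewrite kcomp_linr.
- by move=> p q; rewrite !kcomp_base pcatA.
Qed.

Lemma kcompp1 x y (f : kp x y) : kcomp f (kbase (pid x)) = f.
Proof.
apply: (lin_ext (f := fun f => kcomp f _) (g := id)) => //; first exact: kcomp_linl.
by move=> p; rewrite kcomp_base pcat1p.
Qed.

Lemma kcomp1p x y (f : kp x y) : kcomp (kbase (pid y)) f = f.
Proof.
apply: (lin_ext (f := fun f => kcomp _ f) (g := id)) => //; first exact: kcomp_linr.
by move=> p; rewrite kcomp_base pcatp1.
Qed.

End Paths.

Section Evaluation.
Variables (k : fieldType) (C : kCat k).
Variables (E : obj C -> obj C -> Type) (beta : forall x y, E x y -> hom C x y).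

Fixpoint seqval (x y : obj C) (l : seq (arrow E)) : walk (@src _ E) (@tgt _ E) x y l -> hom C x y :=
  match l return walk (@src _ E) (@tgt _ E) x y l -> hom C x y with
  | [::] => fun h => eq_rect x (fun z => hom C x z) (idc x) y h
  | e :: l' => fun '(conj h h') =>
      comp (seqval h')
        (eq_rect (src e) (fun z => hom C z (tgt e)) (beta (projT2 (projT2 e))) x h)
  end.

Definition pval x y (p : qpath E x y) : hom C x y :=
  let: exist l h := p in seqval h.

Lemma pval_id x : pval (pid E x) = idc x.
Proof. by []. Qed.

Lemma pval_one x y (e : E x y) : pval (pone e) = beta e.
Proof. exact: comp1l. Qed.

Lemma pval_cat x y z (p : qpath E x y) (q : qpath E y z) :
  pval (pcat p q) = comp (pval q) (pval p).
Proof.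
move: z q; elim/qpath_ind: p => [u z q|u v w e p IH z q].
  by rewrite pcat1p pval_id comp1r.
(* [seqval] reduces only on an explicit [conj]; proof irrelevance on paths brings the walk proof
   into that form. *)
have step t (r : qpath E v t) : pval (pcat (pone e) r) = comp (pval r) (beta e).
  case: r => l h.
  rewrite (_ : pcat _ _ = exist (walk _ _ u t) (mkarrow e :: l) (conj erefl h)) //.
  exact: sig_eq.
by rewrite -pcatA !step IH compA.
Qed.

Definition ev x y : kfun k (qpath E x y) -> hom C x y := kext (@pval x y).

Lemma ev_linear x y : linear (@ev x y).
Proof. exact: kext_linear. Qed.

Lemma ev_base x y (p : qpath E x y) : ev (kbase p) = pval p.
Proof. exact: kext_base. Qed.

Lemma ev_comp x y z (f : kfun k (qpath E y z)) (g : kfun k (qpath E x y)) :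
  ev (kcomp f g) = comp (ev f) (ev g).
Proof.
apply: (bilin_ext (F := fun f g => ev (kcomp f g)) (G := fun f g => comp (ev f) (ev g))).
- by move=> g' a f1 f2; rewrite kcomp_linl ev_linear.
- by move=> g' a f1 f2; rewrite kcomp_linr ev_linear.
- by move=> g' a f1 f2; rewrite ev_linear comp_linear_l.
- by move=> g' a f1 f2; rewrite ev_linear comp_linear_r.
- by move=> p q; rewrite kcomp_base !ev_base pval_cat.
Qed.

(** The working form of freeness: [C] is the path category of the quiver [E], with no reference to
    tensor products. *)
Definition free_basis := forall x y, bijective (@ev x y).

Hypothesis fb : free_basis.

Definition coord x y (f : hom C x y) : kfun k (qpath E x y) :=
  sval (cid (bij_surj (fb x y) f)).

Lemma coordK x y (f : hom C x y) : ev (coord f) = f.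
Proof. by rewrite /coord; case: cid. Qed.

Lemma evK x y : cancel (@ev x y) (@coord x y).
Proof. by move=> f; apply: (bij_inj (fb x y)); rewrite coordK. Qed.

Lemma coord_inj x y : injective (@coord x y).
Proof. exact: can_inj (@coordK x y). Qed.

Lemma coord_linear x y : linear (@coord x y).
Proof.
by move=> a f g; apply: (bij_inj (fb x y)); rewrite ev_linear !coordK.
Qed.

Lemma coord_comp x y z (f : hom C y z) (g : hom C x y) :
  coord (comp f g) = kcomp (coord f) (coord g).
Proof. by apply: (bij_inj (fb x z)); rewrite ev_comp !coordK. Qed.

Lemma coord_pval x y (p : qpath E x y) : coord (pval p) = kbase p.
Proof. by rewrite -ev_base evK. Qed.

Lemma coord_beta x y (e : E x y) : coord (beta e) = kbase (pone e).
Proof. by rewrite -pval_one coord_pval. Qed.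

Lemma coord_id x : coord (idc x) = kbase (pid E x).
Proof. by rewrite -pval_id coord_pval. Qed.

Lemma hom_ind x y (P : hom C x y -> Prop) :
  P 0 -> (forall a f g, P f -> P g -> P (a *: f + g)) -> (forall p, P (pval p)) ->
  forall f, P f.
Proof.
move=> P0 PL Pp f; rewrite -[f]coordK; elim/kfun_ind: (coord f) => [|a u v hu hv|p].
- by rewrite (lin0 (@ev_linear _ _)).
- by rewrite ev_linear; apply: PL.
- by rewrite ev_base.
Qed.
End Evaluation.

(** * Irreducible elements of a unitary set of paths *)

Section TransferFreeBasis.
Variables (k : fieldType) (C K : kCat k).
Variables (E : obj C -> obj C -> Type) (beta : forall x y, E x y -> hom C x y).
Hypothesis fb : free_basis beta.
Variables (o : obj K -> obj C) (io : forall x y, hom K x y -> hom C (o x) (o y)).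
Hypothesis io_lin : forall x y, linear (@io x y).
Hypothesis io_inj : forall x y, injective (@io x y).
Variables (E' : obj K -> obj K -> Type) (beta' : forall x y, E' x y -> hom K x y).
Variable pm : forall x y, qpath E' x y -> qpath E (o x) (o y).
Hypothesis pm_inj : forall x y, injective (@pm x y).
Hypothesis io_pval : forall x y (w : qpath E' x y), io (pval beta' w) = pval beta (pm w).
Hypothesis pm_surj : forall x y (g : hom K x y) p, dval (coord fb (io g)) p <> 0 ->
  exists w, pm w = p.

(** Evaluation in [K] followed by [io] agrees with the linear extension of [pm] followed by
    evaluation in [C]. The latter composite is injective, hence so is evaluation in [K]; it is onto
    because only paths in the image of [pm] occur in a morphism coming from [K]. *)
Lemma transfer_free_basis : free_basis beta'.
Proof.
move=> x y.
have io_ev f : io (ev beta' f) = ev beta (kext (fun w => kbase (@pm x y w)) f).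
  elim/kfun_ind: f => [|a f g ef eg|w].
  - rewrite (lin0 (kext_linear _)) !(lin0 (@ev_linear _ _ _ _ _ _)).
    by rewrite (lin0 (@io_lin _ _)).
  - by rewrite ev_linear io_lin kext_linear ev_linear ef eg.
  - by rewrite ev_base io_pval kext_base ev_base.
apply: inj_surj_bij => [|g].
  apply: (lin_inj (@ev_linear _ _ _ _ _ _)) => f f0.
  have := io_ev f; rewrite f0 (lin0 (@io_lin _ _)).
  move=> /(congr1 (coord fb (y := o y))); rewrite evK (lin0 (coord_linear fb (y := _))) => h.
  apply: dsumP => w; rewrite -(kext_map_dval f w (@pm_inj x y)).
  by rewrite -h.
have : exists f, io (ev beta' f) = io g.
  rewrite -[io g](coordK fb) -{1}[coord fb (io g)]kext_kbase.
  apply: (kext_supp (P := fun v => exists f, io (ev beta' f) = ev beta v)) =>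
    [|a u v [f ef] [f' ef']|p hp].
  - by exists 0; rewrite !(lin0 (@ev_linear _ _ _ _ _ _)) (lin0 (@io_lin _ _)).
  - by exists (a *: f + f'); rewrite !ev_linear io_lin ef ef'.
  - have [w <-] := pm_surj hp.
    by exists (kbase w); rewrite !ev_base io_pval.
by case=> f /io_inj <-; exists f.
Qed.
End TransferFreeBasis.

Section Subcategory.
Variables (k : fieldType) (C K : kCat k).
Variables (E : obj C -> obj C -> Type) (beta : forall x y, E x y -> hom C x y).
Hypothesis fb : free_basis beta.
Variables (o : obj K -> obj C) (io : forall x y, hom K x y -> hom C (o x) (o y)).
Hypotheses (o_inj : injective o) (io_lin : forall x y, linear (@io x y)).
Hypothesis io_inj : forall x y, injective (@io x y).
Hypothesis io_id : forall x, io (idc x) = idc (o x).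
Hypothesis io_comp : forall x y z (f : hom K y z) (g : hom K x y),
  io (comp f g) = comp (io f) (io g).
(** [D] consists of the paths whose values come from [K]: all the paths between retained objects for
    a full subcategory, the fixed paths for the fixed category. [D_unitary] makes factorizations
    into irreducibles unique, as for unitary submonoids of free monoids. *)
Variable D : forall x y : obj K, qpath E (o x) (o y) -> Prop.
Hypothesis D_img : forall x y (p : qpath E (o x) (o y)), D p -> exists g, io g = pval beta p.
Hypothesis D_supp : forall x y (g : hom K x y) p, dval (coord fb (io g)) p <> 0 -> D p.
Hypothesis D_unitary : forall x y z (p : qpath E (o x) (o y)) (q : qpath E (o y) (o z)),
  D p -> D (pcat p q) -> D q.

(** The cutting point [z] ranges over the objects of [K], so an irreducible path may run through
    vertices that [K] leaves out. *)
Definition irr x y (p : qpath E (o x) (o y)) : Prop :=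
  [/\ D p, sval p <> [::] &
      forall z (p1 : qpath E (o x) (o z)) (p2 : qpath E (o z) (o y)),
        pcat p1 p2 = p -> D p1 -> D p2 -> sval p1 = [::] \/ sval p2 = [::]].

Definition irrE x y := {p : qpath E (o x) (o y) | irr p}.

Definition irr_hom x y (e : irrE x y) : hom K x y :=
  let: exist p h := e in
  let: And3 d _ _ := h in sval (cid (D_img d)).

Lemma io_irr x y (e : irrE x y) : io (irr_hom e) = pval beta (sval e).
Proof. by case: e => p [d ne dec] /=; case: cid. Qed.

Definition flat (l : seq (arrow irrE)) : seq (arrow E) :=
  flatten [seq sval (sval (projT2 (projT2 e))) | e <- l].

Lemma flat_cons e l : flat (e :: l) = sval (sval (projT2 (projT2 e))) ++ flat l.
Proof. by []. Qed.

Lemma flat_walk x y l : walk (@src _ irrE) (@tgt _ irrE) x y l ->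
  walk (@src _ E) (@tgt _ E) (o x) (o y) (flat l).
Proof.
elim: l x => [|[x' [z e]] l IH] x /=; first by move=> ->.
by move=> [<- /IH]; apply: walk_cat; exact: (svalP (sval e)).
Qed.

Definition pflat x y (w : qpath irrE x y) : qpath E (o x) (o y) :=
  exist (walk _ _ (o x) (o y)) (flat (sval w)) (flat_walk (svalP w)).

Lemma io_pval x y (w : qpath irrE x y) : io (pval irr_hom w) = pval beta (pflat w).
Proof.
elim/qpath_ind: w => [u|u v w e p IH].
  rewrite pval_id io_id (_ : pflat _ = pid E (o u)) //; exact: sig_eq.
rewrite pval_cat io_comp IH pval_one io_irr -pval_cat; congr pval.
by apply: sig_eq.
Qed.

(* Of two factors starting the same path, one is a prefix of the other; by [D_unitary] *)
(* the quotient is in D, so it is trivial when both factors are irreducible.         *)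
Lemma irr_prefix_eq (a1 a2 : arrow irrE) t1 t2 : src a1 = src a2 ->
  sval (sval (projT2 (projT2 a1))) ++ t1 = sval (sval (projT2 (projT2 a2))) ++ t2 ->
  a1 = a2.
Proof.
have first_eq u v1 v2 (e1 : irrE u v1) (e2 : irrE u v2) r1 r2 :
    sval (sval e1) ++ r1 = sval (sval e2) ++ r2 ->
    (size (sval (sval e1)) <= size (sval (sval e2)))%N ->
    mkarrow e1 = mkarrow e2.
  move=> eq12 le12.
  have pre : sval (sval e2) = sval (sval e1) ++ drop (size (sval (sval e1))) (sval (sval e2)).
    have := congr1 (take (size (sval (sval e1)))) eq12.
    by rewrite take_size_cat // takel_cat // => h; rewrite [X in X ++ _]h cat_take_drop.
  have [s hs] : exists s, drop (size (sval (sval e1))) (sval (sval e2)) = s by eexists.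
  rewrite hs in pre.
  have h2 := svalP (sval e2); rewrite /= pre in h2.
  have [m [h1 hr]] := walk_split h2.
  have em := walk_end h1 (svalP (sval e1)); rewrite {}em in hr h1.
  have [r er] : exists r : qpath E (o v1) (o v2), sval r = s.
    by exists (exist (walk _ _ (o v1) (o v2)) s hr).
  have cat_r : pcat (sval e1) r = sval e2 by apply: sig_eq; rewrite /= er pre.
  have [d1 ne1 _] := svalP e1; have [d2 _ dec2] := svalP e2.
  have dr : D r by apply: (D_unitary d1); rewrite cat_r.
  have [//|/= s0] := dec2 _ _ _ cat_r d1 dr; rewrite er in s0.
  have ev : v1 = v2 by apply: o_inj; move: hr; rewrite s0.
  move: e2 pre {eq12 le12 hs h2 hr d2 dec2 r er cat_r dr}; case: v2 / ev => e2 pre.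
  by congr mkarrow; apply: sig_eq; apply: sig_eq; rewrite pre s0 cats0.
case: a1 a2 => [u [v1 e1]] [u2 [v2 e2]] /= eu; case: u2 / eu e2 => e2 eq12.
have [h|h] := leqP (size (sval (sval e1))) (size (sval (sval e2))).
  exact: first_eq eq12 h.
by symmetry; apply: first_eq (esym eq12) (ltnW h).
Qed.

(** The mirror image of [irr_prefix_eq], by cancellation on the other side; it serves to count the
    irreducible paths arriving at a vertex. *)
Lemma irr_suffix_eq
    (D_counitary : forall x y z (p : qpath E (o x) (o y)) (q : qpath E (o y) (o z)),
       D q -> D (pcat p q) -> D p)
    (a1 a2 : arrow irrE) t1 t2 : tgt a1 = tgt a2 ->
  t1 ++ sval (sval (projT2 (projT2 a1))) = t2 ++ sval (sval (projT2 (projT2 a2))) ->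
  a1 = a2.
Proof.
have last_eq u1 u2 v (e1' : irrE u1 v) (e2' : irrE u2 v) s1 s2 :
    s1 ++ sval (sval e1') = s2 ++ sval (sval e2') ->
    (size (sval (sval e1')) <= size (sval (sval e2')))%N ->
    mkarrow e1' = mkarrow e2'.
  move=> eq12 le12.
  pose n := (size (sval (sval e2')) - size (sval (sval e1')))%N.
  have suf : sval (sval e2') = take n (sval (sval e2')) ++ sval (sval e1').
    have sz : size (s1 ++ sval (sval e1')) = size (s2 ++ sval (sval e2')) by rewrite eq12.
    have sz1 : size s1 = (size s2 + n)%N.
      by move: sz le12; rewrite /n !size_cat; move: (size _) (size _) (size _) (size _); lia.
    have := congr1 (drop (size s1)) eq12.
    rewrite drop_size_cat // drop_cat sz1 ltnNge leq_addr /= addKn => h.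
    by rewrite [X in _ ++ X]h cat_take_drop.
  have [s hs] : exists s, take n (sval (sval e2')) = s by eexists.
  rewrite hs in suf.
  have h2 := svalP (sval e2'); rewrite /= suf in h2.
  have [m [hr h1]] := walk_split h2.
  have [_ ne1 _] := svalP e1'.
  have em := walk_start ne1 h1 (svalP (sval e1')); rewrite {}em in hr h1.
  have [r er] : exists r : qpath E (o u2) (o u1), sval r = s.
    by exists (exist (walk _ _ (o u2) (o u1)) s hr).
  have cat_r : pcat r (sval e1') = sval e2' by apply: sig_eq; rewrite /= er suf.
  have [d1 _ _] := svalP e1'; have [d2 _ dec2] := svalP e2'.
  have dr : D r by apply: (D_counitary _ _ _ _ _ d1); rewrite cat_r.
  have [/= s0|//] := dec2 _ _ _ cat_r dr d1; rewrite er in s0.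
  have ev : u2 = u1 by apply: o_inj; move: hr; rewrite s0.
  move: e2' suf {eq12 le12 n hs h2 hr d2 dec2 r er cat_r dr}.
  case: u1 / ev e1' ne1 h1 d1 => e1' _ _ _ e2' suf.
  by congr mkarrow; apply: sig_eq; apply: sig_eq; rewrite suf s0.
case: a1 a2 => [u1 [v e1]] [u2 [v2 e2]] eu; have {}eu : v = v2 := eu; case: v2 / eu e2 => e2 eq12.
have [h|h] := leqP (size (sval (sval e1))) (size (sval (sval e2))).
  exact: last_eq eq12 h.
by symmetry; apply: last_eq (esym eq12) (ltnW h).
Qed.

(** The first factors agree by [irr_prefix_eq] and can be cancelled; irreducible paths have positive
    length, so the two lists end together. *)
Lemma flat_inj x y l1 l2 : walk (@src _ irrE) (@tgt _ irrE) x y l1 ->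
  walk (@src _ irrE) (@tgt _ irrE) x y l2 -> flat l1 = flat l2 -> l1 = l2.
Proof.
have nonempty (e : arrow irrE) : sval (sval (projT2 (projT2 e))) <> [::].
  by case: e => [a [b [p [d ne dec]]]].
elim: l1 x l2 => [|e1 l1 IH] x [|e2 l2] //.
- move=> _ _; rewrite flat_cons => /esym/(congr1 size)/eqP.
  by rewrite size_cat addn_eq0 => /andP[/nilP/nonempty].
- move=> _ _; rewrite flat_cons => /(congr1 size)/eqP.
  by rewrite size_cat addn_eq0 => /andP[/nilP/nonempty].
rewrite !flat_cons => -[s1 w1] [s2 w2] eq12.
have e12 := irr_prefix_eq (etrans s1 (esym s2)) eq12.
case: e2 / e12 s2 w2 eq12 => _ w2 /eqP; rewrite eqseq_cat // => /andP[_ /eqP eql].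
by congr (_ :: _); apply: (IH _ _ w1 w2).
Qed.

Lemma pflat_inj x y : injective (@pflat x y).
Proof.
move=> w1 w2 /(congr1 (@sval _ _)) e; apply: sig_eq.
exact: (flat_inj (svalP w1) (svalP w2)).
Qed.

(** Strong induction on the length: a path of [D] that is neither trivial nor irreducible is a
    product of two nontrivial, hence shorter, paths of [D]. *)
Lemma pflat_surj x y (p : qpath E (o x) (o y)) : D p -> exists w, pflat w = p.
Proof.
have [n] := ubnP (size (sval p)); elim: n => // n IH in x y p *; rewrite ltnS => le_n dp.
have [p0|ne] := pselect (sval p = [::]).
  have exy : x = y by apply: o_inj; have := svalP p; rewrite /= p0.
  case: y / exy p p0 {le_n dp} => p p0.
  by exists (pid irrE x); apply: sig_eq; rewrite p0.
have [ip|nip] := pselect (irr p).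
  exists (pone (exist _ p ip : irrE x y)); apply: sig_eq => /=.
  by rewrite /flat /= cats0.
have [z [p1 [p2 [pp d1 d2 n1 n2]]]] : exists z p1 p2,
    [/\ @pcat _ _ _ (o z) _ p1 p2 = p, D p1, D p2, sval p1 <> [::] & sval p2 <> [::]].
  apply: contrapT => h; apply: nip; split=> // z p1 p2 pp d1 d2.
  have [|n1] := pselect (sval p1 = [::]); first by left.
  have [|n2] := pselect (sval p2 = [::]); first by right.
  by case: h; exists z, p1, p2.
have sz : size (sval p) = (size (sval p1) + size (sval p2))%N.
  by rewrite -pp /= size_cat.
have pos1 : (0 < size (sval p1))%N by rewrite lt0n; apply/eqP => /size0nil.
have pos2 : (0 < size (sval p2))%N by rewrite lt0n; apply/eqP => /size0nil.
have [w1 e1] : exists w, pflat w = p1.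
  by apply: IH d1; apply: leq_trans le_n; rewrite sz -addn1 leq_add2l.
have [w2 e2] : exists w, pflat w = p2.
  by apply: IH d2; apply: leq_trans le_n; rewrite sz -add1n leq_add2r.
exists (pcat w1 w2); rewrite -pp -e1 -e2; apply: sig_eq => /=.
by rewrite /flat map_cat flatten_cat.
Qed.

Theorem irr_free_basis : free_basis irr_hom.
Proof.
apply: (transfer_free_basis (fb := fb) io_lin io_inj pflat_inj io_pval) => x y g p /D_supp.
exact: pflat_surj.
Qed.
End Subcategory.

(** * Uniqueness of the quiver of a free category *)

(** A longest injection is onto, since a missed point would extend it. *)
Lemma max_injection (T : Type) m :
  (forall n (b : 'I_n -> T), injective b -> (n <= m)%N) ->
  exists n (c : 'I_n -> T), bijective c.
Proof.
move=> bound; pose P n := `[< exists b : 'I_n -> T, injective b >].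
have exP : exists n, P n.
  exists 0%N; apply/asboolP.
  by exists (fun i : 'I_0 => match i with Ordinal _ h => False_rect T (notF h) end) => -[].
have ubP n : P n -> (n <= m)%N by move/asboolP => [b]; apply: bound.
case: (ex_maxnP exP ubP) => n /asboolP[b b_inj] maxn; exists n, b.
apply: inj_surj_bij => // t; apply: contrapT => ht.
suff /maxn : P n.+1 by rewrite ltnn.
apply/asboolP; exists (fun i => if unlift ord_max i is Some j then b j else t) => i j.
case: unliftP => [i' ->|->]; case: unliftP => [j' ->|->] //.
- by move/b_inj => ->.
- by move=> e; case: ht; exists i'.
- by move=> e; case: ht; exists j'.
Qed.

Lemma inj_fin_bij (T : Type) (F : finType) (f : T -> F) : injective f ->
  exists n (c : 'I_n -> T), bijective c.
Proof.
move=> f_inj; apply: (@max_injection _ #|F|) => n b b_inj.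
by rewrite -[n]card_ord; apply: (leq_card (f \o b)); exact: inj_comp.
Qed.

Section Coefficient.
Variables (k : fieldType) (X : Type) (E : X -> X -> Type).

(** Indexed by a list of arrows rather than by a path, so that one formula makes sense between all
    pairs of vertices; the value is 0 when [s] is not a path from [x] to [y]. *)
Definition coef x y (s : seq (arrow E)) (f : kfun k (qpath E x y)) : k^o :=
  if pselect (walk (@src _ E) (@tgt _ E) x y s) is left h
  then dval f (exist _ s h) else 0.

Lemma coef_linear x y s : linear (@coef x y s).
Proof.
move=> a f g; rewrite /coef; case: pselect => [h|_] //.
by rewrite scaler0 addr0.
Qed.

Lemma coef_base x y s (p : qpath E x y) : coef s (kbase p) = (sval p == s)%:R.
Proof.
rewrite /coef; case: pselect => [h|nh].
  rewrite dval_kbase; congr (nat_of_bool _)%:R.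
  by apply/eqP/eqP => [->|e] //; apply: sig_eq.
by case: eqP => // e; case: nh; rewrite -e; exact: svalP.
Qed.

(** A one-arrow path factors only as itself with a trivial path on one side: the coefficient is a
    derivation relative to the augmentation [coef [::]]. *)
Lemma coef_comp x y z (f : kfun k (qpath E y z)) (g : kfun k (qpath E x y)) b :
  coef [:: b] (kcomp f g) = coef [:: b] f * coef [::] g + coef [::] f * coef [:: b] g.
Proof.
apply: (bilin_ext (F := fun f g => coef [:: b] (kcomp f g)) (G := fun f g =>
  coef [:: b] f * coef [::] g + coef [::] f * coef [:: b] g : k^o)).
- by move=> g' a f1 f2; rewrite kcomp_linl coef_linear.
- by move=> g' a f1 f2; rewrite kcomp_linr coef_linear.
- move=> g' a f1 f2; rewrite !coef_linear !mulrDl scalerDr addrACA.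
  by rewrite /GRing.scale /= !mulrA.
- move=> g' a f1 f2; rewrite !coef_linear !mulrDr scalerDr addrACA.
  by rewrite /GRing.scale /= !(mulrCA a).
move=> p q; rewrite kcomp_base !coef_base /=.
case: (sval p) (sval q) => [|e [|e' l]] [|e2 l2];
  rewrite /= ?eqxx /= ?mulr1 ?mul1r ?mulr0 ?mul0r ?add0r ?addr0 //.
all: by rewrite ?eqseq_cons /= ?andbF ?andbT ?cats0 ?eqseq_cons /= ?andbF ?andbT.
Qed.
End Coefficient.

Section Compare.
Variables (k : fieldType) (C : kCat k).
Variables (E1 : obj C -> obj C -> Type) (beta1 : forall x y, E1 x y -> hom C x y).
Variables (E2 : obj C -> obj C -> Type) (beta2 : forall x y, E2 x y -> hom C x y).
Hypotheses (fb1 : free_basis beta1) (fb2 : free_basis beta2).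

(* Extracting from f the coefficient of the path reduced to the arrow b is a derivation   *)
(* (see [coef_comp]), hence it is determined by its values on any free basis. If E2 had   *)
(* fewer arrows from x to y, some nontrivial combination of these derivations would vanish. *)
Lemma arrow_bound x y n (b : 'I_n -> E1 x y) m (c : 'I_m -> E2 x y) :
  injective b -> (forall e, exists j, c j = e) -> (n <= m)%N.
Proof.
move=> b_inj c_surj; rewrite leqNgt; apply/negP => lt_mn.
pose del i u v (f : hom C u v) : k^o := coef [:: mkarrow (b i)] (coord fb1 f).
have del_lin i u v : linear (@del i u v).
  by move=> a f g; rewrite /del coord_linear coef_linear.
pose M : 'M[k]_(n, m) := \matrix_(i, j) del i _ _ (beta2 (c j)).
have /rowV0Pn[a /sub_kermxP aM a0] : kermx M != 0.
  rewrite -mxrank_eq0 mxrank_ker -lt0n subn_gt0.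
  exact: leq_ltn_trans (rank_leq_col _) lt_mn.
pose dl u v (f : hom C u v) : k^o := \sum_i a 0 i * del i u v f.
have dl_lin u v : linear (@dl u v).
  move=> t f g; rewrite /dl scaler_sumr -big_split; apply: eq_bigr => i _.
  by rewrite del_lin mulrDr; congr (_ + _); rewrite /GRing.scale /= mulrCA.
have dl_comp u v w (f : hom C v w) (g : hom C u v) :
    dl _ _ (comp f g) = dl _ _ f * coef [::] (coord fb1 g) + coef [::] (coord fb1 f) * dl _ _ g.
  rewrite /dl mulr_suml mulr_sumr -big_split; apply: eq_bigr => i _.
  rewrite /del coord_comp coef_comp mulrDr mulrA; congr (_ + _).
  by rewrite mulrCA.
(* From [x] to [y] this is the relation [a *m M = 0]; between other vertices the one-arrow list
   [[:: mkarrow (b i)]] is not a path. *)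
have dl_gen u v (e : E2 u v) : dl _ _ (beta2 e) = 0.
  have [[ux vy]|h] := pselect (u = x /\ v = y); last first.
    rewrite /dl big1 // => i _; rewrite /del /coef; case: pselect => [|_]; last by rewrite mulr0.
    by by case=> e1 e2; case: h.
  subst u v; have [j <-] := c_surj e.
  have := congr1 (fun A : 'M_(_, _) => A 0 j) aM; rewrite !mxE => h.
  by rewrite -[RHS]h; apply: eq_bigr => i _; rewrite mxE.
have dl_path u v (w : qpath E2 u v) : dl _ _ (pval beta2 w) = 0.
  elim/qpath_ind: w => [u'|u' v' w' e p IH].
    rewrite pval_id /dl big1 // => i _; rewrite /del coord_id coef_base /=.
    by rewrite mulr0.
  by rewrite pval_cat dl_comp IH pval_one dl_gen mul0r mulr0 addr0.
have dl0 u v (f : hom C u v) : dl _ _ f = 0.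
  elim/(hom_ind fb2): f => [|t f g ef eg|//]; first by rewrite (lin0 (dl_lin _ _)).
  by rewrite dl_lin ef eg scaler0 addr0.
case/eqP: a0; apply/rowP => i; rewrite mxE -[RHS](dl0 _ _ (beta1 (b i))) /dl.
rewrite (bigD1 i) //= big1 => [|j ji]; rewrite /del coord_beta coef_base /=.
  by rewrite eqxx mulr1 addr0.
rewrite eqseq_cons andbT; case: eqP => [h|_]; last by rewrite mulr0.
by rewrite (b_inj _ _ (mkarrow_inj h)) eqxx in ji.
Qed.

End Compare.

Lemma arrows_bij (k : fieldType) (C : kCat k)
    (E1 : obj C -> obj C -> Type) (beta1 : forall x y, E1 x y -> hom C x y)
    (E2 : obj C -> obj C -> Type) (beta2 : forall x y, E2 x y -> hom C x y) :
  free_basis beta1 -> free_basis beta2 ->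
  forall x y m (c : 'I_m -> E2 x y), bijective c ->
  exists theta : E1 x y -> E2 x y, bijective theta.
Proof.
move=> fb1 fb2 x y m c c_bij.
have [n [b b_bij]] := max_injection (fun n b b_inj =>
  arrow_bound fb1 fb2 (b := b) b_inj (bij_surj c_bij)).
have le_nm := arrow_bound fb1 fb2 (bij_inj b_bij) (bij_surj c_bij).
have le_mn := arrow_bound fb2 fb1 (bij_inj c_bij) (bij_surj b_bij).
have e : n = m by apply/eqP; rewrite eqn_leq le_nm le_mn.
subst n; have [b' bK b'K] := b_bij; exists (c \o b').
by apply: bij_comp => //; exists b.
Qed.

Lemma giso_trans Q R S : giso Q R -> giso R S -> giso Q S.
Proof.
move=> [f [g [f_bij g_bij h]]] [f' [g' [f'_bij g'_bij h']]].
exists (f' \o f), (g' \o g); split; [exact: bij_comp|exact: bij_comp|move=> e /=].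
have := h e; case: (ends e) => x y h1; have := h' (g e); case: h1 => -> //.
by case; [right|left].
Qed.

Definition quiver_graph (X : Type) (E : X -> X -> Type) : mgraph :=
  @MGraph X (arrow E) (fun e => (src e, tgt e)).

Lemma quiver_graph_iso X (E E' : X -> X -> Type)
    (theta : forall x y, E x y -> E' x y) :
  (forall x y, bijective (theta x y)) -> giso (quiver_graph E) (quiver_graph E').
Proof.
move=> th_bij; exists id, (fun e => mkarrow (theta _ _ (projT2 (projT2 e)))); split.
- by exists id.
- apply: inj_surj_bij => [[x [y e]] [x' [y' e']]|[x [y e]]] /=.
    move=> h; have hx : x = x' := projT1_eq h; subst x'.
    have h2 := existT_inj h; have hy : y = y' := projT1_eq h2; subst y'.
    by rewrite (bij_inj (th_bij _ _) (existT_inj h2)).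
  have [e' <-] := bij_surj (th_bij x y) e.
  by exists (mkarrow e').
- by move=> e /=; left.
Qed.

Lemma dynkin_union_fin X (E : X -> X -> Type) : is_dynkin_union (quiver_graph E) ->
  forall x y, exists n (c : 'I_n -> E x y), bijective c.
Proof.
move=> [n [d [_ [f [g [_ g_bij _]]]]]] x y.
apply: (@inj_fin_bij _ {i : 'I_n & 'I_(size (edges (d i)))} (fun e => g (mkarrow e))).
by move=> e e' /(bij_inj g_bij) h; exact: mkarrow_inj h.
Qed.

(** Tameness comes with a free basis of its own; this carries the diagrams over to any other free
    basis. The arrow sets of a Dynkin union are finite, so [arrows_bij] applies. *)
Theorem free_basis_graph (k : fieldType) (C : kCat k)
    (E1 : obj C -> obj C -> Type) (beta1 : forall x y, E1 x y -> hom C x y)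
    (E2 : obj C -> obj C -> Type) (beta2 : forall x y, E2 x y -> hom C x y) :
  free_basis beta1 -> free_basis beta2 ->
  is_dynkin_union (quiver_graph E2) -> is_dynkin_union (quiver_graph E1).
Proof.
move=> fb1 fb2 du; have [n [d [d_ok iso]]] := du.
exists n, d; split=> //; apply: giso_trans iso.
have th x y : {theta : E1 x y -> E2 x y | bijective theta}.
  apply: cid; have [m [c c_bij]] := dynkin_union_fin du x y.
  exact: (arrows_bij fb1 fb2 c_bij).
by apply: (quiver_graph_iso (theta := fun x y => sval (th x y))) => x y; case: (th x y).
Qed.

(** * Bases and free presentations *)

Section Bases.
Variables (k : fieldType) (M : lmodType k).

Definition indep (B : set M) : Prop :=
  forall n (b : 'I_n -> M) (c : 'I_n -> k), injective b -> (forall i, B (b i)) ->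
    \sum_(i < n) c i *: b i = 0 -> forall i, c i = 0.

Definition in_span (B : set M) (m : M) : Prop :=
  exists n (b : 'I_n -> M) (c : 'I_n -> k),
    (forall i, B (b i)) /\ m = \sum_(i < n) c i *: b i.

Lemma indepU1 (B : set M) m : indep B -> ~ in_span B m -> indep (B `|` [set m]).
Proof.
move=> iB nm n b c b_inj bB c0.
have [[i0 bi0]|nb] := pselect (exists i, b i = m); last first.
  by apply: (iB n b) => // i; have [//|/= e] := bB i; case: nb; exists i.
case: n b c b_inj bB c0 i0 bi0 => [|n] b c b_inj bB c0 i0 bi0; first by case: i0 {bi0}.
have bB' j : B (b (lift i0 j)).
  have [//|/= e] := bB (lift i0 j).
  have /b_inj/eqP : b (lift i0 j) = b i0 by rewrite e bi0.
  by rewrite eq_sym (negbTE (neq_lift _ _)).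
rewrite (bigD1_ord i0) //= in c0.
have ci0 : c i0 = 0.
  apply: contrapT => /eqP ne; apply: nm.
  exists n, (fun j => b (lift i0 j)), (fun j => - (c i0)^-1 * c (lift i0 j)); split=> //.
  rewrite -bi0 -[LHS]scale1r -(mulVf ne) -scalerA.
  have -> : c i0 *: b i0 = - \sum_(j < n) c (lift i0 j) *: b (lift i0 j).
    by apply/eqP; rewrite -addr_eq0 c0.
  rewrite scalerN -scaleNr scaler_sumr; apply: eq_bigr => j _.
  by rewrite scalerA.
rewrite ci0 scale0r add0r in c0 => i.
case: (unliftP i0 i) => [j ->|-> //].
by apply: (iB n (fun j => b (lift i0 j)) (fun j => c (lift i0 j))) => // j1 j2 /b_inj/lift_inj.
Qed.

(** Zorn's lemma is applied to the sets [A] whose union with [S] is independent, so that the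
    independence of [S] takes care of the empty chain. By [indepU1] a maximal one, together with
    [S], spans [T]. *)
Lemma basis_extension (S T : set M) : indep S -> S `<=` T ->
  exists B, [/\ S `<=` B, B `<=` T, indep B & forall m, T m -> in_span B m].
Proof.
move=> iS ST; pose P (A : set M) := A `<=` T /\ indep (A `|` S).
have [F FP Ftot|A [[AT iA] Amax]] := @Zorn_bigcup _ P.
  split=> [m [X FX Xm]|n b c b_inj bF].
    by have [h _] := FP X FX; apply: h.
  (* The [b i] are finitely many and the chain is total, so one member contains all those outside
     [S]; [set0] serves when there are none. *)
  have [X [FX bX]] : exists X, (F X \/ X = set0) /\ forall i, i \in enum 'I_n -> (X `|` S) (b i).
    elim: (enum 'I_n) => [|i s [X [FX bX]]]; first by exists set0; split=> //; right.
    have [X' [FX' XX' bX']] : exists X', [/\ F X' \/ X' = set0, X `<=` X' & (X' `|` S) (b i)].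
      have [[Y FY Yb]|Sb] := bF i; last by exists X; split=> //; right.
      case: FX => [FX|->]; last by exists Y; split=> //; [left|left].
      have [h|h] := Ftot _ _ FX FY.
        by exists Y; split=> //; left.
      by exists X; split=> //; left => //; apply: h.
    exists X'; split=> // j; rewrite inE => /orP[/eqP -> //|/bX].
    by case=> [/XX'|]; [left|right].
  have iX : indep (X `|` S) by case: FX => [/FP[]//|->]; rewrite set0U.
  by apply: iX => // i; apply: bX; rewrite mem_enum.
exists (A `|` S); split; [by move=> m; right|by move=> m [/AT|/ST]|by []|].
move=> m Tm; apply: contrapT => nm.
apply: (Amax (A `|` [set m])).
  split=> [x|h]; first by left.
  apply: nm; exists 1%N, (fun=> m), (fun=> 1); split=> [_|].
    by left; apply: h; right.
  by rewrite big_ord1 scale1r.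
split=> [x [/AT //|/= -> //]|].
have -> : A `|` [set m] `|` S = A `|` S `|` [set m] by rewrite setUAC.
exact: indepU1.
Qed.

Definition vbasis (I : Type) (b : I -> M) : Prop := bijective (kext (I := {classic I}) b).

Lemma is_basis_vbasis (B : set M) : is_basis B -> vbasis (fun v : {v | B v} => sval v).
Proof.
move=> [iB sB]; apply: inj_surj_bij => [|m].
  apply: (lin_inj (kext_linear _)) => f f0; have [X hX] := dsuppP f.
  apply: dsumP => v; have [vX|] := boolP (v \in X); last exact: hX.
  move: f0; rewrite /kext (@dliftE _ _ _ _ _ _ _ X) //; last first.
    by move=> i a b c; rewrite scalerDl -scalerA.
  rewrite (big_tnth _ _ (enum_fset X)) => f0.
  have /(iB _ _ _)/(_ _ f0) h : injective (fun i => sval (tnth (in_tuple (enum_fset X)) i)).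
    by move=> i j /sig_eq; exact: (elimT (tuple_uniqP (in_tuple (enum_fset X))) (fset_uniq X)).
  have /(nthP v)[i ltiX vi] := vX.
  have := h (fun i => svalP _) (Ordinal ltiX).
  by rewrite (tnth_nth v) /= vi.
have [n [b [c [bB ->]]]] := sB m.
exists (\sum_i c i *: kbase (exist _ (b i) (bB i) : {classic _})).
rewrite (lin_sum (kext_linear _)); apply: eq_bigr => i _.
by rewrite (linZ (kext_linear _)) kext_base.
Qed.

Lemma vbasis_is_basis (I : Type) (b : I -> M) : vbasis b -> is_basis [set v | exists i, b i = v].
Proof.
move=> bb; split=> [n v c v_inj hv c0 i|m].
  pose j i : {classic I} := sval (cid (hv i)).
  have bj i' : b (j i') = v i' by rewrite /j; case: cid.
  have : \sum_i c i *: kbase (j i) = 0.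
    apply: (bij_inj bb); rewrite (lin0 (kext_linear _)) (lin_sum (kext_linear _)) -[RHS]c0.
    by apply: eq_bigr => i' _; rewrite (linZ (kext_linear _)) kext_base bj.
  move=> /(congr1 (fun f : kfun k {classic I} => dval f (j i))).
  rewrite dval_sum (eq_bigr (fun i' => c i' * (j i' == j i)%:R)) => [|i' _]; last first.
    by rewrite dvalZ dval_kbase.
  rewrite (bigD1 i) //= eqxx mulr1 big1 ?addr0 // => i' ii'.
  case: eqP => [e|_]; last by rewrite mulr0.
  have /v_inj e' : v i' = v i by rewrite -!bj; congr b; exact: e.
  by rewrite e' eqxx in ii'.
have [f <-] := bij_surj bb m; have [X hX] := dsuppP f.
exists (size (enum_fset X)), (fun i => b (tnth (in_tuple (enum_fset X)) i)),
  (fun i => dval f (tnth (in_tuple (enum_fset X)) i)); split=> [i|].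
  by eexists.
rewrite /kext (@dliftE _ _ _ _ _ _ _ X) //; last by move=> i a v c; rewrite scalerDl -scalerA.
exact: (big_tnth _ _ (enum_fset X)).
Qed.

Lemma vbasis_kbase_support (B S : set M) (f : kfun k {classic {v | B v}}) :
  is_basis B -> in_span S (kext (I := {classic {v | B v}}) (fun v => sval v) f) -> S `<=` B ->
  forall v, dval f v <> 0 -> S (sval v).
Proof.
move=> bB [n [b [c [bS e]]]] SB.
have {}e : f = \sum_i c i *: kbase (exist _ (b i) (SB _ (bS i)) : {classic _}).
  apply: (bij_inj (is_basis_vbasis bB)); rewrite e (lin_sum (kext_linear _)).
  by apply: eq_bigr => i _; rewrite (linZ (kext_linear _)) kext_base.
move=> v; rewrite e dval_sum => h; apply: contrapT => nS; apply: h.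
rewrite big1 // => i _; rewrite dvalZ dval_kbase.
by case: eqP => [ev|_]; [case: nS; rewrite -ev; exact: bS|rewrite mulr0].
Qed.
End Bases.

Section FreeCategoryBasis.
Variables (k : fieldType) (L0 : Type) (V : L0 -> L0 -> lmodType k).
Variables (E : L0 -> L0 -> Type) (eps : forall x y, E x y -> V x y).
Hypothesis eps_basis : forall x y, vbasis (@eps x y).

Definition letter x y (v : V x y) : hom (freecat V) x y :=
  word (V := V) (u := useqS y (useq0 x)) (v, tt).

Lemma letter_linear x y : linear (@letter x y).
Proof.
move=> a v w; rewrite /letter /word -dinj_linear; congr dinj.
by apply: tens_multilinear; left.
Qed.

Definition word_arrow (x y : obj (freecat V)) (e : E x y) : hom (freecat V) x y := letter (eps e).

Lemma vco_ex x y (v : V x y) : exists f, kext (@eps x y : {classic E x y} -> _) f = v.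
Proof. exact: (bij_surj (eps_basis x y)). Qed.

Definition vcoord x y (v : V x y) : kfun k {classic E x y} := sval (cid (vco_ex v)).

Lemma vcoordK x y (v : V x y) : kext (@eps x y : {classic E x y} -> _) (vcoord v) = v.
Proof. by rewrite /vcoord; case: cid. Qed.

Lemma vcoord_linear x y : linear (@vcoord x y).
Proof.
by move=> a v w; apply: (bij_inj (eps_basis x y)); rewrite kext_linear !vcoordK.
Qed.

Lemma vcoord_eps x y (e : E x y) : vcoord (eps e) = kbase (e : {classic E x y}).
Proof. by apply: (bij_inj (eps_basis x y)); rewrite vcoordK kext_base. Qed.

Definition ksingle x y (f : kfun k {classic E x y}) : kfun k (qpath E x y) :=
  kext (fun e : {classic E x y} => kbase (pone (e : E x y))) f.

Lemma ksingle_linear x y : linear (@ksingle x y).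
Proof. exact: kext_linear. Qed.

Fixpoint wcoord x y (u : useq x y) : vecs V u -> kfun k (qpath E x y) :=
  match u in useq _ y return vecs V u -> kfun k (qpath E x y) with
  | useq0 => fun _ => kbase (pid E x)
  | useqS y' z u' => fun s => kcomp (ksingle (vcoord s.1)) (wcoord s.2)
  end.

Lemma wcoord_multilinear x y (u : useq x y) : multilinear (@wcoord x y u).
Proof.
move=> a; elim: u => [//|y' z u IH] r s t /=.
case=> [[-> -> ->]|[-> -> h]].
  by rewrite vcoord_linear ksingle_linear kcomp_linl.
by rewrite (IH _ _ _ h) kcomp_linr.
Qed.

(** The inverse of evaluation: a word of vectors goes to the product of the expansions of its
    letters in the basis [eps], a multilinear expression and so well defined on tensors. *)
Definition fcoord x y (f : fhom V x y) : kfun k (qpath E x y) :=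
  dlift (fun u w => tlift (@wcoord x y u) w) f.

Lemma fcoord_linear x y : linear (@fcoord x y).
Proof. by apply: dlift_linear => u; apply: tlift_linear; exact: wcoord_multilinear. Qed.

Lemma fcoord_word x y (u : useq x y) (s : vecs V u) : fcoord (word s) = wcoord s.
Proof.
rewrite /fcoord /word dlift_inj ?tlift_tens //; first exact: wcoord_multilinear.
by move=> u'; apply: tlift_linear; exact: wcoord_multilinear.
Qed.

Lemma wcoord_cat x y z (v : useq y z) (u : useq x y) (s : vecs V v) (t : vecs V u) :
  wcoord (vcat s t) = kcomp (wcoord s) (wcoord t).
Proof.
elim: v u s t => [|y' z' v IH] u s t /=; first by rewrite kcomp1p.
by rewrite IH kcompA.
Qed.

Lemma fcoord_comp x y z (f : fhom V y z) (g : fhom V x y) :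
  fcoord (fcomp f g) = kcomp (fcoord f) (fcoord g).
Proof.
elim/fhom_ind: f => [|a f h e e'|v r].
- by rewrite fcomp0l !(lin0 (@fcoord_linear _ _)) (lin0 (@kcomp_linl _ _ _ _ _ _ _)).
- by rewrite !(fcoord_linear, fcomp_linear_l) kcomp_linl e e'.
elim/fhom_ind: g => [|a g h e e'|u s].
- by rewrite fcomp0r !(lin0 (@fcoord_linear _ _)) (lin0 (@kcomp_linr _ _ _ _ _ _ _)).
- by rewrite !(fcoord_linear, fcomp_linear_r) kcomp_linr e e'.
- by rewrite fcomp_word !fcoord_word wcoord_cat.
Qed.

Lemma fcoord_pval x y (p : qpath E x y) :
  fcoord (pval (C := freecat V) (E := E) word_arrow p) = kbase p.
Proof.
elim/qpath_ind: p => [u|u v w e p IH].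
  by rewrite pval_id /= /fid fcoord_word.
rewrite pval_cat fcoord_comp IH pval_one.
rewrite /word_arrow /letter fcoord_word /= vcoord_eps /ksingle kext_base kcompp1.
by rewrite kcomp_base.
Qed.

Lemma ev_ksingle x y (f : kfun k {classic E x y}) :
  ev (C := freecat V) (E := E) word_arrow (ksingle f) =
  letter (kext (@eps x y : {classic E x y} -> _) f).
Proof.
elim/kfun_ind: f => [|a f g ef eg|e].
- rewrite (lin0 (@ksingle_linear _ _)) (lin0 (kext_linear _)).
  by rewrite (lin0 (@ev_linear _ _ _ _ _ _)) (lin0 (@letter_linear _ _)).
- by rewrite ksingle_linear ev_linear kext_linear letter_linear ef eg.
- by rewrite /ksingle !kext_base ev_base pval_one.
Qed.

Lemma ev_wcoord x y (u : useq x y) (s : vecs V u) :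
  ev (C := freecat V) (E := E) word_arrow (wcoord s) = word s.
Proof.
elim: u s => [[]|y' z u IH s] /=; first by rewrite ev_base pval_id.
rewrite ev_comp ev_ksingle vcoordK IH.
by case: s => v s; exact: (fcomp_word (v := useqS z (useq0 y')) (v, tt) s).
Qed.

Theorem freecat_free_basis : free_basis (C := freecat V) (E := E) word_arrow.
Proof.
move=> x y; exists (@fcoord x y) => [f|f].
  elim/kfun_ind: f => [|a f g ef eg|p].
  - by rewrite (lin0 (@ev_linear _ _ _ _ _ _)) (lin0 (@fcoord_linear _ _)).
  - by rewrite ev_linear fcoord_linear ef eg.
  - by rewrite ev_base fcoord_pval.
elim/fhom_ind: f => [|a f g ef eg|u s].
- by rewrite (lin0 (@fcoord_linear _ _)) (lin0 (@ev_linear _ _ _ _ _ _)).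
- by rewrite fcoord_linear ev_linear ef eg.
- by rewrite fcoord_word ev_wcoord.
Qed.

End FreeCategoryBasis.

Section Presentation.
Variables (k : fieldType) (C : kCat k).
Variables (E : obj C -> obj C -> Type) (beta : forall x y, E x y -> hom C x y).
Hypothesis fb : free_basis beta.

Let V x y : lmodType k := kfun k {classic E x y}.
Let eps x y (e : E x y) : V x y := kbase (e : {classic E x y}).

Let eps_basis x y : vbasis (@eps x y).
Proof. by exists id => f; exact: kext_kbase. Qed.

Lemma free_basis_kiso : kiso C (freecat V).
Proof.
have fbV := freecat_free_basis eps_basis.
exists id, (fun x y f => ev (C := freecat V) (E := E) (word_arrow eps) (coord fb f)); split.
- by exists id.
- move=> x y; split; first by move=> a f g; rewrite coord_linear ev_linear.
  exists (fun g => ev beta (coord fbV g)) => f; first by rewrite evK coordK.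
  by rewrite evK coordK.
- by move=> x; rewrite coord_id ev_base pval_id.
- by move=> x y z f g; rewrite coord_comp ev_comp.
Qed.

Lemma free_basis_is_free : is_free C.
Proof. by exists (obj C), V; exact: free_basis_kiso. Qed.

(** [C] is isomorphic to the free category on the spaces spanned by the arrows, and the canonical
    bases of these spaces give back the quiver [E]. *)
Lemma free_basis_tame : is_dynkin_union (quiver_graph E) -> tame_rep_type C.
Proof.
move=> [n [d [d_ok iso]]]; left; exists (obj C), V; split; first exact: free_basis_kiso.
exists (fun x y => [set v | exists e, @eps x y e = v]); split=> [x y|].
  exact: vbasis_is_basis.
exists n, d; split=> //; apply: giso_trans iso.
pose th x y (v : {v : V x y | exists e, eps e = v}) : E x y := sval (cid (svalP v)).
have thK x y v : eps (th x y v) = sval v by rewrite /th; case: cid.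
apply: (@quiver_graph_iso _ (fun x y => {v : V x y | exists e, eps e = v}) _ th) => x y.
apply: inj_surj_bij => [v w e|e].
  by apply: sig_eq; rewrite -!thK e.
exists (exist _ (eps e) (ex_intro _ e erefl)).
exact: kbase_inj (thK _ _ (exist _ (eps e) (ex_intro _ e erefl))).
Qed.
End Presentation.

Lemma kiso_free_basis (k : fieldType) (C D : kCat k)
    (E : obj D -> obj D -> Type) (beta : forall x y, E x y -> hom D x y) :
  kiso C D -> free_basis beta ->
  exists (E' : obj C -> obj C -> Type) (beta' : forall x y, E' x y -> hom C x y),
    free_basis beta' /\ giso (quiver_graph E') (quiver_graph E).
Proof.
move=> [F [F1 [F_bij F1_bij F1_id F1_comp]]] fb.
pose E' x y := E (F x) (F y).
have beta'_ex x y (e : E' x y) : exists f, F1 x y f = beta (F x) (F y) e.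
  by have [_ b] := F1_bij x y; exact: bij_surj b _.
pose beta' x y (e : E' x y) := sval (cid (beta'_ex x y e)).
have F1_beta' x y e : F1 x y (beta' x y e) = beta (F x) (F y) e by rewrite /beta'; case: cid.
exists E', beta'.
pose em (e : arrow E') : arrow E := mkarrow (projT2 (projT2 e) : E (F (src e)) (F (tgt e))).
have em_inj : injective em.
  case=> [x [y e]] [x' [y' e']] h.
  have hx : x = x' := bij_inj F_bij (projT1_eq h); subst x'.
  have h2 := existT_inj h.
  have hy : y = y' := bij_inj F_bij (projT1_eq h2); subst y'.
  by have -> : e = e' := existT_inj h2.
have em_surj e : exists e', em e' = e.
  case: e => [u [v e]].
  have [x xu] := bij_surj F_bij u; subst u; have [y yv] := bij_surj F_bij v; subst v.
  by exists (mkarrow (e : E' x y)).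
have em_walk x y l : walk (@src _ E') (@tgt _ E') x y l ->
    walk (@src _ E) (@tgt _ E) (F x) (F y) (map em l).
  by elim: l x => [|e l IH] x /=; [move=> -> | move=> [<- /IH]].
have em_walkV x y l : walk (@src _ E) (@tgt _ E) (F x) (F y) (map em l) ->
    walk (@src _ E') (@tgt _ E') x y l.
  elim: l x => [|e l IH] x /=; first exact: bij_inj F_bij _ _.
  by move=> [/(bij_inj F_bij) <- /IH].
pose pm x y (w : qpath E' x y) : qpath E (F x) (F y) :=
  exist (walk _ _ (F x) (F y)) (map em (sval w)) (em_walk _ _ _ (svalP w)).
split; last first.
  exists F, em; split=> //; first exact: inj_surj_bij.
  by move=> e; left.
apply: (@transfer_free_basis _ _ _ E beta fb F F1 _ _ E' beta' pm).
- by move=> x y; have [] := F1_bij x y.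
- by move=> x y; have [_ /bij_inj] := F1_bij x y.
- move=> x y w1 w2 /(congr1 (@sval _ _)) /= h; apply: sig_eq.
  exact: (inj_map em_inj h).
- move=> x y w; elim/qpath_ind: w => [u|u v w e p IH].
    by rewrite pval_id F1_id (_ : pm _ _ _ = pid E (F u)) //; exact: sig_eq.
  rewrite pval_cat F1_comp IH pval_one F1_beta'.
  rewrite -(pval_one beta (e : E (F u) (F v))) -pval_cat; congr pval.
  exact: sig_eq.
- move=> x y _ [l h] _.
  have [l' el] : exists l', map em l' = l.
    elim: l {h} => [|e l [l' <-]]; first by exists [::].
    by have [e' <-] := em_surj e; exists (e' :: l').
  subst l; exists (exist _ l' (em_walkV _ _ _ h)); exact: sig_eq.
Qed.

(** * Dynkin unions *)

Section HalfEdges.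
Variable Q : mgraph.

(** A half-edge is an edge with a direction of travel, [true] meaning backwards. A loop yields two
    distinct half-edges at its vertex, so it counts twice in the degree. *)
Definition hedge := (edge Q * bool)%type.
Definition hs (h : hedge) : vertex Q := if h.2 then (ends h.1).2 else (ends h.1).1.
Definition flip (h : hedge) : hedge := (h.1, ~~ h.2).
Definition ht (h : hedge) : vertex Q := hs (flip h).

Lemma flipK : involutive flip.
Proof. by case=> e b; rewrite /flip /= negbK. Qed.

Lemma flip_neq h : flip h <> h.
Proof. by case: h => e [] []. Qed.

Lemma hedge_eq (h h' : hedge) : h.1 = h'.1 -> h = h' \/ h = flip h'.
Proof. by case: h h' => [e b] [e' b'] /= ->; case: b b' => [] []; [left|right|right|left]. Qed.

Definition deg_le2 (v : vertex Q) : Prop := forall h1 h2 h3 : hedge,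
  hs h1 = v -> hs h2 = v -> hs h3 = v -> h1 <> h2 -> h3 = h1 \/ h3 = h2.

(* The numbering of the vertices of a Dynkin or extended Dynkin diagram other than extA n  *)
(* is such that each vertex has at most one edge to a smaller one; [cyc] marks the vertices *)
(* of the components of type extA n.                                                       *)
Definition ranked : Prop := exists (r : vertex Q -> nat) (cyc : vertex Q -> Prop),
  [/\ forall h, cyc (hs h) -> cyc (ht h),
      forall v, cyc v -> deg_le2 v &
      forall v h1 h2, ~ cyc v -> hs h1 = v -> hs h2 = v ->
        (r (ht h1) <= r v)%N -> (r (ht h2) <= r v)%N -> h1 = h2].

Definition core (Z : vertex Q -> Prop) : Prop := forall v, Z v -> exists h1 h2 : hedge,
  [/\ h1 <> h2, hs h1 = v, hs h2 = v, Z (ht h1) & Z (ht h2)].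

(** If [Z] had a vertex that is not cyclic, choose one of largest rank: its two half-edges inside
    [Z] would lead to noncyclic vertices of no larger rank, which [ranked] forbids. So all of [Z] is
    cyclic. *)
Lemma core_deg_le2 (Z : vertex Q -> Prop) n (c : 'I_n -> vertex Q) :
  ranked -> (forall v, Z v -> exists i, c i = v) -> core Z ->
  forall v, Z v -> deg_le2 v.
Proof.
move=> [r [cyc [cyc_adj cyc_deg noncyc]]] Zfin Zcore v Zv; apply: cyc_deg.
apply: contrapT => ncv.
pose P j := `[< exists u, [/\ Z u, ~ cyc u & r u = j] >].
have exP : exists j, P j by exists (r v); apply/asboolP; exists v.
have ubP j : P j -> (j <= \max_(i < n) r (c i))%N.
  by move=> /asboolP[u [/Zfin[i <-] _ <-]]; exact: (leq_bigmax i).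
case: (ex_maxnP exP ubP) => j /asboolP[u [Zu ncu ruj]] maxj.
have [h1 [h2 [ne s1 s2 Z1 Z2]]] := Zcore u Zu.
apply/ne/(noncyc u) => //; rewrite ruj; apply: maxj; apply/asboolP.
  exists (ht h1); split=> // cy; apply: ncu; rewrite -s1 -[h1]flipK; exact: cyc_adj.
by exists (ht h2); split=> // cy; apply: ncu; rewrite -s2 -[h2]flipK; exact: cyc_adj.
Qed.

End HalfEdges.

Arguments deg_le2 Q v : clear implicits.
Arguments core Q Z : clear implicits.

Lemma ranked_giso (Q R : mgraph) : giso Q R -> ranked R -> ranked Q.
Proof.
move=> [f [g [f_bij g_bij compat]]] [r [cyc [cyc_adj cyc_deg noncyc]]].
(* A graph isomorphism may reverse edges; the boolean records whether it reverses [e]. *)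
have ho' e : exists o : bool, forall b, hs (g e, b (+) o) = f (hs (e, b)).
  move: (compat e); rewrite /hs /=; case E: (ends e) => [x y] [] E'.
    by exists false => -[] /=; rewrite E'.
  by exists true => -[] /=; rewrite E'.
pose o e := sval (cid (ho' e)); have ho e b := svalP (cid (ho' e)) b.
pose m (h : hedge Q) : hedge R := (g h.1, h.2 (+) o h.1).
have ms h : hs (m h) = f (hs h) by rewrite ho; case: h.
have mf h : m (flip h) = flip (m h) by rewrite /m /flip /= addNb.
have mt h : ht (m h) = f (ht h) by rewrite /ht -mf ms.
have m_inj : injective m.
  by move=> [e b] [e' b'] [/(bij_inj g_bij) <-] /addIb <-.
exists (r \o f), (cyc \o f); split=> [h|v cv h1 h2 h3 s1 s2 s3 ne|v h1 h2 ncv s1 s2] /=.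
- by rewrite -ms -mt; exact: cyc_adj.
- have := cyc_deg _ cv (m h1) (m h2) (m h3); rewrite !ms s1 s2 s3.
  case=> // [/m_inj //|/m_inj ->|/m_inj ->]; by [left|right].
- rewrite -!mt => r1 r2; apply: m_inj; apply: (noncyc (f v)) => //.
  + by rewrite ms s1.
  + by rewrite ms s2.
Qed.

Lemma ranked_gunion n (Q : 'I_n -> mgraph) : (forall i, ranked (Q i)) -> ranked (gunion Q).
Proof.
move=> rk; pose r i := sval (cid (rk i)).
pose cyc i := sval (cid (svalP (cid (rk i)))); have h i := svalP (cid (svalP (cid (rk i)))).
pose sub i (h : hedge (Q i)) : hedge (gunion Q) := (existT _ i h.1, h.2).
have sub_s i (g : hedge (Q i)) : hs (sub i g) = existT _ i (hs g) by case: g => e [].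
have sub_t i (g : hedge (Q i)) : ht (sub i g) = existT _ i (ht g) by case: g => e [].
have subP (g : hedge (gunion Q)) : exists i g', g = sub i g'.
  by case: g => [[i e] b]; exists i, (e, b).
have subPi i v (g : hedge (gunion Q)) : hs g = existT _ i v ->
    exists2 g', g = sub i g' & hs g' = v.
  have [j [g' ->]] := subP g; rewrite sub_s => e.
  have eji : j = i := projT1_eq e; subst j.
  by exists g' => //; exact: existT_inj e.
exists (fun v => r (projT1 v) (projT2 v)), (fun v => cyc (projT1 v) (projT2 v)); split.
- move=> g; have [i [g' ->]] := subP g; rewrite sub_s sub_t /=.
  by have [adj _ _] := h i; exact: adj.
- move=> [i v] /= cv h1 h2 h3 /subPi[g1 -> s1] /subPi[g2 -> s2] /subPi[g3 -> s3] ne.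
  have [_ deg _] := h i.
  have [e|->|->] := deg v cv g1 g2 g3 s1 s2 s3; [by case: ne; rewrite e|by left|by right].
- move=> [i v] h1 h2 /= ncv /subPi[g1 -> s1] /subPi[g2 -> s2].
  rewrite !sub_t /= => r1 r2; have [_ _ nc] := h i.
  by rewrite (nc v g1 g2).
Qed.

(** A checkable form of the ranking: edges are determined by their larger ends, so a vertex has at
    most one edge to smaller vertices. *)
Definition tree_edges (n : nat) (s : seq (nat * nat)) : bool :=
  all (fun p => [&& p.1 != p.2, p.1 <= n & p.2 <= n])%N s &&
  uniq [seq maxn p.1 p.2 | p <- s].

Lemma chain_bounds m n : (n <= m)%N ->
  all (fun p => [&& p.1 != p.2, p.1 <= m & p.2 <= m])%N (chain n).
Proof.
move=> le_nm; apply/allP => p /mapP[i]; rewrite mem_iota => hi -> /=.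
by apply/and3P; split; lia.
Qed.

Lemma chain_max n : [seq maxn p.1 p.2 | p <- chain n] = iota 1 n.
Proof.
rewrite /chain -map_comp (iotaDl 1 0); apply: eq_map => i /=; lia.
Qed.

Lemma diagram_tree d : dynkin_or_extended d -> (forall n, d <> extA n) ->
  tree_edges (top d) (edges d).
Proof.
rewrite /tree_edges; case: d => [n|n|||| n |n|||] //= hn nA; last 1 first.
- apply/andP; split.
    apply/and3P; split; [lia|lia|apply: chain_bounds; lia].
  by rewrite chain_max !inE !mem_iota iota_uniq andbT; lia.
- by rewrite chain_bounds //= chain_max iota_uniq.
- apply/andP; split.
    apply/andP; split; [lia|apply: chain_bounds; lia].
  by rewrite chain_max mem_iota iota_uniq andbT; lia.
- by have := nA n.
Qed.

Lemma diagram_hs d (h : hedge (diagram_graph d)) :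
  hs h = inord (if h.2 then (nth (0, 0)%N (edges d) h.1).2
                else (nth (0, 0)%N (edges d) h.1).1).
Proof. by case: h => e []; rewrite /hs /=; case: (nth (0, 0)%N (edges d) e). Qed.

Lemma diagram_ranked d : dynkin_or_extended d -> ranked (diagram_graph d).
Proof.
move=> ok.
have [[n dA]|nA] := pselect (exists n, d = extA n).
  subst d; exists (fun=> 0%N), (fun=> True); split=> // v _.
  (* In [extA n] a vertex is the first end of at most one edge and the second end of at most one,
     hence carries at most two half-edges. *)
  have side (h h' : hedge (diagram_graph (extA n))) : h.2 = h'.2 -> hs h = hs h' -> h = h'.
    case: h h' => [e b] [e' b'] /= <- {b'}; rewrite !diagram_hs => e12.
    congr pair; apply/val_inj/eqP => /=.
    rewrite -(nth_uniq 0%N (s := [seq (if b then p.2 else p.1) | p <- edges (extA n)])); last first.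
    - case: b {e12} => /=.
        rewrite /chain -map_comp (eq_map (g := addn 1)) // -(iotaDl 1 0) iota_uniq andbT.
        by rewrite mem_iota.
      rewrite /chain -map_comp (eq_map (g := id)) // map_id iota_uniq andbT.
      by rewrite mem_iota ltnn andbF.
    - by rewrite (size_map _ (edges (extA n))); exact: ltn_ord e'.
    - by rewrite (size_map _ (edges (extA n))); exact: ltn_ord e.
    rewrite !(nth_map (0, 0)%N) //; apply/eqP.
    have bd (i : 'I_(size (edges (extA n)))) : ((if b then (nth (0, 0) (edges (extA n)) i).2
       else (nth (0, 0) (edges (extA n)) i).1) < n.+1)%N.
      have : all (fun p => (p.1 <= n) && (p.2 <= n))%N (edges (extA n)).
        rewrite /= leqnn /=; apply: sub_all (chain_bounds (leqnn n)) => p.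
        by case/and3P => _ -> ->.
      by move/all_nthP => /(_ (0, 0)%N i (ltn_ord i)) /andP[h1 h2]; rewrite ltnS; case: b {e12}.
    by rewrite -[LHS](inordK (bd e)) -[RHS](inordK (bd e')) e12.
  move=> h1 h2 h3 s1 s2 s3 ne.
  have n12 : h1.2 <> h2.2 by move=> e; apply/ne/side; rewrite // s1 s2.
  have [e|e] := eqVneq h3.2 h1.2; [left|right]; apply: side; rewrite ?s1 ?s2 ?s3 //.
  by move: e n12; case: h1.2; case: h2.2; case: h3.2.
(* For the other diagrams the number of a vertex is its rank. *)
have /andP[/all_nthP bd un] := diagram_tree ok (fun n e => nA (ex_intro _ n e)).
exists (fun v : 'I_(top d).+1 => nat_of_ord v), (fun=> False); split=> // v [e1 b1] [e2 b2] _.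
have /and3P[/= n1 x1 y1] := bd (0, 0)%N e1 (ltn_ord e1).
have /and3P[/= n2 x2 y2] := bd (0, 0)%N e2 (ltn_ord e2).
rewrite /ht !diagram_hs /= => s1 s2.
have vs (b : bool) (e : 'I_(size (edges d))) :
    nat_of_ord (inord (if b then (nth (0, 0)%N (edges d) e).2
      else (nth (0, 0)%N (edges d) e).1) : 'I_(top d).+1) =
    (if b then (nth (0, 0)%N (edges d) e).2 else (nth (0, 0)%N (edges d) e).1).
  by have /and3P[_ u w] := bd (0, 0)%N e (ltn_ord e); rewrite inordK //; case: b.
have {}s1 := congr1 (@nat_of_ord _) s1; have {}s2 := congr1 (@nat_of_ord _) s2.
rewrite !vs in s1 s2.
rewrite !vs => r1 r2.
have m1 : maxn (nth (0, 0)%N (edges d) e1).1 (nth (0, 0)%N (edges d) e1).2 = v.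
  by move: s1 r1; case: b1 => /=; lia.
have m2 : maxn (nth (0, 0)%N (edges d) e2).1 (nth (0, 0)%N (edges d) e2).2 = v.
  by move: s2 r2; case: b2 => /=; lia.
have e12 : e1 = e2.
  have lt (e : 'I_(size (edges d))) : (e < size [seq maxn p.1 p.2 | p <- edges d])%N.
    by rewrite size_map.
  apply/val_inj/eqP; rewrite -(nth_uniq 0%N (lt e1) (lt e2) un).
  by rewrite (nth_map (0, 0)%N _ _ (ltn_ord e1)) (nth_map (0, 0)%N _ _ (ltn_ord e2)) m1 m2.
rewrite -e12 in s2 *; congr pair; move: s1 s2 n1; case: b1 {r1}; case: b2 {r2} => //= -> ->;
  by rewrite eqxx.
Qed.

Lemma dynkin_union_ranked Q : is_dynkin_union Q -> ranked Q.
Proof.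
move=> [n [d [ok iso]]]; apply: ranked_giso iso _; apply: ranked_gunion => i.
exact: diagram_ranked.
Qed.

Section DynkinOn.
Variable Q : mgraph.

(* The part of Q spanned by S is a Dynkin union, and no edge of Q leaves S. *)
Definition dynkin_on (S : vertex Q -> Prop) : Prop :=
  exists (I : finType) (d : I -> diagram)
    (f : {i : I & vertex (diagram_graph (d i))} -> vertex Q)
    (g : {i : I & edge (diagram_graph (d i))} -> edge Q),
  [/\ forall i, dynkin_or_extended (d i), injective f /\ injective g,
      forall v, S v <-> exists a, f a = v,
      forall e, S (ends e).1 <-> exists a, g a = e &
      forall i (e : edge (diagram_graph (d i))),
        let: (x, y) := ends e in
        ends (g (existT _ i e)) = (f (existT _ i x), f (existT _ i y)) \/
        ends (g (existT _ i e)) = (f (existT _ i y), f (existT _ i x))].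

Lemma dynkin_on_ext (S S' : vertex Q -> Prop) :
  (forall v, S v <-> S' v) -> dynkin_on S -> dynkin_on S'.
Proof.
move=> h; have -> // : S = S'.
by apply: funext => v; apply/propeqP.
Qed.

Lemma dynkin_on0 : dynkin_on (fun _ => False).
Proof.
exists void, (of_void _), (fun a => of_void _ (projT1 a)), (fun a => of_void _ (projT1 a)).
by split; [case|split; do 2![case]|split=> // -[[[]]]|split=> // -[[[]]]|case].
Qed.

Lemma dynkin_onU (S1 S2 : vertex Q -> Prop) :
  (forall v, S1 v -> S2 v -> False) ->
  dynkin_on S1 -> dynkin_on S2 -> dynkin_on (fun v => S1 v \/ S2 v).
Proof.
move=> dis [I1 [d1 [f1 [g1 [ok1 [f1i g1i] f1P g1P c1]]]]].
move=> [I2 [d2 [f2 [g2 [ok2 [f2i g2i] f2P g2P c2]]]]].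
pose d i := match i with inl i => d1 i | inr i => d2 i end.
pose f (a : {i : I1 + I2 & vertex (diagram_graph (d i))}) : vertex Q :=
  match a with
  | existT (inl i) x => f1 (existT _ i x)
  | existT (inr i) x => f2 (existT _ i x)
  end.
pose g (a : {i : I1 + I2 & edge (diagram_graph (d i))}) : edge Q :=
  match a with
  | existT (inl i) x => g1 (existT _ i x)
  | existT (inr i) x => g2 (existT _ i x)
  end.
have S1f a : S1 (f1 a) by apply/f1P; exists a.
have S2f a : S2 (f2 a) by apply/f2P; exists a.
have S1g a : S1 (ends (g1 a)).1 by apply/g1P; exists a.
have S2g a : S2 (ends (g2 a)).1 by apply/g2P; exists a.
exists (I1 + I2)%type, d, f, g; split.
- by case.
- split=> -[[i|i] x] [[j|j] y] /= e.
  + have e' := f1i _ _ e; have ij : i = j := projT1_eq e'; subst j.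
    by rewrite (existT_inj e').
  + by case: (dis (f1 (existT _ i x))) => //; rewrite e.
  + by case: (dis (f2 (existT _ i x))) => //; rewrite e.
  + have e' := f2i _ _ e; have ij : i = j := projT1_eq e'; subst j.
    by rewrite (existT_inj e').
  + have e' := g1i _ _ e; have ij : i = j := projT1_eq e'; subst j.
    by rewrite (existT_inj e').
  + by case: (dis (ends (g1 (existT _ i x))).1) => //; rewrite e.
  + by case: (dis (ends (g2 (existT _ i x))).1) => //; rewrite e.
  + have e' := g2i _ _ e; have ij : i = j := projT1_eq e'; subst j.
    by rewrite (existT_inj e').
- move=> v; split=> [[/f1P[[i x] <-]|/f2P[[i x] <-]]|[[[i|i] x] <-]] /=.
  + by exists (existT _ (inl i) x).
  + by exists (existT _ (inr i) x).
  + by left.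
  + by right.
- move=> v; split=> [[/g1P[[i x] <-]|/g2P[[i x] <-]]|[[[i|i] x] <-]] /=.
  + by exists (existT _ (inl i) x).
  + by exists (existT _ (inr i) x).
  + by left.
  + by right.
- by case=> i e; [exact: c1|exact: c2].
Qed.

Lemma dynkin_on_full : dynkin_on (fun _ => True) -> is_dynkin_union Q.
Proof.
move=> [I [d [f [g [ok [fi gi] fP gP c]]]]].
pose d' (i : 'I_#|I|) := d (enum_val i).
pose R : mgraph := gunion (fun i => diagram_graph (d' i)).
pose f' (a : vertex R) : vertex Q := f (existT _ (enum_val (projT1 a)) (projT2 a)).
pose g' (a : edge R) : edge Q := g (existT _ (enum_val (projT1 a)) (projT2 a)).
have evs (T : I -> Type) (a : {i & T i}) : exists b : {i : 'I_#|I| & T (enum_val i)},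
    existT _ (enum_val (projT1 b)) (projT2 b) = a.
  case: a => i x; have [j ej] : exists j : 'I_#|I|, enum_val j = i.
    by exists (enum_rank i); rewrite enum_rankK.
  by subst i; exists (existT _ j x).
have evi (T : I -> Type) (a b : {i : 'I_#|I| & T (enum_val i)}) :
    existT T (enum_val (projT1 a)) (projT2 a) = existT T (enum_val (projT1 b)) (projT2 b) ->
    a = b.
  case: a b => [i x] [j y] /= h; have ij : i = j := enum_val_inj (projT1_eq h).
  by subst j; rewrite (existT_inj h).
have f'b : bijective f'.
  apply: inj_surj_bij => [a b /fi/evi //|v].
  have [a <-] := proj1 (fP v) Logic.I.
  by have [b <-] := evs _ a; exists b.
have g'b : bijective g'.
  apply: inj_surj_bij => [a b /gi/evi //|e].
  have [a <-] := proj1 (gP e) Logic.I.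
  by have [b <-] := evs _ a; exists b.
have [fv fvK f'K] := f'b; have [gv gvK g'K] := g'b.
exists #|I|, d'; split=> [i|]; first exact: ok.
exists fv, gv; split; [by exists f'|by exists g'|move=> e].
rewrite -[e]g'K /=; set a := gv e; rewrite gvK.
have := c (enum_val (projT1 a)) (projT2 a); case: a => i x /=.
case E: (nth _ _ _) => [u w] /=.
by case=> ->; [left|right]; congr pair; exact: esym (fvK (existT _ i _)).
Qed.
End DynkinOn.

Arguments dynkin_on Q S : clear implicits.

Lemma dynkin_on_map (Q R : mgraph) (phi : vertex Q -> vertex R)
    (psi : edge Q -> edge R) (S : vertex R -> Prop) :
  injective phi -> injective psi ->
  (forall e, ends (psi e) = (phi (ends e).1, phi (ends e).2)) ->
  (forall v, S v <-> exists u, phi u = v) ->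
  (forall e, S (ends e).1 -> exists e', psi e' = e) ->
  is_dynkin_union Q -> dynkin_on R S.
Proof.
move=> phi_inj psi_inj compat SP SE [n [d [ok [f [g [[f' fK f'K] [g' gK g'K] c]]]]]].
exists 'I_n, d, (phi \o f'), (psi \o g'); split=> //.
- by split; apply: inj_comp => //; exact: can_inj; eassumption.
- move=> v; rewrite SP; split=> [[u <-]|[a <-]]; last by eexists.
  by exists (f u); rewrite /= fK.
- move=> e; split=> [/SE[e' <-]|[a <-]]; first by exists (g e'); rewrite /= gK.
  by rewrite compat SP; eexists.
- move=> i e; have := c (g' (existT _ i e)); rewrite compat.
  case: (ends (g' _)) => x y /=; rewrite g'K; case E: (nth _ _ _) => [u w] /=.
  by case=> [[-> ->]|[-> ->]]; rewrite !fK; [left|right].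
Qed.

(** * Components of degree at most two *)

(** Induction on the enumeration: a representative related to a later one satisfying [P] is dropped;
    otherwise its class is disjoint from the later ones and is added by [dynkin_onU]. *)
Lemma dynkin_on_classes (Q : mgraph) (R : vertex Q -> vertex Q -> Prop)
    (P : vertex Q -> Prop) n (c : 'I_n -> vertex Q) :
  (forall x y, R x y -> R y x) -> (forall x y z, R x y -> R y z -> R x z) ->
  (forall x, P x -> dynkin_on Q (R x)) ->
  dynkin_on Q (fun v => exists i, P (c i) /\ R (c i) v).
Proof.
move=> Rs Rt du; elim: n c => [|n IH] c.
  by apply: dynkin_on_ext (@dynkin_on0 Q) => v; split=> [//|[[]]].
have {IH}du' := IH (fun i => c (lift ord0 i)).
have skip : (forall v, P (c ord0) -> R (c ord0) v ->
    exists i, P (c (lift ord0 i)) /\ R (c (lift ord0 i)) v) ->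
    dynkin_on Q (fun v => exists i, P (c i) /\ R (c i) v).
  move=> h; apply: dynkin_on_ext du' => v; split=> [[j Rj]|[j Rj]].
    by exists (lift ord0 j).
  by case: (unliftP ord0 j) Rj => [j' ->|->] Rj; [exists j'|case: Rj; exact: h].
have [P0|nP0] := pselect (P (c ord0)); last by apply: skip => v /nP0.
have [[i [Pi Ri]]|nR] := pselect (exists i, P (c (lift ord0 i)) /\ R (c (lift ord0 i)) (c ord0)).
  by apply: skip => v _ R0; exists i; split=> //; exact: Rt Ri R0.
apply: dynkin_on_ext (dynkin_onU _ (du _ P0) du') => [v|v R0 [i [Pi Ri]]]; last first.
  by apply: nR; exists i; split=> //; apply: Rt Ri _; exact: Rs.
split=> [[R0|[i Ri]]|[i Ri]]; [by exists ord0|by eexists; exact: Ri|].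
by case: (unliftP ord0 i) Ri => [j ->|->] Ri; [right; exists j|left; case: Ri].
Qed.

Lemma dynkin_on_diagram (Q : mgraph) (S : vertex Q -> Prop) d
    (vs : seq {classic vertex Q}) (es : seq {classic edge Q}) v0 :
  dynkin_or_extended d -> size vs = (top d).+1 -> size es = size (edges d) ->
  uniq vs -> uniq es -> 
  (forall v, S v <-> exists2 i, (i < size vs)%N & nth v0 vs i = v) ->
  (forall e, S (ends e).1 <-> exists2 j, (j < size es)%N & nth e es j = e) ->
  (forall j e0, (j < size es)%N -> let p := nth (0, 0)%N (edges d) j in
     [/\ (p.1 <= top d)%N, (p.2 <= top d)%N &
      ends (nth e0 es j) = (nth v0 vs p.1, nth v0 vs p.2) \/
      ends (nth e0 es j) = (nth v0 vs p.2, nth v0 vs p.1)]) ->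
  dynkin_on Q S.
Proof.
move=> ok sz_vs sz_es uvs ues SP EP compat.
pose f (a : {i : unit & 'I_(top d).+1}) : vertex Q := nth v0 vs (projT2 a).
pose g (a : {i : unit & 'I_(size (edges d))}) : edge Q :=
  tnth (in_tuple es) (cast_ord (esym sz_es) (projT2 a)).
have gE e0 a : g a = nth e0 es (projT2 a) by rewrite /g (tnth_nth e0).
have fi : injective f.
  move=> [[] i] [[] j] e; congr existT; apply/val_inj/eqP.
  by rewrite -(nth_uniq v0 (s := vs)) ?sz_vs ?(ltn_ord i) ?(ltn_ord j) //; apply/eqP.
have gi : injective g.
  move=> [[] i] [[] j] e; congr existT; apply/val_inj/eqP.
  rewrite -(nth_uniq (g (existT _ tt i) : {classic edge Q}) (s := es));
    rewrite ?sz_es ?(ltn_ord i) ?(ltn_ord j) //.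
  by apply/eqP; rewrite -[LHS](gE _ (existT _ tt i)) -[RHS](gE _ (existT _ tt j)).
exists unit, (fun=> d), f, g; split=> //.
- move=> v; rewrite SP; split=> [[i]|[[[] i] <-]].
    by rewrite sz_vs => lti <-; exists (existT _ tt (Ordinal lti)).
  by exists i => //; rewrite sz_vs; exact: ltn_ord i.
- move=> e; rewrite EP; split=> [[i]|[[[] i] <-]].
    rewrite sz_es => lti ei; exists (existT _ tt (Ordinal lti)).
    by rewrite (gE e).
  by exists i; rewrite ?sz_es -?gE //; exact: ltn_ord i.
- move=> [] j; pose e0 : {classic edge Q} := g (existT _ tt j).
  rewrite (gE e0) /=; have [|b1 b2 c] := compat j e0; first by rewrite sz_es; exact: ltn_ord j.
  by case E: (nth _ _ _) b1 b2 c => [x y] /= b1 b2 c; rewrite /f /= !inordK.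
Qed.

Lemma hedge_ends (Q : mgraph) (h : hedge Q) :
  ends h.1 = (hs h, ht h) \/ ends h.1 = (ht h, hs h).
Proof. by case: h => e []; rewrite /ht /hs /=; case: (ends e); [right|left]. Qed.

Lemma nth_chain m j : (j < m)%N -> nth (0, 0)%N (chain m) j = (j, j.+1).
Proof. by move=> hj; rewrite (nth_map 0%N) ?size_iota // nth_iota. Qed.

Lemma size_chain m : size (chain m) = m.
Proof. by rewrite size_map size_iota. Qed.

Section DegreeTwo.
Variables (Q : mgraph) (x : vertex Q).

Definition linked (u v : vertex Q) : Prop := exists l, walk (@hs Q) (@ht Q) u v l.

Lemma linked_refl u : linked u u. Proof. by exists [::]. Qed.

Lemma walk_rev u v l : walk (@hs Q) (@ht Q) u v l ->
  walk (@hs Q) (@ht Q) v u (rev (map (@flip Q) l)).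
Proof.
elim: l u => [|h l IH] u /=; first by move=> ->.
move=> [<- /IH w]; rewrite rev_cons -cats1; apply: walk_cat w _ => /=.
by rewrite /ht flipK.
Qed.

Lemma linked_sym u v : linked u v -> linked v u.
Proof. by move=> [l /walk_rev w]; eexists; exact: w. Qed.

Lemma linked_trans u v w : linked u v -> linked v w -> linked u w.
Proof. by move=> [l h] [l' h']; exists (l ++ l'); exact: walk_cat h h'. Qed.

Lemma linked_hedge (h : hedge Q) : linked (hs h) (ht h).
Proof. by exists [:: h]. Qed.

Lemma linked_closed (S : vertex Q -> Prop) : (forall h, S (hs h) -> S (ht h)) ->
  forall u v, linked u v -> S u -> S v.
Proof.
move=> cl u v [l]; elim: l u => [|h l IH] u /=; first by move=> ->.
by move=> [<- /IH w] /cl.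
Qed.

Variables (n : nat) (c : 'I_n -> vertex Q).
Hypothesis c_surj : forall v, exists i, c i = v.
Hypothesis deg2 : forall v, linked x v -> deg_le2 Q v.

Let size_uniq (s : seq {classic vertex Q}) : uniq s -> (size s <= n)%N.
Proof.
move=> us; pose idx (v : {classic vertex Q}) := sval (cid (c_surj v)).
have idxK v : c (idx v) = v by rewrite /idx; case: cid.
have : uniq (map idx s) by rewrite map_inj_uniq // => u v e; rewrite -(idxK u) e idxK.
by move=> /card_uniqP; rewrite size_map => <-; rewrite -[X in (_ <= X)%N]card_ord; exact: max_card.
Qed.

Let trace (a : vertex Q) (l : seq (hedge Q)) : seq {classic vertex Q} := a :: map (@ht Q) l.

Let simple_walk m := exists a b l,
  [/\ linked x a, walk (@hs Q) (@ht Q) a b l, size l = m & uniq (trace a l)].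

Lemma longest_walk : exists m, simple_walk m /\ forall m', simple_walk m' -> (m' <= m)%N.
Proof.
have exP : exists m, `[< simple_walk m >].
  by exists 0%N; apply/asboolP; exists x, x, [::]; split=> //; exact: linked_refl.
have ubP m : `[< simple_walk m >] -> (m <= n)%N.
  move=> /asboolP[a [b [l [_ _ <- /size_uniq]]]]; rewrite /= size_map; exact: ltnW.
case: (ex_maxnP exP ubP) => m /asboolP wm maxm; exists m; split=> // m' wm'.
exact/maxm/asboolP.
Qed.

(* The trace of a longest simple walk is the whole component: a step leaving the trace at  *)
(* one of its ends would extend the walk, and an inner vertex has no further edge.         *)
Theorem component_deg2 : dynkin_on Q (linked x).
Proof.
have [[h0]|none] := pselect (inhabited (hedge Q)); last first.
  have nohalf (h : hedge Q) : False by apply: none.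
  apply: (@dynkin_on_diagram _ _ (A_ 1) [:: x] [::] x) => // [v|e].
  - split=> [[[|h l]]|[[|//] _ <-]]; last exact: linked_refl.
      by move=> /= ->; exists 0%N.
    by case: (nohalf h).
  - by case: (nohalf (e, true)).
have [m [[a [b [l [xa wl sz ul]]]] maxm]] := longest_walk.
pose v i := nth (a : {classic vertex Q}) (trace a l) i.
pose h i := nth h0 l i.
have vinj i j : (i <= m)%N -> (j <= m)%N -> v i = v j -> i = j.
  by move=> hi hj /eqP; rewrite nth_uniq //= ?size_map ?sz ?ltnS // => /eqP.
have v_in i : (i <= m)%N -> v i \in trace a l.
  by move=> hi; apply: mem_nth; rewrite /= size_map sz ltnS.
have inV u : u \in trace a l -> exists2 i, (i <= m)%N & v i = u.
  by move=> /(nthP (a : {classic vertex Q}))[i]; rewrite /= size_map sz ltnS; exists i.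
have htE i : (i < m)%N -> ht (h i) = v i.+1.
  by move=> hi; rewrite /v /= (nth_map h0) // sz.
have hsE i : (i < m)%N -> hs (h i) = v i.
  rewrite -sz /v /h; elim: (l) (a) wl i => [//|h1 l' IH] a' /= [<- w] [//|i] hi.
  rewrite (IH _ w) //; apply: set_nth_default.
  by rewrite /= size_map ltnS ltnW.
have linked_v i : (i <= m)%N -> linked x (v i).
  elim: i => [//|i IH] hi; apply: linked_trans (IH (ltnW hi)) _.
  by rewrite -htE // -hsE //; exact: linked_hedge.
have vm : v m = b.
  rewrite -sz /v; elim: (l) (a) wl => [|h1 l' IH] a' /=; first by move=> ->.
  move=> [_ w]; rewrite -(IH _ w) //; apply: set_nth_default.
  by rewrite /= size_map.
have at_end g : hs g = v m -> ht g \in trace a l.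
  move=> sg; apply: contrapT => /negP nin.
  suff /maxm : simple_walk m.+1 by rewrite ltnn.
  exists a, (ht g), (rcons l g); split=> //.
  - by rewrite -cats1; apply: walk_cat wl _ => /=; rewrite sg vm.
  - by rewrite size_rcons sz.
  - by rewrite /trace map_rcons -rcons_cons rcons_uniq nin.
have at_start g : hs g = v 0%N -> ht g \in trace a l.
  move=> sg; apply: contrapT => /negP nin.
  suff /maxm : simple_walk m.+1 by rewrite ltnn.
  exists (ht g), b, (flip g :: l); split=> //.
  - by apply: linked_trans xa _; rewrite -[a]/(v 0%N) -sg; exact: linked_hedge.
  - by split=> //; rewrite /ht flipK sg.
  - by rewrite /= sz.
  - have -> : trace (ht g) (flip g :: l) = ht g :: trace a l.
      by rewrite /trace /= [ht (flip g)]/ht flipK sg.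
    by rewrite cons_uniq nin.
have interior i g : (0 < i < m)%N -> hs g = v i -> g = h i \/ g = flip (h i.-1).
  case: i => [//|i] /= him sg; have him' : (i < m)%N := ltnW him.
  apply: (deg2 (linked_v i.+1 him')) => //.
  - exact: hsE.
  - exact: htE.
  - move=> e; have /vinj : v i.+2 = v i by rewrite -(htE i.+1) // e /ht flipK hsE.
    by move=> /(_ him (ltnW him')); lia.
have deg i g1 g2 g3 : (i <= m)%N -> hs g1 = v i -> hs g2 = v i -> hs g3 = v i ->
    g1 <> g2 -> g3 = g1 \/ g3 = g2.
  by move=> hi; exact: (deg2 (linked_v i hi)).
(* A spare half-edge at the last vertex closes up at the first one: inner vertices have no free
   half-edge, and for positive [m] a loop at the last vertex would give three half-edges there. *)
have endpoint g : hs g = v m -> (0 < m -> g <> flip (h m.-1))%N -> ht g = v 0%N.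
  move=> sg un; have [j jm vj] := inV _ (at_end g sg); rewrite -vj.
  have sfg : hs (flip g) = v j by rewrite vj.
  have [->//|jpos] := posnP j.
  have [jlt|] := ltnP j m; last move=> mj.
    have [e|e] := interior j (flip g) (introT andP (conj jpos jlt)) sfg.
      have := sg; rewrite -[g]flipK e -/(ht _) htE // => /vinj ejm.
      have {}ejm := ejm jlt (leqnn m); have := un; rewrite -ejm => /(_ isT) [].
      by rewrite -[LHS]flipK e.
    have := sg; rewrite (can_inj (@flipK _) e) hsE; last by lia.
    by move=> /vinj ejm; lia.
  have {}mj : j = m by lia.
  have mpos : (0 < m)%N by rewrite -mj.
  subst j; have hm : (m.-1 < m)%N by rewrite prednK.
  have fm : hs (flip (h m.-1)) = v m by rewrite -/(ht _) htE // prednK.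
  case: (deg m g (flip (h m.-1)) (flip g) jm sg fm sfg (un mpos)) => [/flip_neq//|].
  by move=> /(can_inj (@flipK _)) e; have := sg; rewrite e hsE // => /vinj; lia.
(* Every half-edge at the trace belongs to an edge of the walk or is spare at one of the ends; the
   ends coincide when [m] is 0. *)
have inner i g : (i <= m)%N -> hs g = v i -> [\/ exists2 j, (j < m)%N & g.1 = (h j).1,
    i = m /\ (0 < m -> g <> flip (h m.-1))%N | i = 0%N /\ (0 < m -> g <> h 0)%N].
  move=> im sg; have [i0|ipos] := posnP i.
    have [e|ne] := pselect (g = h 0%N); last by constructor 3; split.
    have [m0|mpos] := posnP m; first by constructor 2; split; [lia|rewrite m0].
    by constructor 1; exists 0%N; rewrite ?e.
  have [ilt|ige] := ltnP i m.
    have [->|->] := interior i g (introT andP (conj ipos ilt)) sg; constructor 1.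
      by exists i.
    by exists i.-1 => //; lia.
  have ei : i = m by lia.
  have [e|ne] := pselect (g = flip (h m.-1)); last by constructor 2; split.
  by constructor 1; exists m.-1; rewrite ?e //; lia.
have closed g : hs g \in trace a l -> ht g \in trace a l.
  move=> /inV[i im vi]; have [i0|ipos] := posnP i.
    by apply: at_start; rewrite -vi i0.
  have [ilt|ige] := ltnP i m.
    have [->|->] := interior i g (introT andP (conj ipos ilt)) (esym vi).
      by rewrite htE // v_in.
    by rewrite /ht flipK hsE ?v_in //; lia.
  by apply: at_end; rewrite -vi; congr v; lia.
have linkedV u : linked x u <-> exists2 i, (i < size (trace a l))%N &
    nth (a : {classic vertex Q}) (trace a l) i = u.
  rewrite /= size_map sz; split=> [xu|[i]]; last by rewrite ltnS => /linked_v + <-.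
  have [] := inV u; last by move=> i; exists i.
  have cl := @linked_closed (fun u => (u : {classic vertex Q}) \in trace a l) closed.
  exact: cl (linked_trans (linked_sym xa) xu) (mem_head _ _).
pose es : seq {classic edge Q} := map fst l.
have nth_es e0 i : (i < m)%N -> nth e0 es i = (h i).1.
  by move=> hi; rewrite (nth_map h0) // sz.
have sz_es : size es = m by rewrite size_map.
have es_inj i j : (i < m)%N -> (j < m)%N -> (h i).1 = (h j).1 -> i = j.
  move=> hi hj /hedge_eq[|] e.
    by apply: vinj; [exact: ltnW|exact: ltnW|rewrite -hsE // -[RHS]hsE // e].
  have /vinj e1 : v i = v j.+1 by rewrite -hsE // e -/(ht _) htE.
  have /vinj e2 : v i.+1 = v j by rewrite -htE // e /ht flipK hsE.
  by move: (e1 (ltnW hi) hj) (e2 hi (ltnW hj)); lia.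
have es_uniq : uniq es.
  apply/(uniqP (h0.1 : {classic edge Q})) => i j; rewrite !inE sz_es => hi hj.
  by rewrite !nth_es //; exact: es_inj.
have edgeP (e : edge Q) : linked x (ends e).1 -> exists2 i, (i <= m)%N & hs (e, false) = v i.
  by move=> /linkedV[i]; rewrite /= size_map sz ltnS => im e'; exists i => //; exact: esym.
have h_src j : (j < m)%N -> linked x (ends (h j).1).1.
  move=> hj; case: (hedge_ends (h j)) => -> /=.
    by rewrite hsE //; apply: linked_v; exact: ltnW.
  by rewrite htE //; apply: linked_v.
have h_ends j : (j < m)%N -> ends (h j).1 = (v j, v j.+1) \/ ends (h j).1 = (v j.+1, v j).
  by move=> hj; rewrite -hsE // -htE //; exact: hedge_ends.
(* A spare half-edge at the last vertex turns the walk into [extA m], a loop when [m] is 0 and a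
   double edge when [m] is 1; without one the component is [A_ m.+1]. *)
have [[g [sg un]]|open] := pselect (exists g, hs g = v m /\ (0 < m -> g <> flip (h m.-1))%N).
  have tg := endpoint g sg un.
  have g_new i : (i < m)%N -> g.1 <> (h i).1.
    move=> hi /hedge_eq[|] e.
      by have := sg; rewrite e hsE // => /vinj; lia.
    have := sg; rewrite e -/(ht _) htE // => /vinj e'.
    have em := e' hi (leqnn m); have := un; rewrite -em => /(_ isT); exact.
  apply: (@dynkin_on_diagram _ _ (extA m) (trace a l) ((g.1 : {classic edge Q}) :: es) a) => //.
  - by rewrite /= size_map sz.
  - by rewrite /= sz_es size_chain.
  - rewrite cons_uniq es_uniq andbT; apply/negP => /(nthP (h0.1 : {classic edge Q}))[i].
    by rewrite sz_es => hi; rewrite nth_es // => e; exact: (g_new i hi).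
  - move=> e; split=> [/edgeP[i im se]|[[|j] hj]]; rewrite /=; last 2 first.
    + by move=> <-; case: (hedge_ends g) => ->; rewrite ?sg ?tg; exact: linked_v.
    + by move: hj; rewrite /= sz_es ltnS => hj; rewrite nth_es // => <-; exact: h_src.
    have [[j hj ej]|[ei une]|[ei une]] := inner i _ im se.
    + by exists j.+1; rewrite /= ?sz_es ?ltnS // nth_es.
    + exists 0%N => //=; rewrite ei in se; have [m0|mpos] := posnP m.
        have fm : hs (flip g) = v m by rewrite -/(ht _) tg m0.
        by case: (deg m g (flip g) _ (leqnn m) sg fm se (fun e' => flip_neq (esym e'))) =>
          /(congr1 fst).
      have fm : hs (flip (h m.-1)) = v m by rewrite -/(ht _) htE prednK.
      case: (deg m g (flip (h m.-1)) _ (leqnn m) sg fm se (un mpos)) => [/(congr1 fst)//|].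
      by move/(une mpos).
    + exists 0%N => //=; rewrite ei in se; have [m0|mpos] := posnP m.
        have s0 : hs g = v 0%N by rewrite sg m0.
        by case: (deg 0%N g (flip g) _ (leq0n m) s0 tg se (fun e' => flip_neq (esym e'))) =>
          /(congr1 fst).
      have ne : h 0%N <> flip g.
        move=> e'; have eg : g = flip (h 0%N) by rewrite e' flipK.
        have := sg; rewrite eg -/(ht _) htE // => /vinj em.
        have {}em := em mpos (leqnn m); have := un; rewrite -em => /(_ isT); exact.
      case: (deg 0%N (h 0%N) (flip g) _ (leq0n m) (hsE 0%N mpos) tg se ne) => [|/(congr1 fst)//].
      by move/(une mpos).
  - move=> [|j] e0 /=.
      rewrite leqnn => _; split=> //; have := hedge_ends g; rewrite sg tg; exact.
        move=> hj; have {}hj : (j < m)%N by rewrite -sz_es.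
    by rewrite nth_chain // nth_es //=; split; [lia|lia|exact: h_ends].
apply: (@dynkin_on_diagram _ _ (A_ m.+1) (trace a l) es a) => //.
- by rewrite /= size_map sz.
- by rewrite sz_es /= size_chain.
- move=> e; split=> [/edgeP[i im se]|[j]]; last first.
    by rewrite sz_es => hj; rewrite nth_es // => <-; exact: h_src.
  have [[j hj ej]|[ei une]|[ei une]] := inner i _ im se.
  + by exists j; rewrite ?sz_es // nth_es.
  + by case: open; exists (e, false); rewrite se ei.
  (* A spare half-edge at the first vertex would, when reversed, be spare at the last vertex,
     against [open]. *)
  exfalso; have [m0|mpos] := posnP m.
    by case: open; exists (e, false); rewrite se ei m0.
  have {}une := une mpos; rewrite ei in se; set g := (e, false) in se une.
  have [j jm vj] := inV _ (at_start g se).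
  have sfg : hs (flip g) = v j by rewrite vj.
  have [j0|jpos] := posnP j.
    subst j; case: (deg 0%N g (h 0%N) (flip g) jm se (hsE 0%N mpos) sfg une) => [/flip_neq//|e'].
    have eg : g = flip (h 0%N) by rewrite -e' flipK.
    by have := se; rewrite eg -/(ht _) htE // => /vinj; lia.
  have [jlt|jge] := ltnP j m.
    have [e'|e'] := interior j (flip g) (introT andP (conj jpos jlt)) sfg.
      by have := se; rewrite -[g]flipK e' -/(ht _) htE // => /vinj; lia.
    have eg := can_inj (@flipK _) e'; have := se; rewrite eg hsE; last lia.
    by move=> /vinj ej; apply: une; rewrite eg; congr h; lia.
  have ej : j = m by lia.
  have [e'|ne] := pselect (flip g = flip (h m.-1)).
    have eg := can_inj (@flipK _) e'; have := se; rewrite eg hsE; last lia.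
    by move=> /vinj em; apply: une; rewrite eg; congr h; lia.
  by case: open; exists (flip g); rewrite sfg ej.
- move=> j e0; rewrite sz_es => hj.
  by rewrite nth_chain // nth_es //=; split; [lia|lia|exact: h_ends].
Qed.
End DegreeTwo.

(** * Bridges and weights of walks *)

Section Bridges.
Variable Q : mgraph.

Lemma ht_flip (h : hedge Q) : ht (flip h) = hs h.
Proof. by rewrite /ht flipK. Qed.

Definition avoids (e : edge Q) (l : seq (hedge Q)) : bool := all (fun h => `[< h.1 <> e >]) l.

(** The edge lies on a circuit; loops qualify, with the empty walk. *)
Definition nonbridge (e : edge Q) : Prop :=
  exists l, walk (@hs Q) (@ht Q) (ends e).1 (ends e).2 l /\ avoids e l.

Lemma nonbridge_hedge h l : walk (@hs Q) (@ht Q) (ht h) (hs h) l -> avoids h.1 l ->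
  nonbridge h.1.
Proof.
case: h => e [] wl av; first by exists l.
exists (rev (map (@flip Q) l)); split; first exact: walk_rev wl.
by rewrite /avoids all_rev all_map.
Qed.

(** A shortest walk joining the ends of [e] without using [e] never backtracks. Since [e] closes it,
    each of its vertices has two distinct half-edges to its neighbours on the circuit. *)
Lemma nonbridge_core e : nonbridge e -> exists (Z : vertex Q -> Prop),
  [/\ Z (ends e).1, core Q Z &
      exists s : seq (vertex Q), forall v, Z v -> exists2 i, (i < size s)%N & nth v s i = v].
Proof.
move=> nb; pose P n := `[< exists l, [/\ size l = n,
  walk (@hs Q) (@ht Q) (ends e).1 (ends e).2 l & avoids e l] >].
have exP : exists n, P n.
  by have [l [wl av]] := nb; exists (size l); apply/asboolP; exists l.
case: (ex_minnP exP) => n /asboolP[l [sz wl av]] min_n.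
have reduced l1 h l2 : l <> l1 ++ h :: flip h :: l2.
  move=> el; have : P (size (l1 ++ l2)).
    apply/asboolP; exists (l1 ++ l2); split=> //.
      have w := wl; rewrite el in w; have [y [w1 [ey [_ w2]]]] := walk_split w.
      by rewrite ht_flip in w2; subst y; exact: walk_cat w1 w2.
    by move: av; rewrite el /avoids !all_cat /= => /and4P[-> _ _ ->].
  by move/min_n; rewrite -sz el !size_cat /=; lia.
pose Z v := exists l1 l2, [/\ l = l1 ++ l2, walk (@hs Q) (@ht Q) (ends e).1 v l1 &
  walk (@hs Q) (@ht Q) v (ends e).2 l2].
exists Z; split; first by exists [::], l.
- move=> v [l1 [l2 [el w1 w2]]].
  have Zs : Z (ends e).1 by exists [::], l.
  have Zt : Z (ends e).2 by exists l, [::]; rewrite cats0.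
  have [h1 [s1 Z1 P1]] : exists h1 : hedge Q, [/\ hs h1 = v, Z (ht h1) &
      (h1 = (e, false)) \/ exists l1', l1 = rcons l1' (flip h1)].
    case/lastP: l1 el w1 => [|l1 h] el w1; first by exists (e, false); split=> //; left.
    have w := w1; rewrite -cats1 in w; have [y [wy /= [hy tv]]] := walk_split w.
    exists (flip h); split; rewrite ?/ht ?flipK.
    - by rewrite -tv.
    - exists l1, (h :: l2); split; [by rewrite el cat_rcons|by rewrite hy|].
      by split=> //; rewrite tv.
    - by right; exists l1.
  have [h2 [s2 Z2 P2]] : exists h2 : hedge Q, [/\ hs h2 = v, Z (ht h2) &
      (h2 = (e, true)) \/ exists l2', l2 = h2 :: l2'].
    case: l2 el w2 => [|h l2] el w2; first by exists (e, true); split=> //; left.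
    have [hv w2'] := w2; exists h; split=> //; last by right; exists l2.
    exists (rcons l1 h), l2; split=> //; first by rewrite el cat_rcons.
    by rewrite -cats1; apply: walk_cat w1 _.
  exists h1, h2; split=> // e12; subst h2.
  move: av; rewrite /avoids el; case: P1 => [e1|[l1' e1]]; case: P2 => [e2|[l2' e2]].
  + by rewrite e1 in e2.
  + by rewrite e2 all_cat /= e1 => /and3P[_ /asboolP].
  + by rewrite e1 all_cat all_rcons /= e2 => /andP[/andP[/asboolP]].
  + by case: (reduced l1' (flip h1) l2'); rewrite el e1 e2 flipK cat_rcons.
pose c i := sval (cid (walk_split (l := take i l) (l' := drop i l)
  (eq_ind_r (fun l => walk (@hs Q) (@ht Q) (ends e).1 (ends e).2 l) wl (cat_take_drop i l)))).
exists (mkseq c (size l).+1) => v [l1 [l2 [el w1 w2]]].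
exists (size l1); first by rewrite size_mkseq el size_cat; lia.
rewrite nth_mkseq; last by rewrite el size_cat; lia.
rewrite /c; case: cid => y /= [wy _]; move: wy; rewrite el take_size_cat // => wy.
exact: walk_end wy w1.
Qed.

(** At a vertex of the circuit the two half-edges given by [core] are the only ones, so the circuit
    is closed under adjacency and is the whole component. *)
Lemma nonbridge_deg_le2 e :
  (forall (Z : vertex Q -> Prop) (s : seq (vertex Q)),
     (forall v, Z v -> exists2 i, (i < size s)%N & nth v s i = v) -> core Q Z ->
     forall v, Z v -> deg_le2 Q v) ->
  nonbridge e -> forall v, linked (ends e).1 v -> deg_le2 Q v.
Proof.
move=> absorb /nonbridge_core[Z [Ze Zcore [s Zs]]] v lv.
have deg := absorb Z s Zs Zcore; apply: (deg).
apply: linked_closed lv Ze => g Zg.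
have [h1 [h2 [ne s1 s2 Z1 Z2]]] := Zcore _ Zg.
by have [->|->] := deg _ Zg h1 h2 g s1 s2 erefl ne.
Qed.

Variable k : fieldType.
Variable c : edge Q -> k.
Hypothesis c_neq0 : forall e, (c e != 0)%R.

Definition hweight (h : hedge Q) : k := if h.2 then ((c h.1)^-1)%R else c h.1.
Definition weight (l : seq (hedge Q)) : k := (\prod_(h <- l) hweight h)%R.

Lemma weight_cat l l' : weight (l ++ l') = (weight l * weight l')%R.
Proof. exact: big_cat. Qed.

Lemma hweight_flip h : (hweight h * hweight (flip h) = 1)%R.
Proof. by case: h => e []; rewrite /hweight /= (mulfV, mulVf). Qed.

Lemma weight_rev l : (weight l * weight (rev (map (@flip Q) l)) = 1)%R.
Proof.
elim: l => [|h l IH]; first by rewrite /weight !big_nil mulr1.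
rewrite /= rev_cons -cats1 weight_cat /weight big_cons big_seq1 -/(weight l) -/(weight _).
by rewrite -mulrA (mulrA (weight l)) IH mul1r hweight_flip.
Qed.

(* If the walk crosses the edge e of its first step a second time, it does so in the     *)
(* opposite direction, e being a bridge; this cuts it into two shorter closed walks.      *)
Lemma weight_closed x : (forall e, linked x (ends e).1 -> ~ nonbridge e) ->
  forall l, walk (@hs Q) (@ht Q) x x l -> weight l = 1%R.
Proof.
move=> br l; have [n] := ubnP (size l); elim: n => // n IH in x br l *.
case: l => [|h l] /=; first by rewrite /weight big_nil.
rewrite ltnS => szl [sx wl].
have hbr : ~ nonbridge h.1.
  apply: br; have [/(congr1 fst)/= ->|/(congr1 fst)/= ->] := hedge_ends h.
    by rewrite sx; exact: linked_refl.
  by rewrite -sx; exact: linked_hedge.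
have [av|] := boolP (avoids h.1 l).
  by case: hbr; apply: nonbridge_hedge av; rewrite sx.
rewrite /avoids -has_predC => hl.
have [p [h' [q [el avp h'e]]]] : exists p h' q, [/\ l = p ++ h' :: q, avoids h.1 p & h'.1 = h.1].
  elim: l hl {szl wl} => [//|a l IHl] /=.
  have [e _|ne] := pselect (a.1 = h.1); first by exists [::], a, l.
  have -> /= : `[< a.1 <> h.1 >] by exact/asboolP.
  move=> /IHl[p [h' [q [-> avp h'e]]]]; exists (a :: p), h', q; split=> //=.
  by rewrite /avoids /= -/(avoids _ _) avp andbT; exact/asboolP.
have w := wl; rewrite el in w; have [y [wp /= [sy wq]]] := walk_split w.
have [eh|eh] := hedge_eq h'e; subst h'.
  by case: hbr; apply: nonbridge_hedge avp; rewrite sy.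
move: wp wq; rewrite -sy ht_flip sx -/(ht h) => wp wq.
have szp : (size p < n)%N by move: szl; rewrite el size_cat /=; lia.
have szq : (size q < n)%N by move: szl; rewrite el size_cat /=; lia.
have lth : linked x (ht h) by rewrite -sx; exact: linked_hedge.
have p1 : weight p = 1%R.
  by apply: (IH (ht h)) => // e le; apply: br; exact: linked_trans lth le.
have q1 : weight q = 1%R by exact: (IH x).
rewrite el /weight big_cons big_cat big_cons /= -/(weight p) -/(weight q).
by rewrite p1 q1 mul1r mulr1 hweight_flip.
Qed.
End Bridges.

(** * Full subcategories *)

Lemma finite_setT_enum (T : Type) : finite_set [set: T] ->
  exists n (c : 'I_n -> T), forall t, exists i, c i = t.
Proof.
move=> /(@finite_seqP {classic T})[s sT].
exists (size s), (tnth (in_tuple s)) => t.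
have : (t : {classic T}) \in s by have : [set: T] t by []; rewrite sT.
by move=> /seq_tnthP[i ->]; exists i.
Qed.

Lemma enum_finite_setT (T : Type) n (c : 'I_n -> T) : (forall t, exists i, c i = t) ->
  finite_set [set: T].
Proof.
move=> c_surj; apply: (@sub_finite_set _ _ (range c)); last exact: finite_image.
by move=> t _; have [i <-] := c_surj t; exists i.
Qed.

Definition nth_set (T : Type) (s : seq T) : set T :=
  [set x | exists2 i, (i < size s)%N & nth x s i = x].

Lemma nth_set_finite (T : Type) (s : seq T) : finite_set [set: {x | nth_set s x}].
Proof.
case: s => [|x0 s]; first by rewrite (_ : setT = set0) //; apply/seteqP; split=> // -[x []].
have inS (i : 'I_(size (x0 :: s))) : nth_set (x0 :: s) (nth x0 (x0 :: s) i).
  by exists i => //; exact: set_nth_default.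
apply: (@enum_finite_setT _ _ (fun i => exist _ _ (inS i))) => -[x hx].
have [i lti ei] := hx; exists (Ordinal lti); apply: sig_eq => /=.
by rewrite -[RHS]ei; exact: set_nth_default.
Qed.

Section FullSubcategory.
Variables (k : fieldType) (C : kCat k).
Variables (E : obj C -> obj C -> Type) (beta : forall x y, E x y -> hom C x y).
Hypothesis fb : free_basis beta.

Section OneSet.
Variable A : set (obj C).

Definition fullE (x y : {x | A x}) : Type :=
  @irrE k C (fullsub A) E sval (fun _ _ _ => True) x y.

Lemma fullsub_free_basis : exists beta' : forall x y, fullE x y -> hom (fullsub A) x y,
  @free_basis k (fullsub A) fullE beta'.
Proof.
pose io (x y : obj (fullsub A)) (g : hom (fullsub A) x y) : hom C (sval x) (sval y) := g.
have D_img (x y : obj (fullsub A)) (p : qpath E (sval x) (sval y)) :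
  True -> exists g, io x y g = pval beta p by exists (pval beta p).
exists (irr_hom D_img).
apply: (irr_free_basis (fb := fb)) => //. 
  exact: (@sig_eq _ A).
by move=> x y f g.
Qed.

Lemma fullsub_is_free : is_free (fullsub A).
Proof. by have [b fb'] := fullsub_free_basis; exact: free_basis_is_free fb'. Qed.

(** A full subcategory of a free category is free, so its tameness is the diagram condition,
    transported from the given bases to the irreducible paths. *)
Lemma fullsub_dynkin : tame_rep_type (fullsub A) -> is_dynkin_union (quiver_graph fullE).
Proof.
case=> [[L1 [V [iso [B [bB duB]]]]]|[nf _]]; last by case: nf; exact: fullsub_is_free.
have bV x y : vbasis (fun v : {v : V x y | B x y v} => sval v) := is_basis_vbasis (bB x y).
have [E' [b' [fb' giso']]] := kiso_free_basis iso (freecat_free_basis bV).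
have [b fb''] := fullsub_free_basis; apply: (free_basis_graph fb'' fb').
have [n [d [ok isoB]]] := duB; exists n, d; split=> //.
exact: giso_trans giso' isoB.
Qed.

Lemma single_irr (x y : {x | A x}) (e : E (sval x) (sval y)) :
  @irr k C (fullsub A) E sval (fun _ _ _ => True) x y (pone e).
Proof.
split=> // z p1 p2 /(congr1 (fun p => size (sval p))); rewrite /= size_cat.
case: (sval p1) => [|a p]; first by left.
case: (sval p2) => [|b q]; first by right.
by rewrite /= addSn addnS.
Qed.

Lemma hedge_lift (h : hedge (quiver_graph E)) : A (hs h) -> A (ht h) ->
  exists h' : hedge (quiver_graph fullE),
    [/\ sval (hs h') = hs h, sval (ht h') = ht h,
        sval (sval (projT2 (projT2 h'.1))) = [:: h.1] & h'.2 = h.2].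
Proof.
case: h => [[x [y e]] b] As At.
have Ax : A x by case: b As At.
have Ay : A y by case: b As At.
pose X : {x | A x} := exist _ x Ax; pose Y : {x | A x} := exist _ y Ay.
pose e' : fullE X Y := exist _ (@pone _ E (sval X) (sval Y) e) (single_irr (x := X) (y := Y) e).
by exists (mkarrow e', b); case: b {As At}.
Qed.
End OneSet.

Hypothesis tame : finitely_objects (@tame_rep_type k) C.

(** Only finitely many objects matter: those of the core and the far ends of three half-edges. The
    full subcategory on them is tame, and the arrows between them remain irreducible there, so
    [core_deg_le2] applies. *)
Lemma core_absorb (Z : obj C -> Prop) (s : seq (obj C)) :
  (forall v, Z v -> exists2 i, (i < size s)%N & nth v s i = v) -> core (quiver_graph E) Z ->
  forall v, Z v -> deg_le2 (quiver_graph E) v.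
Proof.
move=> Zs Zcore v Zv g1 g2 g3 s1 s2 s3 ne.
pose A := nth_set (s ++ [:: ht g1; ht g2; ht g3]).
have Afin : finite_set [set: {x | A x}] := nth_set_finite _.
have ZA u : Z u -> A u.
  move=> /Zs[i lti ei]; exists i; first by rewrite size_cat ltn_addr.
  by rewrite nth_cat lti.
have A1 : A (ht g1).
  by exists (size s); rewrite ?size_cat ?nth_cat ?ltnn ?subnn //=; lia.
have A2 : A (ht g2).
  exists (size s).+1; rewrite ?size_cat ?nth_cat /=; first lia.
  by rewrite ltnNge leqnSn /= subSnn.
have A3 : A (ht g3).
  exists (size s).+2; rewrite ?size_cat ?nth_cat /=; first lia.
  by rewrite ltnNge (leq_trans (leqnSn _) (leqnSn _)) /= -addn2 addKn.
pose R := quiver_graph (@fullE A).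
have rk : ranked R by apply/dynkin_union_ranked/fullsub_dynkin/tame.
have Rcore : core R (fun u => Z (sval u)).
  move=> u Zu; have [h1 [h2 [ne12 t1 t2 Z1 Z2]]] := Zcore _ Zu.
  have [||k1 [ks1 kt1 k1e k1b]] := @hedge_lift A h1; rewrite ?t1; try exact: ZA.
  have [||k2 [ks2 kt2 k2e k2b]] := @hedge_lift A h2; rewrite ?t2; try exact: ZA.
  exists k1, k2; split; rewrite /= ?kt1 ?kt2 //.
  - move=> k12; apply: ne12.
    case: h1 h2 k1e k2e k1b k2b {t1 t2 Z1 Z2 ks1 ks2 kt1 kt2} => [e1 b1] [e2 b2] /=.
    by rewrite k12 => -> [->] -> ->.
  - by apply: sig_eq; rewrite ks1.
  - by apply: sig_eq; rewrite ks2.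
have [n [c c_surj]] := finite_setT_enum Afin.
have Av : A v := ZA v Zv.
have deg := @core_deg_le2 R (fun u => Z (sval u)) n c rk (fun u _ => c_surj u) Rcore
  (exist _ v Av) Zv.
have [||l1 [ls1 _ l1e l1b]] := @hedge_lift A g1; rewrite ?s1 //.
have [||l2 [ls2 _ l2e l2b]] := @hedge_lift A g2; rewrite ?s2 //.
have [||l3 [ls3 _ l3e l3b]] := @hedge_lift A g3; rewrite ?s3 //.
have inj (h h' : hedge (quiver_graph E)) (l l' : hedge R) :
    sval (sval (projT2 (projT2 l.1))) = [:: h.1] -> l.2 = h.2 ->
    sval (sval (projT2 (projT2 l'.1))) = [:: h'.1] -> l'.2 = h'.2 -> l = l' -> h = h'.
  case: h h' => [e b] [e' b'] /= eh bh eh' bh' ll'; move: eh bh; rewrite ll' eh' bh'.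
  by move=> [->] ->.
have [|||e|e|e] := deg l1 l2 l3.
- by apply: sig_eq; rewrite ls1.
- by apply: sig_eq; rewrite ls2.
- by apply: sig_eq; rewrite ls3.
- by apply: ne; exact: (inj _ _ _ _ _ _ _ _ e).
- by left; exact: (inj _ _ _ _ _ _ _ _ e).
- by right; exact: (inj _ _ _ _ _ _ _ _ e).
Qed.

Lemma tame_nonbridge e v : @nonbridge (quiver_graph E) e ->
  linked (Q := quiver_graph E) (src e) v -> deg_le2 (quiver_graph E) v.
Proof.
move=> nb lk; refine (@nonbridge_deg_le2 (quiver_graph E) e _ nb v lk).
exact: @core_absorb.
Qed.

End FullSubcategory.

(** * Fixed paths *)

(* The last clause says that the fixed vectors of the basis span all the fixed vectors. *)
Lemma adapted_basis (k : fieldType) (G : finGroupType) (M : lmodType k) (a : linact G M) :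
  exists B : set M, is_basis B /\
    forall f : kfun k {classic {v | B v}},
      (forall g, lact a g (kext (I := {classic {v | B v}}) (fun v => sval v) f) =
                 kext (I := {classic {v | B v}}) (fun v => sval v) f) ->
      forall v, dval f v <> 0 -> forall g, lact a g (sval v) = sval v.
Proof.
pose T : set M := [set m | forall g, lact a g m = m].
have [||B1 [_ B1T iB1 sB1]] := @basis_extension _ _ set0 T => //.
  by move=> n b c _ h _ i; case: (h i).
have [|B [B1B _ iB sB]] := @basis_extension _ _ B1 setT iB1; first by [].
have bB : is_basis B by split=> // m; exact: sB.
exists B; split=> // f fixf v fv; apply: B1T.
exact: (vbasis_kbase_support bB (sB1 _ fixf) B1B fv).
Qed.

Lemma compZl (k : fieldType) (C : kCat k) (x y z : obj C) a (f : hom C y z) (g : hom C x y) :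
  comp (a *: f) g = a *: comp f g.
Proof. exact: (linZ (comp_linear_l g)). Qed.

Lemma compZr (k : fieldType) (C : kCat k) (x y z : obj C) a (f : hom C y z) (g : hom C x y) :
  comp f (a *: g) = a *: comp f g.
Proof. exact: (linZ (comp_linear_r f)). Qed.

Section Cancellation.
Variables (k : fieldType) (C : kCat k).
Variables (E : obj C -> obj C -> Type) (beta : forall x y, E x y -> hom C x y).
Hypothesis fb : free_basis beta.

Lemma comp_pval_injr x y z (p : qpath E x y) :
  injective (fun f : hom C y z => comp f (pval beta p)).
Proof.
move=> f f' /(congr1 (coord fb (y := z))); rewrite !coord_comp !coord_pval => e.
apply: (coord_inj (fb := fb)); apply: dsumP => q.
have E1 (u : kfun k (qpath E y z)) : kcomp u (kbase p) = kext (fun q => kbase (pcat p q)) u.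
  by rewrite /kcomp; congr kext; apply: funext => r; rewrite kext_base.
have inj : injective (fun q : qpath E y z => pcat p q).
  move=> q1 q2 /(congr1 (@sval _ _)) /= /eqP.
  by rewrite eqseq_cat // eqxx /= => /eqP; exact: sig_eq.
by rewrite -(kext_map_dval (coord fb f) q inj) -(kext_map_dval (coord fb f') q inj) -!E1 e.
Qed.

Lemma comp_pval_injl x y z (q : qpath E y z) :
  injective (fun g : hom C x y => comp (pval beta q) g).
Proof.
move=> f f' /(congr1 (coord fb (y := z))); rewrite !coord_comp !coord_pval => e.
apply: (coord_inj (fb := fb)); apply: dsumP => p.
have E1 (u : kfun k (qpath E x y)) : kcomp (kbase q) u = kext (fun p => kbase (pcat p q)) u.
  by rewrite /kcomp kext_base.
have inj : injective (fun p : qpath E x y => pcat p q).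
  move=> q1 q2 /(congr1 (@sval _ _)) /= e'; apply: sig_eq.
  have := congr1 (fun s => take (size s - size (sval q)) s) e'.
  by rewrite !size_cat !addnK !take_size_cat.
by rewrite -(kext_map_dval (coord fb f) p inj) -(kext_map_dval (coord fb f') p inj) -!E1 e.
Qed.
End Cancellation.

Section Homogeneous.
Variables (k : fieldType) (L0 : Type) (V : L0 -> L0 -> lmodType k).
Variables (G : finGroupType) (rho : forall x y : L0, linact G (V x y)).

Definition fbasis x y : set (V x y) := sval (cid (adapted_basis (rho x y))).

Definition farrow x y : Type := {v : V x y | fbasis v}.
Definition farrow_vec x y (e : farrow x y) : V x y := sval e.

Lemma farrow_vec_basis x y : vbasis (@farrow_vec x y).
Proof.
by have [bB _] := svalP (cid (adapted_basis (rho x y))); exact: is_basis_vbasis bB.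
Qed.

Lemma farrow_vec_fixed x y (f : kfun k {classic farrow x y}) :
  (forall g, lact (rho x y) g (kext (I := {classic farrow x y}) (@farrow_vec x y) f) =
             kext (I := {classic farrow x y}) (@farrow_vec x y) f) ->
  forall e : farrow x y, dval f e <> 0 -> forall g, lact (rho x y) g (farrow_vec e) = farrow_vec e.
Proof. by have [_ h] := svalP (cid (adapted_basis (rho x y))); exact: h. Qed.

Definition fbeta := word_arrow (E := farrow) farrow_vec.
Definition ffree : free_basis (C := freecat V) (E := farrow) fbeta :=
  freecat_free_basis farrow_vec_basis.

Definition gact g (x y : obj (freecat V)) : hom (freecat V) x y -> hom (freecat V) x y :=
  @hact k L0 V G rho g x y.

Lemma gact_linear g x y : linear (@gact g x y).
Proof. exact: hact_linear. Qed.

Lemma gact_comp g x y z (f : hom (freecat V) y z) (f' : hom (freecat V) x y) :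
  gact g (comp f f') = comp (gact g f) (gact g f').
Proof. exact: hact_comp. Qed.

Lemma gact_letter g x y (v : V x y) : gact g (letter v) = letter (lact (rho x y) g v).
Proof. by rewrite /gact /letter (hact_word rho g). Qed.

Lemma gact_id g x : gact g (idc x) = idc x.
Proof. by rewrite /gact /= /fid (hact_word rho g). Qed.

Lemma letter_inj x y : injective (@letter k L0 V x y).
Proof.
move=> v w; rewrite -[v](vcoordK farrow_vec_basis) -[w](vcoordK farrow_vec_basis).
rewrite -!(ev_ksingle farrow_vec) => /(bij_inj (ffree x y)) e.
congr kext; apply: dsumP => a.
have inj : injective (fun e : {classic farrow x y} => pone (e : farrow x y)).
  move=> e1 e2 /(congr1 (fun p => head (mkarrow (e1 : farrow x y)) (sval p))) h.
  exact: mkarrow_inj h.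
by rewrite -(kext_map_dval _ a inj) -[RHS](kext_map_dval _ a inj); congr dval.
Qed.

Lemma farrow_vec_neq0 x y (e : farrow x y) : farrow_vec e <> 0.
Proof.
move=> e0.
have /(bij_inj (farrow_vec_basis x y)) : kext (@farrow_vec x y : {classic farrow x y} -> _)
    (kbase (e : {classic farrow x y})) = kext (@farrow_vec x y : {classic farrow x y} -> _) 0.
  by rewrite kext_base (lin0 (kext_linear _)).
move=> /(congr1 (fun f : kfun k {classic farrow x y} => dval f e)).
by rewrite dval_kbase eqxx => /eqP; rewrite oner_eq0.
Qed.

(* The value 1 is a junk value for the basis vectors which are not eigenvectors. *)
Definition eigval (g : G) (e : arrow farrow) : k :=
  if pselect (exists c, lact (rho (src e) (tgt e)) g (farrow_vec (projT2 (projT2 e))) =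
                        c *: farrow_vec (projT2 (projT2 e))) is left h
  then sval (cid h) else 1.

Definition eigen (e : arrow farrow) : Prop := forall g,
  lact (rho (src e) (tgt e)) g (farrow_vec (projT2 (projT2 e))) =
  eigval g e *: farrow_vec (projT2 (projT2 e)).

Lemma eigval_neq0 g e : eigval g e != 0.
Proof.
rewrite /eigval; case: pselect => [h|_]; last exact: oner_neq0.
case: cid => c /= hc; apply/eqP => c0; apply: (farrow_vec_neq0 (e := projT2 (projT2 e))).
rewrite -(lact1 (rho (src e) (tgt e)) (farrow_vec _)) -(mulVg g) lactM hc c0 scale0r.
exact: linear0P (lact_linear _ _).
Qed.

Lemma lone_colinear x y (e : farrow x y) : (forall e' : farrow x y, e' = e) ->
  forall v : V x y, exists c, v = c *: farrow_vec e.
Proof.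
move=> lone v; exists (dval (vcoord farrow_vec_basis v) (e : {classic farrow x y})).
have vE : vcoord farrow_vec_basis v =
    (dval (vcoord farrow_vec_basis v) e : k) *: kbase (e : {classic farrow x y}).
  apply: dsumP => e'; rewrite (lone e') dvalZ dval_kbase eqxx.
  exact: esym (mulr1 _).
by rewrite -[LHS](vcoordK farrow_vec_basis) {1}vE (linZ (kext_linear _)) kext_base.
Qed.

Lemma lone_eigen (e : arrow farrow) :
  (forall e' : farrow (src e) (tgt e), e' = projT2 (projT2 e)) -> eigen e.
Proof.
move=> lone g; rewrite /eigval; case: pselect => [h|nh]; first by case: cid.
by case: nh; exact: lone_colinear.
Qed.

Definition pweight g (s : seq (arrow farrow)) : k := \prod_(e <- s) eigval g e.

Lemma gact_pval g x y (p : qpath farrow x y) : all (fun e => `[< eigen e >]) (sval p) ->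
  gact g (pval fbeta p) = pweight g (sval p) *: pval fbeta p.
Proof.
elim/qpath_ind: p => [u _|u v w e p IH].
  by rewrite pval_id gact_id /pweight big_nil scale1r.
rewrite [sval _]/= => /andP[/asboolP eig /IH {}IH].
rewrite pval_cat gact_comp IH pval_one /fbeta /word_arrow gact_letter.
have -> : lact (rho u v) g (farrow_vec e) = eigval g (mkarrow e) *: farrow_vec e := eig g.
rewrite (linZ (@letter_linear _ _ _ _ _)) /pweight big_cons.
by rewrite compZl compZr scalerA mulrC.
Qed.

Definition fixedp x y (p : qpath farrow x y) : Prop := forall g,
  gact g (pval fbeta p) = pval fbeta p.

(** Applying [g] to the composite leaves it and [p] unchanged; cancelling [p] shows that [q] is
    fixed. *)
Lemma fixedp_unitary x y z (p : qpath farrow x y) (q : qpath farrow y z) :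
  fixedp p -> fixedp (pcat p q) -> fixedp q.
Proof.
move=> fp fpq g; apply: (comp_pval_injr ffree (p := p)).
by have := fpq g; rewrite pval_cat gact_comp fp.
Qed.

Lemma fixedp_counitary x y z (p : qpath farrow x y) (q : qpath farrow y z) :
  fixedp q -> fixedp (pcat p q) -> fixedp p.
Proof.
move=> fq fpq g; apply: (comp_pval_injl ffree (q := q)).
by have := fpq g; rewrite pval_cat gact_comp fq.
Qed.

Lemma pval_neq0 x y (p : qpath farrow x y) : pval fbeta p <> 0.
Proof.
move=> /(congr1 (coord ffree (y := y))); rewrite coord_pval (lin0 (coord_linear _ (y := _))).
move=> /(congr1 (fun f : kfun k (qpath farrow x y) => dval f p)).
by rewrite dval_kbase eqxx => /eqP; rewrite oner_eq0.
Qed.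

Lemma fixedp_weight x y (p : qpath farrow x y) : all (fun e => `[< eigen e >]) (sval p) ->
  (fixedp p <-> forall g, pweight g (sval p) = 1).
Proof.
move=> eig; split=> [fp g|h g]; last by rewrite gact_pval // h scale1r.
have := fp g; rewrite gact_pval // => /eqP.
rewrite -subr_eq0 -[X in _ - X]scale1r -scalerBl scaler_eq0 subr_eq0.
by case/orP => /eqP // /pval_neq0.
Qed.

Let Q := quiver_graph farrow.

Hypothesis nb_deg : forall e v, @nonbridge Q e -> linked (Q := Q) (src e) v -> deg_le2 Q v.

Lemma eigen_or_parallel (e : arrow farrow) : eigen e \/
  exists e' : farrow (src e) (tgt e), e' <> projT2 (projT2 e).
Proof.
have [[e' ne]|h] := pselect (exists e' : farrow (src e) (tgt e), e' <> projT2 (projT2 e)).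
  by right; exists e'.
by left; apply: lone_eigen => e'; apply: contrapT => ne; apply: h; exists e'.
Qed.

Lemma parallel_nonbridge (e : arrow farrow) (e' : farrow (src e) (tgt e)) :
  e' <> projT2 (projT2 e) -> @nonbridge Q e.
Proof.
move=> ne; exists [:: (mkarrow e', false) : hedge Q]; split=> //=.
rewrite andbT; apply/asboolP => h; apply: ne; case: e e' h => x [y e] e'.
exact: mkarrow_inj.
Qed.

(* If V x y has dimension at least 2, then x and y form a component of the quiver. *)
Lemma not_eigen_single x y (p0 : qpath farrow x y) : ~~ all (fun e => `[< eigen e >]) (sval p0) ->
  forall p : qpath farrow x y, exists e : farrow x y, p = pone e.
Proof.
move=> neig.
have [s1 [e [s2 [p0E ne]]]] : exists s1 e s2, sval p0 = s1 ++ e :: s2 /\ ~ eigen e.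
  elim: (sval p0) neig => [//|e s IH] /=.
  have [_ /IH[s1 [e' [s2 [-> ne]]]]|ne _] := boolP `[< eigen e >].
    by exists (e :: s1), e', s2.
  by exists [::], e, s; split=> //; move/asboolP: ne.
have [//|[e' ne']] := eigen_or_parallel e.
have nb := parallel_nonbridge ne'.
have ds := nb_deg nb (linked_refl (Q := Q) (src e)).
have dt := nb_deg nb (linked_hedge (Q := Q) (e, false)).
have eqe : mkarrow e' <> e.
  by move=> h; apply: ne'; case: (e) e' h => u [v a] b; exact: mkarrow_inj.
(* The parallel arrows [e] and [e'] exhaust the degree of both their ends, so no arrow enters the
   source or leaves the target. *)
have out (f : hedge Q) : hs f = src e -> f = (e, false) \/ f = (mkarrow e', false).
  by move=> sf; apply: ds => // -[/esym].
have inn (f : hedge Q) : hs f = tgt e -> f = (e, true) \/ f = (mkarrow e', true).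
  by move=> sf; apply: dt => // -[/esym].
have st : src e <> tgt e.
  by move=> h; have [|//|//] := out (e, true).
have w0 := svalP p0; rewrite p0E in w0.
have [a [wa /= [ea wb]]] := walk_split w0; rewrite -ea in wa => {a ea}.
have ex : x = src e.
  case/lastP: s1 wa {p0E w0} => [|s1 f] // wa.
  rewrite -cats1 in wa; have [b [_ /= [_ tf]]] := walk_split wa.
  by have [|//|//] := out (f, true).
have ey : y = tgt e.
  case: s2 wb {p0E w0} => [|f s2] /= wb; first by [].
  by case: wb => sf _; have [|//|//] := inn (f, false).
subst x y; move=> [[|f s] w]; first by case: st.
have [sf wf] := w.
have tf : tgt f = tgt e.
  by have [|[->]|[->]] := out (f, false).
case: s w wf => [|f' s] w wf; last first.
  by case: wf => sf' _; rewrite tf in sf'; have [|//|//] := inn (f', false).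
have [a fa] : exists a : farrow (src e) (tgt e), f = mkarrow a.
  have [|[->]|[->]] := out (f, false) => //; last by exists e'.
  by case: (e) => u [v a]; exists a.
by exists a; apply: sig_eq; rewrite /= fa.
Qed.

(** Either all the paths from [x] to [y] are products of eigenvectors, and [G] acts diagonally on
    the path basis; or they are all single arrows, the morphisms are those of [V x y], and the
    choice of an adapted basis concludes. *)
Lemma fixed_support x y (f : hom (freecat V) x y) : (forall g, gact g f = f) ->
  forall p, dval (coord ffree f) p <> 0 -> fixedp p.
Proof.
move=> fixf p fp.
have [alleig|] := pselect (forall p0 : qpath farrow x y, all (fun e => `[< eigen e >]) (sval p0)).
  apply/(fixedp_weight (alleig p)) => g.
  have actE h : dval (coord ffree (gact g h)) p =
      pweight g (sval p) * (dval (coord ffree h) p : k) :> k.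
    elim/(hom_ind ffree): h => [|a u v hu hv|q].
    - by rewrite (lin0 (@gact_linear _ _ _)) (lin0 (coord_linear _ (y := _))) mulr0.
    - by rewrite gact_linear !(coord_linear ffree) !dvalP hu hv mulrDr mulrCA.
    - rewrite gact_pval // (linZ (coord_linear _ (y := _))) coord_pval dvalZ dval_kbase.
      by case: eqP => [->|]; rewrite ?mulr0.
  have := actE f; rewrite fixf => e; apply/eqP; rewrite -subr_eq0.
  have /eqP : (pweight g (sval p) - 1) * (dval (coord ffree f) p : k) = 0.
    by rewrite mulrBl mul1r -e subrr.
  by rewrite mulf_eq0 => /orP[//|/eqP].
move=> /existsNP[p0 /negP neig].
have single := not_eigen_single neig.
have [h hE] : exists h, ksingle h = coord ffree f.
  rewrite -[coord ffree f]kext_kbase.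
  apply: (kext_supp (P := fun u => exists h, ksingle h = u)) => [|a u v [h1 <-] [h2 <-]|q _].
  - by exists 0; rewrite (lin0 (@ksingle_linear _ _ _ _ _)).
  - by exists (a *: h1 + h2); rewrite ksingle_linear.
  - have [e ->] := single q; exists (kbase (e : {classic farrow x y})).
    exact: kext_base.
have fE : f = letter (kext (@farrow_vec x y : {classic farrow x y} -> _) h).
  by rewrite -[f](coordK ffree) -hE; exact: ev_ksingle.
have [e pE] := single p; rewrite pE.
have inj : injective (fun e : {classic farrow x y} => pone (e : farrow x y)).
  move=> e1 e2 /(congr1 (fun p => head (mkarrow (e1 : farrow x y)) (sval p))) h'.
  exact: mkarrow_inj h'.
move=> g; rewrite pval_one /fbeta /word_arrow gact_letter; congr letter.
apply: (farrow_vec_fixed (f := h)) => [g'|].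
  by apply: letter_inj; rewrite -gact_letter -fE.
by move=> h0; apply: fp; rewrite pE -hE /ksingle (kext_map_dval _ _ inj).
Qed.

Section FixedSub.
Variable A : set L0.

Let K := @fullsub k (fixcat (homogeneous rho)) A.

Definition fixE (x y : {x | A x}) : Type :=
  @irrE k (freecat V) K farrow sval (fun x y => @fixedp (sval x) (sval y)) x y.

Lemma fixed_free_basis : exists beta' : forall x y, fixE x y -> hom K x y,
  @free_basis k K fixE beta'.
Proof.
pose io (x y : obj K) (f : hom K x y) : hom (freecat V) (sval x) (sval y) := fixval f.
have D_img (x y : obj K) (p : qpath farrow (sval x) (sval y)) :
    fixedp p -> exists f, io x y f = pval fbeta p.
  move=> fp; have fp' : pval fbeta p \in fixed_pred (hact_linact rho (sval x) (sval y)).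
    by apply/asboolP.
  by exists (FixMod fp').
exists (@irr_hom k (freecat V) K farrow fbeta sval io
  (fun x y => @fixedp (sval x) (sval y)) D_img).
apply: (irr_free_basis (fb := ffree)) => //.
- exact: (@sig_eq _ A).
- by move=> x y f g; exact: val_inj.
- move=> x y f p; apply: fixed_support => g.
  by have /asboolP h := fixvalP f; exact: h.
- by move=> x y z p q; exact: fixedp_unitary.
Qed.
End FixedSub.
End Homogeneous.

(** * Invariants of a tame category *)

Section Forest.
Variables (k : fieldType) (L0 : Type) (V : L0 -> L0 -> lmodType k).
Variables (G : finGroupType) (rho : forall x y : L0, linact G (V x y)).

Definition fquiver := quiver_graph (farrow rho).
Let Q := fquiver.

Definition forest (x : L0) : Prop := forall e : edge Q, linked (Q := Q) x (src e) -> ~ nonbridge e.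

(* On a forest the weights of the arrows derive from a potential, and the weight of a walk *)
(* is the quotient of the potentials of its ends.                                        *)
Definition same_pot (x y : L0) : Prop :=
  exists l, walk (@hs Q) (@ht Q) x y l /\ forall g, weight (Q := Q) (eigval (rho := rho) g) l = 1.

Lemma same_pot_refl x : same_pot x x.
Proof. by exists [::]; split=> // g; rewrite /weight big_nil. Qed.

Lemma same_pot_sym x y : same_pot x y -> same_pot y x.
Proof.
move=> [l [wl w1]]; exists (rev (map (@flip Q) l)); split; first exact: walk_rev.
by move=> g; have := weight_rev (Q := Q) (fun e => eigval_neq0 g e) l; rewrite w1 mul1r.
Qed.

Lemma same_pot_trans x y z : same_pot x y -> same_pot y z -> same_pot x z.
Proof.
move=> [l [wl w1]] [l' [wl' w1']]; exists (l ++ l'); split; first exact: walk_cat wl wl'.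
by move=> g; rewrite weight_cat w1 w1' mulr1.
Qed.

Lemma same_pot_linked x y : same_pot x y -> linked (Q := Q) x y.
Proof. by move=> [l [wl _]]; exists l. Qed.

Lemma forest_linked x y : linked (Q := Q) x y -> forest x -> forest y.
Proof. by move=> xy fx e ye; apply: fx; exact: linked_trans xy ye. Qed.

Definition steps (s : seq (arrow (farrow rho))) : seq (hedge Q) :=
  [seq ((e, false) : hedge Q) | e <- s].

Lemma walk_steps x y s : walk (@src _ (farrow rho)) (@tgt _ (farrow rho)) x y s ->
  walk (@hs Q) (@ht Q) x y (steps s).
Proof. by elim: s x => [|e s IH] x //= [sx /IH w]; split. Qed.

Lemma path_linked x y (p : qpath (farrow rho) x y) : linked (Q := Q) x y.
Proof. by exists (steps (sval p)); exact: walk_steps (svalP p). Qed.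

Lemma weight_steps g s : weight (Q := Q) (eigval (rho := rho) g) (steps s) = pweight g s.
Proof. by rewrite /weight big_map. Qed.

(** A parallel arrow would give a circuit; on a forest each arrow is thus alone between its ends and
    spans a line stable under [G]. *)
Lemma forest_eigen x y (p : qpath (farrow rho) x y) : forest x ->
  all (fun e => `[< eigen e >]) (sval p).
Proof.
case: p => s /= w; elim: s x w => [//|e s IH] x /= [sx w] fx.
apply/andP; split.
  apply/asboolP; have [//|[e' ne]] := eigen_or_parallel e.
  by subst x; case: (fx e (linked_refl _)); exact: parallel_nonbridge ne.
apply: IH w _; apply: forest_linked fx; subst x.
exact: (linked_hedge (Q := Q) (e, false)).
Qed.

Lemma forest_fixed x y (p : qpath (farrow rho) x y) : forest x ->
  (fixedp p <-> forall g, pweight g (sval p) = 1).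
Proof. by move=> fx; apply: fixedp_weight; exact: forest_eigen. Qed.

Lemma fixed_same_pot x y (p : qpath (farrow rho) x y) : forest x -> fixedp p -> same_pot x y.
Proof.
move=> fx /(forest_fixed p fx) pw; exists (steps (sval p)); split.
  exact: walk_steps (svalP p).
by move=> g; rewrite weight_steps.
Qed.

(** Following [p] and returning along [l] is a closed walk, of weight 1 by [weight_closed]; since
    [l] has weight 1, so has [p]. *)
Lemma same_pot_fixed x y (p : qpath (farrow rho) x y) : forest x -> same_pot x y -> fixedp p.
Proof.
move=> fx [l [wl w1]]; apply/(forest_fixed p fx) => g.
have closed : walk (@hs Q) (@ht Q) x x (steps (sval p) ++ rev (map (@flip Q) l)).
  by apply: walk_cat (walk_steps (svalP p)) _; exact: walk_rev wl.
have := @weight_closed Q k (eigval (rho := rho) g) (fun e => eigval_neq0 g e) x fx _ closed.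
rewrite weight_cat weight_steps.
have := weight_rev (Q := Q) (fun e => eigval_neq0 g e) l; rewrite w1 mul1r => ->.
by rewrite mulr1.
Qed.
End Forest.

Section DegreeTwoPaths.
Variables (X : Type) (E : X -> X -> Type).
Let Q := quiver_graph E.

(** The arrow [e] takes one of the two half-edges at its target, so the next arrow is forced, and so
    on along the shorter path. *)
Lemma prefix_of_deg2 x y y' e s s' :
  (forall v, linked (Q := Q) x v -> deg_le2 Q v) ->
  walk (@src _ E) (@tgt _ E) x y (e :: s) -> walk (@src _ E) (@tgt _ E) x y' (e :: s') ->
  (exists r, s' = s ++ r) \/ (exists r, s = s' ++ r).
Proof.
elim: s s' x e => [|f s IH] s' x e deg; first by left; exists s'.
case: s' => [|f' s'] [sx [sf w]] [_ w']; first by right; exists (f :: s).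
case: w' => sf' w'.
have xt : linked (Q := Q) x (tgt e) by rewrite -sx; exact: (linked_hedge (Q := Q) (e, false)).
have ff' : f = f'.
  apply: contrapT => ne.
  have [|//|//] := deg _ xt (f, false) (f', false) (e, true) sf sf' erefl.
  by case.
subst f'; have [|[r ->]|[r ->]] := IH s' (tgt e) f _ (conj sf w) (conj sf' w').
- by move=> v tv; apply: deg; exact: linked_trans xt tv.
- by left; exists r.
- by right; exists r.
Qed.

Lemma suffix_of_deg2 x x' y e s s' :
  (forall v, linked (Q := Q) y v -> deg_le2 Q v) ->
  walk (@src _ E) (@tgt _ E) x y (rcons s e) -> walk (@src _ E) (@tgt _ E) x' y (rcons s' e) ->
  (exists r, s' = r ++ s) \/ (exists r, s = r ++ s').
Proof.
elim/last_ind: s s' y e => [|s f IH] s' y e deg; first by left; exists s'; rewrite cats0.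
case/lastP: s' => [|s' f'] w w'; first by right; exists (rcons s f); rewrite cats0.
rewrite -cats1 in w; have [z [w1 /= [sz ty]]] := walk_split w.
rewrite -cats1 in w'; have [z' [w1' /= [sz' _]]] := walk_split w'.
rewrite -sz in w1; rewrite -sz' in w1'.
have yt : linked (Q := Q) y (src e).
  by rewrite -ty; apply: linked_sym; exact: (linked_hedge (Q := Q) (e, false)).
have tf : tgt f = src e.
  by move: w1; rewrite -cats1 => w2; have [? [_ /= [_ ?]]] := walk_split w2.
have tf' : tgt f' = src e.
  by move: w1'; rewrite -cats1 => w2; have [? [_ /= [_ ?]]] := walk_split w2.
have ff' : f = f'.
  apply: contrapT => ne.
  have [|//|//] := deg _ yt (f, true) (f', true) (e, false) tf tf' erefl.
  by case.
subst f'; have [|[r ->]|[r ->]] := IH s' (src e) f _ w1 w1'.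
- by move=> v tv; apply: deg; exact: linked_trans yt tv.
- by left; exists r; rewrite rcons_cat.
- by right; exists r; rewrite rcons_cat.
Qed.
End DegreeTwoPaths.

Section TameFixed.
Variables (k : fieldType) (L0 : Type) (V : L0 -> L0 -> lmodType k).
Variables (G : finGroupType) (rho : forall x y : L0, linact G (V x y)).
Hypothesis tame : finitely_objects (@tame_rep_type k) (freecat V).
Variable A : set L0.
Hypothesis A_fin : finite_set [set: {x | A x}].

Let Q := fquiver rho.
Let R := quiver_graph (@fixE k L0 V G rho A).

Let nb_deg e v : @nonbridge Q e -> linked (Q := Q) (src e) v -> deg_le2 Q v.
Proof. exact: (tame_nonbridge (ffree rho) tame). Qed.

Lemma nonforest_deg x : ~ forest rho x -> forall v, linked (Q := Q) x v -> deg_le2 Q v.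
Proof.
move=> /existsNP[e /not_implyP[xe /contrapT nb]] v xv; apply: (nb_deg nb).
exact: linked_trans (linked_sym xe) xv.
Qed.

Lemma fix_linked (u v : {x | A x}) : linked (Q := R) u v -> linked (Q := Q) (sval u) (sval v).
Proof.
pose S (w : vertex R) : Prop := linked (Q := Q) (sval u) (sval w).
have cl (h : hedge R) : S (hs h) -> S (ht h).
  move=> uh; apply: linked_trans uh _; case: h => [[x [y e]] b].
  have xy : linked (Q := Q) (sval x) (sval y) := path_linked (sval e).
  by case: b; rewrite /ht /hs /=; [exact: linked_sym xy|exact: xy].
move=> uv; exact: (linked_closed cl uv (linked_refl _)).
Qed.

(** Irreducible fixed paths leaving [v] by the same arrow are comparable by [prefix_of_deg2], hence
    equal by [irr_prefix_eq]; those arriving are treated symmetrically. *)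
Lemma nonforest_fix_deg (v : {x | A x}) : ~ forest rho (sval v) -> deg_le2 R v.
Proof.
move=> nf; have deg := nonforest_deg nf.
have o_inj : injective (sval : {x | A x} -> L0) := @sig_eq _ A.
pose K := @fullsub k (fixcat (homogeneous rho)) A.
pose D (x y : obj K) (p : qpath (farrow rho) (sval x) (sval y)) := fixedp p.
have D_unitary x y z p q : D x y p -> D x z (pcat p q) -> D y z q by exact: fixedp_unitary.
have D_counitary x y z p q : D y z q -> D x z (pcat p q) -> D x y p by exact: fixedp_counitary.
have irr_walk (e : edge R) s : sval (sval (projT2 (projT2 e))) = s ->
    walk (@src _ (farrow rho)) (@tgt _ (farrow rho)) (sval (src e)) (sval (tgt e)) s.
  by move=> <-; exact: (svalP (sval (projT2 (projT2 e)))).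
have prefix (e1 e2 : edge R) (f : edge Q) s1 s2 : src e1 = v -> src e2 = v ->
    sval (sval (projT2 (projT2 e1))) = f :: s1 ->
    sval (sval (projT2 (projT2 e2))) = f :: s2 -> e1 = e2.
  move=> v1 v2 p1 p2.
  have w1 := irr_walk _ _ p1; have w2 := irr_walk _ _ p2; rewrite v1 in w1; rewrite v2 in w2.
  have v12 : src e1 = src e2 by rewrite v1 v2.
  have [[r er]|[r er]] := prefix_of_deg2 deg w1 w2.
  - apply: (@irr_prefix_eq k (freecat V) K (farrow rho) sval o_inj D D_unitary e1 e2 r [::] v12).
    by rewrite p1 p2 er cats0.
  - apply: (@irr_prefix_eq k (freecat V) K (farrow rho) sval o_inj D D_unitary e1 e2 [::] r v12).
    by rewrite p1 p2 er cats0.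
have suffix (e1 e2 : edge R) (f : edge Q) s1 s2 : tgt e1 = v -> tgt e2 = v ->
    sval (sval (projT2 (projT2 e1))) = rcons s1 f ->
    sval (sval (projT2 (projT2 e2))) = rcons s2 f -> e1 = e2.
  move=> v1 v2 p1 p2.
  have w1 := irr_walk _ _ p1; have w2 := irr_walk _ _ p2; rewrite v1 in w1; rewrite v2 in w2.
  have v12 : tgt e1 = tgt e2 by rewrite v1 v2.
  have [[r er]|[r er]] := suffix_of_deg2 deg w1 w2.
  - apply: (@irr_suffix_eq k (freecat V) K (farrow rho) sval o_inj D D_counitary e1 e2 r [::] v12).
    by rewrite p1 p2 er rcons_cat.
  - apply: (@irr_suffix_eq k (freecat V) K (farrow rho) sval o_inj D D_counitary e1 e2 [::] r v12).
    by rewrite p1 p2 er rcons_cat.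
(* The half-edges of R inject into those of Q: a path is replaced by its first or last arrow. *)
pose mu_spec (h : hedge R) (h' : hedge Q) := h'.2 = h.2 /\ exists s,
  sval (sval (projT2 (projT2 h.1))) = if h.2 then rcons s h'.1 else h'.1 :: s.
have mu_ex (h : hedge R) : exists h', mu_spec h h'.
  case: h => [[x [y [p [fp ne dec]]]] b]; rewrite /mu_spec /=.
  case: b.
    by case/lastP: (sval p) ne => [//|s f] _; exists (f, true); split=> //; exists s.
  by case: (sval p) ne => [//|f s] _; exists (f, false); split=> //; exists s.
have mu_hs (h : hedge R) (h' : hedge Q) : mu_spec h h' -> hs h' = sval (hs h).
  case: h h' => [e b] [f b'] [/= -> [s es]].
  have w := irr_walk _ _ es.
  case: b es w => es w; last by case: w.
  by rewrite -cats1 in w; have [? [_ /= [_ ?]]] := walk_split w.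
have mu_inj (h1 h2 : hedge R) h' : hs h1 = v -> hs h2 = v ->
    mu_spec h1 h' -> mu_spec h2 h' -> h1 = h2.
  case: h1 h2 h' => [e1 b1] [e2 b2] [f b] s1 s2 [/= eb [r1 er1]] [/= eb2 [r2 er2]].
  subst b b2; congr pair; case: b1 s1 s2 er1 er2 => s1 s2 er1 er2.
    exact: suffix er1 er2.
  exact: prefix er1 er2.
move=> h1 h2 h3 s1 s2 s3 ne.
have [m1 M1] := mu_ex h1; have [m2 M2] := mu_ex h2; have [m3 M3] := mu_ex h3.
have ne' : m1 <> m2 by move=> e; apply: ne; apply: mu_inj s1 s2 M1 _; rewrite e.
have [|||e|e] := deg _ (linked_refl _) m1 m2 m3 _ _ _ ne'.
- by rewrite (mu_hs _ _ M1) s1.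
- by rewrite (mu_hs _ _ M2) s2.
- by rewrite (mu_hs _ _ M3) s3.
- by left; apply: mu_inj s3 s1 M3 _; rewrite e.
- by right; apply: mu_inj s3 s2 M3 _; rewrite e.
Qed.

Lemma sub_finite (A' : set L0) : A' `<=` A -> finite_set [set: {x | A' x}].
Proof.
move=> sub; have [n [c c_surj]] := finite_setT_enum A_fin.
pose idx (x : {x | A' x}) : 'I_n := sval (cid (c_surj (exist _ (sval x) (sub _ (svalP x))))).
have idx_inj : injective idx.
  move=> x y; rewrite /idx; case: cid => i /= ei; case: cid => j /= ej ij; apply: sig_eq.
  by have := congr1 sval ei; rewrite ij ej /= => <-.
have [m [d d_bij]] := inj_fin_bij idx_inj.
exact: enum_finite_setT (bij_surj d_bij).
Qed.

(** On a level set [A'] of the potential every path is fixed, and a fixed path starting in [A'] ends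
    in it if its end is in [A]. So its irreducible fixed paths are the irreducible paths of the full
    subcategory of [freecat V] on [A'], which is tame. *)
Lemma forest_fix_dynkin (u : {x | A x}) : forest rho (sval u) ->
  dynkin_on R (fun v => same_pot rho (sval u) (sval v)).
Proof.
move=> fu; pose A' : set L0 := [set x | A x /\ same_pot rho (sval u) x].
have subA : A' `<=` A by move=> x [].
have du : is_dynkin_union (quiver_graph (@fullE k (freecat V) (farrow rho) A')).
  by apply: (fullsub_dynkin (ffree rho)); apply: tame; exact: sub_finite.
pose inc (x : {x | A' x}) : {x | A x} := exist _ (sval x) (subA _ (svalP x)).
have fA' x : A' x -> forest rho x.
  by move=> [_ ux]; exact: forest_linked (same_pot_linked ux) fu.
have fixA' x y (p : qpath (farrow rho) x y) : A' x -> A' y -> fixedp p.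
  move=> Ax Ay; apply: same_pot_fixed; first exact: fA'.
  by case: Ax Ay => [_ ux] [_ uy]; exact: same_pot_trans (same_pot_sym ux) uy.
have A'_end x y (p : qpath (farrow rho) x y) : A' x -> A y -> fixedp p -> A' y.
  move=> Ax Ay fp; split=> //; case: (Ax) => _ ux; apply: same_pot_trans ux _.
  by apply: (fixed_same_pot _ fp); exact: fA'.
have irr_inc (x y : {x | A' x}) (e : @fullE k (freecat V) (farrow rho) A' x y) :
    @irr k (freecat V) (@fullsub k (fixcat (homogeneous rho)) A) (farrow rho) sval
      (fun x y => @fixedp k L0 V G rho (sval x) (sval y)) (inc x) (inc y) (sval e).
  have [_ ne dec] := svalP e; split=> //; first exact: (fixA' _ _ (sval e) (svalP x) (svalP y)).
  move=> z p1 p2 pp f1 f2; have Az : A' (sval z) by exact: (A'_end _ _ p1 (svalP x) (svalP z) f1).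
  exact: (dec (exist _ (sval z) Az) p1 p2 pp).
pose psi (e : arrow (@fullE k (freecat V) (farrow rho) A')) : edge R :=
  mkarrow (exist _ (sval (projT2 (projT2 e))) (irr_inc _ _ (projT2 (projT2 e)))
    : fixE rho (inc (src e)) (inc (tgt e))).
have inc_inj : injective inc by move=> x y /(congr1 sval) /= e; exact: sig_eq.
apply: (@dynkin_on_map (quiver_graph (@fullE k (freecat V) (farrow rho) A')) R inc psi) du => //.
- move=> [x [y e]] [x' [y' e']] h.
  have hx : x = x' := inc_inj _ _ (projT1_eq h); subst x'.
  have h2 := existT_inj h; have hy : y = y' := inc_inj _ _ (projT1_eq h2); subst y'.
  have h3 : sval e = sval e' := congr1 sval (existT_inj h2).
  by have -> : e = e' by exact: sig_eq.
- move=> v; split=> [uv|[x <-]]; last by have [] := svalP x.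
  have Av : A' (sval v) by split=> //; exact: svalP v.
  by exists (exist _ (sval v) Av); exact: sig_eq.
- move=> [x [y e]] ux.
  have Ax : A' (sval x) by split=> //; exact: svalP x.
  have Ay : A' (sval y).
    by have [fp _ _] := svalP e; exact: (A'_end _ _ (sval e) Ax (svalP y) fp).
  have [X eX] : exists X, inc X = x by exists (exist _ (sval x) Ax); exact: sig_eq.
  have [Y eY] : exists Y, inc Y = y by exists (exist _ (sval y) Ay); exact: sig_eq.
  subst x y; have [fp ne dec] := svalP e.
  have ie : @irr k (freecat V) (@fullsub k (freecat V) A') (farrow rho) sval
      (fun _ _ _ => True) X Y (sval e).
    split=> // z p1 p2 pp _ _; have Az := svalP z.
    apply: (dec (inc z) p1 p2 pp).
      exact: (fixA' _ _ p1 Ax Az).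
    exact: (fixA' _ _ p2 Az Ay).
  exists (mkarrow (exist _ (sval e) ie : @fullE k (freecat V) (farrow rho) A' X Y)).
  by congr mkarrow; exact: sig_eq.
Qed.

(** Forest vertices are grouped by [same_pot], the others by components of the fixed quiver. The two
    kinds do not meet, since vertices linked in the fixed quiver are linked in [Q]. *)
Theorem fix_tame : tame_rep_type (fullsub (C := fixcat (homogeneous rho)) A).
Proof.
have nbd := nb_deg.
have [b fb] := @fixed_free_basis k L0 V G rho nbd A.
apply: (free_basis_tame fb); apply: dynkin_on_full.
have [n [c c_surj]] := finite_setT_enum A_fin.
pose R1 (u v : {x | A x}) := same_pot rho (sval u) (sval v).
have d1 := @dynkin_on_classes R R1 (fun u => forest rho (sval u)) n c
  (fun u v => @same_pot_sym _ _ _ _ _ _ _) (fun u v w => @same_pot_trans _ _ _ _ _ _ _ _)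
  forest_fix_dynkin.
have d2 := @dynkin_on_classes R (linked (Q := R)) (fun u => ~ forest rho (sval u)) n c
  (@linked_sym R) (@linked_trans R)
  (fun u nf => @component_deg2 R u n c c_surj (fun v uv => nonforest_fix_deg
     (fun fv => nf (forest_linked (linked_sym (fix_linked uv)) fv)))).
apply: dynkin_on_ext (dynkin_onU _ d1 d2) => [v|v [i [fi iv]] [j [nfj jv]]]; last first.
  apply: nfj; apply: forest_linked (linked_sym (fix_linked jv)) _.
  exact: forest_linked (same_pot_linked iv) fi.
split=> // _; have [i ei] := c_surj v.
have [fv|nfv] := pselect (forest rho (sval v)).
  by left; exists i; rewrite ei; split=> //; exact: same_pot_refl.
by right; exists i; rewrite ei; split=> //; exact: linked_refl.
Qed.
End TameFixed.

(** * Jordan modules *)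

Section Jordan.
Variables (k : fieldType) (d : nat).

Definition jordan : 'M[k]_d.+1 := \matrix_(i, j) ((i.+1 == j :> nat)%:R).

Lemma mul_jordan0 (v : 'rV[k]_d.+1) : (v *m jordan) 0 ord0 = 0.
Proof. by rewrite !mxE big1 // => i _; rewrite mxE mulr0. Qed.

Lemma mul_jordanS (v : 'rV[k]_d.+1) (i j : 'I_d.+1) : i.+1 = j -> (v *m jordan) 0 j = v 0 i.
Proof.
move=> ij; rewrite mxE (bigD1 i) //= mxE ij eqxx mulr1 big1 ?addr0 // => i' ne.
rewrite mxE -ij eqSS; case: eqP => [e|_]; last by rewrite mulr0.
by case/eqP: ne; exact: val_inj.
Qed.

Lemma jordan_nilpotent (v : 'rV[k]_d.+1) m (j : 'I_d.+1) : (j < m)%N ->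
  iter m (fun u => u *m jordan) v 0 j = 0.
Proof.
elim: m j => [//|m IH] [[|j] hj] jm.
  by rewrite iterS (_ : Ordinal hj = ord0) ?mul_jordan0 //; exact: val_inj.
by rewrite iterS (@mul_jordanS _ (Ordinal (ltnW hj))) // IH.
Qed.

(** The last nonzero iterate of a nonzero vector of [W] lies in the kernel of the nilpotent block,
    which is the line of the last basis vector. *)
Lemma jordan_stable (W : {vspace 'rV[k]_d.+1}) :
  (forall v, v \in W -> v *m jordan \in W) -> W != 0%VS ->
  delta_mx 0 ord_max \in W.
Proof.
move=> stab W0; have vW := memv_pick W; have v0 : vpick W != 0 by rewrite vpick0.
set v := vpick W in vW v0.
have iterW m : iter m (fun u => u *m jordan) v \in W.
  by elim: m => [//|m IH]; rewrite iterS; exact: stab.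
have ex0 : exists m, iter m (fun u => u *m jordan) v == 0.
  by exists d.+1; apply/eqP/rowP => j; rewrite jordan_nilpotent ?mxE.
case: (ex_minnP ex0) => -[|m] /eqP m0 minm; first by move: v0; rewrite [v]m0 eqxx.
set u := iter m (fun u => u *m jordan) v; have u0 : u != 0.
  by apply/eqP => e; have := minm m; rewrite -/u e eqxx ltnn => /(_ isT).
have uJ : u *m jordan = 0 by rewrite -m0 iterS.
have uE : u = u 0 ord_max *: delta_mx 0 ord_max.
  apply/rowP => j; rewrite !mxE eqxx /=.
  have [->|ne] := eqVneq j ord_max; first by rewrite mulr1.
  have jd : (j < d)%N.
    by rewrite ltn_neqAle -ltnS ltn_ord andbT; apply: contra ne => /eqP e; apply/eqP/val_inj.
  rewrite mulr0 -(@mul_jordanS _ j (Ordinal (jd : j.+1 < d.+1)%N)) // uJ mxE //.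
have c0 : u 0 ord_max != 0 by apply: contraNneq u0 => e; rewrite uE e scale0r.
rewrite -[delta_mx _ _]scale1r -(mulVf c0) -scalerA -uE.
exact/memvZ/iterW.
Qed.

Lemma jordan_indecomposable (W W' : {vspace 'rV[k]_d.+1}) :
  (forall v, v \in W -> v *m jordan \in W) -> (forall v, v \in W' -> v *m jordan \in W') ->
  (W :&: W' = 0)%VS -> W != 0%VS -> W' != 0%VS -> False.
Proof.
move=> sW sW' dis W0 W'0.
have : (delta_mx 0 ord_max : 'rV[k]_d.+1) \in (W :&: W')%VS.
  by rewrite memv_cap !jordan_stable.
rewrite dis memv0 => /eqP/rowP/(_ ord_max); rewrite !mxE !eqxx /=.
by move/eqP; rewrite oner_eq0.
Qed.
End Jordan.

Section JordanModule.
Variables (k : fieldType) (C : kCat k).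
Variables (E : obj C -> obj C -> Type) (beta : forall x y, E x y -> hom C x y).
Hypothesis fb : free_basis beta.
Variable e : arrow E.
Variable A : set (obj C).
Variable d : nat.

(** A path is sent to the indeterminate raised to the number of times it traverses [e], then
    evaluated at the Jordan block. Commutativity of polynomials makes the order of composition
    immaterial. *)
Definition mark (a : arrow E) : {poly k} := if `[< a = e >] then 'X else 1.

Definition markp x y (p : qpath E x y) : {poly k} := \prod_(a <- sval p) mark a.

Definition markf x y (f : kfun k (qpath E x y)) : {poly k} := kext (@markp x y) f.

Lemma markf_linear x y : linear (@markf x y).
Proof. exact: kext_linear. Qed.

Lemma markf_comp x y z (f : kfun k (qpath E y z)) (g : kfun k (qpath E x y)) :
  markf (kcomp f g) = markf f * markf g.
Proof.
apply: (bilin_ext (F := fun f g => markf (kcomp f g)) (G := fun f g => markf f * markf g)).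
- by move=> g' a f1 f2; rewrite kcomp_linl markf_linear.
- by move=> g' a f1 f2; rewrite kcomp_linr markf_linear.
- by move=> g' a f1 f2; rewrite markf_linear mulrDl scalerAl.
- by move=> g' a f1 f2; rewrite markf_linear mulrDr scalerAr.
- move=> p q; rewrite kcomp_base /markf !kext_base /markp big_cat.
  exact: mulrC.
Qed.

Let J := jordan k d.

Definition jmap x y (f : hom (fullsub A) x y) : 'Hom('rV[k]_d.+1, 'rV[k]_d.+1) :=
  linfun (mulmxr (horner_mx J (markf (coord fb (f : hom C (sval x) (sval y)))))).

Lemma jmapE x y (f : hom (fullsub A) x y) v :
  jmap f v = v *m horner_mx J (markf (coord fb (f : hom C (sval x) (sval y)))).
Proof. by rewrite lfunE. Qed.

Lemma jmap_linear x y : linear (@jmap x y).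
Proof.
move=> a f g; apply/lfunP => v; rewrite add_lfunE scale_lfunE !jmapE.
by rewrite coord_linear markf_linear linearP /= mulmxDr scalemxAr.
Qed.

Lemma jmap_id x : jmap (idc x) = \1%VF.
Proof.
apply/lfunP => v; rewrite jmapE id_lfunE [idc x]/(idc (sval x)) coord_id.
by rewrite /markf kext_base /markp big_nil rmorph1 mulmx1.
Qed.

Lemma jmap_comp x y z (f : hom (fullsub A) y z) (g : hom (fullsub A) x y) :
  jmap (comp f g) = (jmap f \o jmap g)%VF.
Proof.
apply/lfunP => v; rewrite comp_lfunE !jmapE [comp f g]/(@comp _ C _ _ _ f g) coord_comp.
by rewrite markf_comp mulrC rmorphM mulmxA.
Qed.

Definition jmod : cmod (fullsub A) :=
  @CMod k (fullsub A) (fun _ => 'rV[k]_d.+1) jmap jmap_linear jmap_id jmap_comp.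

Lemma jmap_beta (x y : {x | A x}) (a : E (sval x) (sval y)) v :
  @jmap x y (beta a) v = if `[< mkarrow a = e >] then v *m J else v.
Proof.
rewrite jmapE coord_beta /markf kext_base /markp big_seq1 /mark.
by case: ifP => _; rewrite ?horner_mx_X // rmorph1 mulmx1.
Qed.
End JordanModule.

(** * Free categories of finite type are forests *)

Section FiniteTypeForest.
Variables (k : fieldType) (C : kCat k).
Variables (E : obj C -> obj C -> Type) (beta : forall x y, E x y -> hom C x y).
Hypothesis fb : free_basis beta.
Let Q := quiver_graph E.

Lemma complement_eq (vT : vectType k) (U1 U1' U2 U2' : {vspace vT}) :
  (U1 + U1' = fullv)%VS -> (U1 :&: U1' = 0)%VS ->
  (U2 + U2' = fullv)%VS -> (U2 :&: U2' = 0)%VS ->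
  (U1 <= U2)%VS -> (U1' <= U2')%VS -> U1 = U2.
Proof.
move=> s1 d1 s2 d2 le le'; apply/eqP; rewrite eqEdim le /=.
have := dimv_disjoint_sum d1; rewrite s1 => e1.
have := dimv_disjoint_sum d2; rewrite s2 e1 => e2.
by have := dimvS le'; lia.
Qed.

Section WalkModule.
Variables (e : edge Q) (l : seq (hedge Q)).
Hypothesis wl : walk (@hs Q) (@ht Q) (src e) (tgt e) l.
Hypothesis avl : avoids e l.

Definition on_walk : set (obj C) :=
  [set x | exists l1 l2, l = l1 ++ l2 /\ walk (@hs Q) (@ht Q) (src e) x l1].

Lemma on_walk_finite : finite_set [set: {x | on_walk x}].
Proof.
pose idx (x : {x | on_walk x}) := size (sval (cid (svalP x))).
have idxP (x : {x | on_walk x}) : exists l2,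
    [/\ l = take (idx x) l ++ l2, walk (@hs Q) (@ht Q) (src e) (sval x) (take (idx x) l) &
     (idx x < (size l).+1)%N].
  rewrite /idx; case: cid => l1 [l2 [el w1]] /=; exists l2.
  by rewrite el take_size_cat // ltnS size_cat leq_addr.
have lt x : (idx x < (size l).+1)%N by have [? []] := idxP x.
have inj : injective (fun x => Ordinal (lt x)).
  move=> x y [ixy]; apply: sig_eq; have [_ [_ wx _]] := idxP x; have [_ [_ wy _]] := idxP y.
  by rewrite ixy in wx; exact: walk_end wx wy.
have [n [c c_bij]] := inj_fin_bij inj.
exact: enum_finite_setT (bij_surj c_bij).
Qed.

Lemma src_on_walk : on_walk (src e). Proof. by exists [::], l. Qed.
Lemma tgt_on_walk : on_walk (tgt e). Proof. by exists l, [::]; rewrite cats0. Qed.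

(** Arrows other than [e] act as identities, so by [complement_eq] a decomposition is constant along
    the walk, whichever way its edges point. The arrow [e] then makes both summands stable under the
    Jordan block. *)
Lemma jordan_walk_indecomposable d : indecomposable (jmod fb e on_walk d).
Proof.
pose x0 : {x | on_walk x} := exist _ _ src_on_walk.
pose y0 : {x | on_walk x} := exist _ _ tgt_on_walk.
split; first by exists x0; apply/eqP; rewrite -dimv_eq0 dimvf.
move=> [U [U' [[sU sU'] [x1 Ux1] [x2 Ux2] comp]]].
pose W (x : {x | on_walk x}) : {vspace 'rV[k]_d.+1} := U x.
pose W' (x : {x | on_walk x}) : {vspace 'rV[k]_d.+1} := U' x.
have stab (T : forall x, {vspace mobj (jmod fb e on_walk d) x}) (x y : {x | on_walk x})
    (a : E (sval x) (sval y)) (v : 'rV[k]_d.+1) : is_submod T -> v \in T x ->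
    (if `[< mkarrow a = e >] then v *m jordan k d else v) \in T y.
  move=> sT vT; have := memv_img (@jmap _ _ _ _ fb e on_walk d x y (beta a)) vT.
  by rewrite jmap_beta; apply/subvP; exact: sT.
have step (x y : {x | on_walk x}) (a : E (sval x) (sval y)) : mkarrow a <> e ->
    W x = W y /\ W' x = W' y.
  move=> ne; have [s1 d1] := comp x; have [s2 d2] := comp y.
  have le : (W x <= W y)%VS.
    by apply/subvP => v vx; have := stab U x y a v sU vx; rewrite (asboolF ne).
  have le' : (W' x <= W' y)%VS.
    by apply/subvP => v vx; have := stab U' x y a v sU' vx; rewrite (asboolF ne).
  split; first exact: (complement_eq s1 d1 s2 d2).
  by apply: (complement_eq (U1' := W x) (U2' := W y)) => //; rewrite (addvC, capvC).
have hstep (h : hedge Q) (x y : {x | on_walk x}) : h.1 <> e ->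
    hs h = sval x -> ht h = sval y -> W x = W y /\ W' x = W' y.
  case: h => [[u [v a]] b] /= ne; case: b; rewrite /ht /hs /=.
    move=> ev eu; have {}ev : v = sval x := ev; have {}eu : u = sval y := eu; subst u v.
    by have [-> ->] := step _ _ _ ne.
  move=> eu ev; have {}ev : v = sval y := ev; have {}eu : u = sval x := eu; subst u v.
  exact: step ne.
have const (x : {x | on_walk x}) : W x = W x0 /\ W' x = W' x0.
  have [l1 [l2 [el w1]]] := svalP x.
  elim/last_ind: l1 x l2 el w1 => [|l1 h IH] x l2 el w1.
    by have -> : x = x0 by apply: sig_eq; rewrite -w1.
  have w := w1; rewrite -cats1 in w; have [u [wu /= [su tu]]] := walk_split w.
  have el' : l = l1 ++ h :: l2 by rewrite el cat_rcons.
  have uP : on_walk u by exists l1, (h :: l2).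
  have he : h.1 <> e.
    by move: avl; rewrite /avoids el' all_cat /= => /and3P[_ /asboolP].
  have [eW eW'] := hstep h (exist _ u uP) x he su tu.
  have [eW0 eW'0] := IH (exist _ u uP) _ el' wu.
  by rewrite -eW -eW' eW0 eW'0.
have [constW constW'] : (forall x, W x = W x0) /\ (forall x, W' x = W' x0).
  by split=> x; have [] := const x.
have me (a : arrow E) : mkarrow (projT2 (projT2 a)) = a by case: a => ? [].
have jst (T : forall x, {vspace mobj (jmod fb e on_walk d) x}) : is_submod T ->
    T y0 = T x0 -> forall v : 'rV[k]_d.+1, v \in (T x0 : {vspace 'rV[k]_d.+1}) ->
    v *m jordan k d \in (T x0 : {vspace 'rV[k]_d.+1}).
  move=> sT Ty v vT; have := stab T x0 y0 (projT2 (projT2 e)) v sT vT.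
  rewrite (asboolT (me e)).
  by rewrite -[in X in _ -> X]Ty.
apply: (@jordan_indecomposable k d (W x0) (W' x0)).
- by apply: jst => //; exact: constW.
- by apply: jst => //; exact: constW'.
- by have [] := comp x0.
- by rewrite -(constW x1); apply/eqP.
- by rewrite -(constW' x2); apply/eqP.
Qed.
End WalkModule.

Theorem finite_type_bridge : finitely_objects (@finite_rep_type k) C ->
  forall e : edge Q, ~ nonbridge e.
Proof.
move=> fin e [l [wl avl]].
have [n [N Nall]] := fin _ (on_walk_finite e l).
pose x0 : {x | on_walk e l x} := exist _ _ (src_on_walk e l).
(* The Jordan module has dimension [d.+1] at [x0], more than any listed module, so it is isomorphic
   to none of them. *)
pose d := (\max_(i < n) \dim {: mobj (N i) x0})%N.
have [i [phi [phi_bij _]]] := Nall _ (jordan_walk_indecomposable wl avl d).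
have le_d : (\dim {: mobj (N i) x0} <= d)%N by exact: (leq_bigmax i).
have /bij_inj/lker0P ker0 := phi_bij x0.
have := limg_dim_eq (f := phi x0) (U := fullv); rewrite (eqP ker0) capv0 => /(_ erefl) dimE.
have := dimvS (subvf (phi x0 @: fullv)%VS); rewrite dimE dimvf => le.
have : (d.+1 <= d)%N.
  apply: leq_trans le_d; apply: leq_trans le; rewrite -[X in (X <= _)%N](mul1n d.+1).
  exact: leqnn.
by rewrite ltnn.
Qed.
End FiniteTypeForest.

(** * Invariants of a category of finite type *)

Lemma finite_rep_type_of (k : fieldType) (C : kCat k) (T : finType) (P : cmod C -> T -> Prop) :
  (forall M, indecomposable M -> exists t, P M t) ->
  (forall M M' t, P M t -> P M' t -> mod_iso M M') -> finite_rep_type C.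
Proof.
move=> total same.
have [[M0 _]|none] := pselect (exists M : cmod C, indecomposable M); last first.
  exists 0%N, (fun i : 'I_0 => match i with Ordinal _ h => False_rect _ (notF h) end).
  move=> M iM.
  by case: none; exists M.
pose N (i : 'I_#|T|) := if pselect (exists M, P M (enum_val i)) is left h
  then sval (cid h) else M0.
exists #|T|, N => M iM; have [t Pt] := total M iM; exists (enum_rank t).
rewrite /N enum_rankK; case: pselect => [h|[]]; last by exists M.
by case: cid => M' /= PM'; exact: same Pt PM'.
Qed.

Section ZeroSpace.
Variables (k : fieldType) (vT : vectType k).
Definition zspace : Prop := fullv = 0%VS :> {vspace vT}.
Lemma zspaceP (v : vT) : zspace -> v = 0.
Proof. by move=> z; apply/eqP; rewrite -memv0 -z memvf. Qed.
Lemma zspace_sub (U W : {vspace vT}) : zspace -> (U <= W)%VS.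
Proof. by move=> z; apply/subvP => v _; rewrite (zspaceP v z) mem0v. Qed.
Lemma zspace0 (U : {vspace vT}) : zspace -> U = 0%VS.
Proof. by move=> z; apply/eqP; rewrite -subv0; exact: zspace_sub. Qed.
End ZeroSpace.

Lemma zspace_lfun_l (k : fieldType) (aT rT : vectType k) (f g : 'Hom(aT, rT)) :
  zspace aT -> f = g.
Proof. by move=> z; apply/lfunP => v; rewrite (zspaceP v z) !linear0. Qed.

Lemma zspace_lfun_r (k : fieldType) (aT rT : vectType k) (f g : 'Hom(aT, rT)) :
  zspace rT -> f = g.
Proof. by move=> z; apply/lfunP => v; rewrite (zspaceP (f v) z) (zspaceP (g v) z). Qed.

Lemma zspace_bij (k : fieldType) (aT rT : vectType k) (f : 'Hom(aT, rT)) :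
  zspace aT -> zspace rT -> bijective f.
Proof.
move=> za zr; exists (fun=> 0) => v; first by rewrite (zspaceP v za).
by rewrite linear0 (zspaceP v zr).
Qed.

Lemma lfun_inv_bij (k : fieldType) (aT rT : vectType k) (f : 'Hom(aT, rT)) :
  bijective f -> cancel f (f^-1)%VF /\ cancel (f^-1)%VF f.
Proof.
move=> fb; have fK := lker0_lfunK (introT lker0P (bij_inj fb)); split=> // w.
by have [v <-] := bij_surj fb w; rewrite fK.
Qed.

Lemma mod_iso_sym (k : fieldType) (C : kCat k) (M N : cmod C) : mod_iso M N -> mod_iso N M.
Proof.
move=> [phi [phi_bij nat]]; exists (fun x => (phi x)^-1)%VF; split=> [x|x y f].
  by have [h1 h2] := lfun_inv_bij (phi_bij x); exists (phi x).
have [kx xk] := lfun_inv_bij (phi_bij x); have [ky yk] := lfun_inv_bij (phi_bij y).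
apply/lfunP => v; rewrite !comp_lfunE; apply: (bij_inj (phi_bij y)); rewrite yk.
have := congr1 (fun h : 'Hom(_, _) => h ((phi x)^-1%VF v)) (nat x y f).
by rewrite /= !comp_lfunE xk.
Qed.

Lemma mod_iso_trans (k : fieldType) (C : kCat k) (M N P : cmod C) :
  mod_iso M N -> mod_iso N P -> mod_iso M P.
Proof.
move=> [phi [phi_bij nat]] [psi [psi_bij nat']].
exists (fun x => psi x \o phi x)%VF; split=> [x|x y f].
  apply: (eq_bij (f := psi x \o phi x)); first exact: bij_comp.
  by move=> v; rewrite /= comp_lfunE.
by rewrite -comp_lfunA nat comp_lfunA nat' comp_lfunA.
Qed.

Section Restriction.
Variables (k : fieldType) (L0 : Type) (V : L0 -> L0 -> lmodType k).
Variables (G : finGroupType) (rho : forall x y : L0, linact G (V x y)).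
Variables (A S : set L0).
Hypothesis SA : S `<=` A.
Let K := @fullsub k (fixcat (homogeneous rho)) A.
Let D := @fullsub k (freecat V) S.
(** [S] stands for a level set of the potential: morphisms inside it are all fixed, and no nonzero
    fixed morphism crosses its boundary. *)
Hypothesis S_fixed : forall (x y : L0) (f : hom (freecat V) x y), S x -> S y ->
  f \in fixed_pred (hact_linact rho x y).
Hypothesis S_cut : forall (x y : obj K) (f : hom K x y), ~ (S (sval x) <-> S (sval y)) -> f = 0.

Definition incl (x : obj D) : obj K := exist _ (sval x) (SA (svalP x)).

Lemma incl_inj : injective incl.
Proof. by move=> x y /(congr1 sval) /= e; exact: sig_eq. Qed.

Definition lift_hom (x y : obj D) (f : hom D x y) : hom K (incl x) (incl y) :=
  FixMod (S_fixed f (svalP x) (svalP y)).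

Lemma lift_homE (x y : obj D) (f : hom K (incl x) (incl y)) :
  lift_hom (fixval f : hom D x y) = f.
Proof. exact: val_inj. Qed.

Section RestrictModule.
Variable M : cmod K.

Definition res_map (x y : obj D) (f : hom D x y) : 'Hom(mobj M (incl x), mobj M (incl y)) :=
  mmap M (lift_hom f).

Lemma res_map_linear x y : linear (@res_map x y).
Proof.
move=> a f g; rewrite /res_map.
have -> : lift_hom (a *: f + g) = a *: lift_hom f + lift_hom g by exact: val_inj.
exact: mmap_linear.
Qed.

Lemma res_map_id x : res_map (idc x) = \1%VF.
Proof.
rewrite /res_map; have -> : lift_hom (idc x) = idc (incl x) by exact: val_inj.
exact: mmap_id.
Qed.

Lemma res_map_comp x y z (f : hom D y z) (g : hom D x y) :
  res_map (comp f g) = (res_map f \o res_map g)%VF.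
Proof.
rewrite /res_map; have -> : lift_hom (comp f g) = comp (lift_hom f) (lift_hom g).
  exact: val_inj.
exact: mmap_comp.
Qed.

Definition restrict : cmod D :=
  @CMod k D (fun x => mobj M (incl x)) res_map res_map_linear res_map_id res_map_comp.
End RestrictModule.

Definition supported (M : cmod K) : Prop := forall x : obj K, ~ S (sval x) -> zspace (mobj M x).

Definition extend (T : obj K -> Type) (t0 : forall x, T x) (t : forall x : obj D, T (incl x))
    (x : obj K) : T x :=
  if pselect (exists y, incl y = x) is left h
  then let: exist y e := cid h in eq_rect _ T (t y) x e else t0 x.

Lemma extend_incl T t0 t (y : obj D) : @extend T t0 t (incl y) = t y.
Proof.
rewrite /extend; case: pselect => [h|[]]; last by exists y.
case: (cid h) => y' /= e; have ey := incl_inj e; subst y'.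
by rewrite (Prop_irrelevance e erefl).
Qed.

Lemma inclP (x : obj K) : S (sval x) -> exists y, incl y = x.
Proof. by move=> Sx; exists (exist _ (sval x) Sx); exact: sig_eq. Qed.

Lemma extend_iso (M N : cmod K) : supported M -> supported N ->
  mod_iso (restrict M) (restrict N) -> mod_iso M N.
Proof.
move=> sM sN [phi [phi_bij nat]].
pose psi := @extend (fun x => 'Hom(mobj M x, mobj N x)) (fun x => 0) phi.
exists psi; split=> [x|x y f].
  have [/inclP[z <-]|nS] := pselect (S (sval x)).
    by rewrite /psi extend_incl; exact: phi_bij.
  by apply: zspace_bij; [exact: sM|exact: sN].
have [/inclP[x' ex]|nS] := pselect (S (sval x)); last exact/zspace_lfun_l/sM.
have [/inclP[y' ey]|nS] := pselect (S (sval y)); last exact/zspace_lfun_r/sN.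
subst x y; rewrite /psi !extend_incl -[f]lift_homE.
exact: nat.
Qed.

Lemma res_indecomposable (M : cmod K) : supported M -> indecomposable M ->
  indecomposable (restrict M).
Proof.
move=> sM [[x0 nz] ind]; split.
  have [/inclP[y ey]|/sM z] := pselect (S (sval x0)); last by rewrite z in nz.
  by subst x0; exists y.
move=> [U [U' [[sU sU'] [x Ux] [x' Ux'] comp]]]; apply: ind.
pose ext := @extend (fun x => {vspace mobj M x}) (fun x => 0%VS).
have ext_sub W : @is_submod k D (restrict M) W -> is_submod (ext W).
  move=> sW y z f.
  have [/inclP[y' ey]|nS] := pselect (S (sval y)); last first.
    by apply/subvP => v /memv_imgP[u _ ->]; rewrite (zspaceP u (sM _ nS)) linear0 mem0v.
  have [/inclP[z' ez]|nS] := pselect (S (sval z)); last exact/zspace_sub/sM.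
  subst y z; rewrite /ext !extend_incl -[f]lift_homE.
  exact: sW.
exists (ext U), (ext U'); split.
- by split; exact: ext_sub.
- by exists (incl x); rewrite /ext extend_incl.
- by exists (incl x'); rewrite /ext extend_incl.
- move=> y; have [/inclP[y' <-]|nS] := pselect (S (sval y)).
    by rewrite /ext !extend_incl; exact: comp.
  by split; [rewrite [RHS](sM _ nS)|]; exact/zspace0/sM.
Qed.

(** As nothing crosses the boundary of [S], a module is the direct sum of its parts on [S] and off
    [S]; one of them must vanish. *)
Lemma indecomposable_supported (M : cmod K) : indecomposable M ->
  (exists x, S (sval x) /\ ~ zspace (mobj M x)) -> supported M.
Proof.
move=> [_ ind] [x0 [S0 nz]] x nS; apply: contrapT => nzx; apply: ind.
pose part (P : Prop) y : {vspace mobj M y} := if `[< P >] then fullv else 0%VS.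
have part_sub (P : obj K -> Prop) :
    (forall y, P y <-> S (sval y)) \/ (forall y, P y <-> ~ S (sval y)) ->
    is_submod (fun y => part (P y) y).
  move=> hP y z f; rewrite /part.
  have [Pz|nPz] := pselect (P z); first by rewrite (asboolT Pz) subvf.
  have [Py|nPy] := pselect (P y); last first.
    rewrite (asboolF nPy); apply/subvP => v /memv_imgP[u]; rewrite memv0 => /eqP -> ->.
    by rewrite linear0 mem0v.
  have -> : f = 0.
    apply: S_cut => SS; apply: nPz; case: hP => hP; apply/hP; move/hP: Py.
      by move/SS.
    by move=> nSy Sz; apply: nSy; apply/SS.
  rewrite (linear0P (@mmap_linear _ _ M y z)).
  by apply/subvP => v /memv_imgP[u _ ->]; rewrite zero_lfunE mem0v.
exists (fun y => part (S (sval y)) y), (fun y => part (~ S (sval y)) y); split.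
- split; first by apply: (part_sub (fun y => S (sval y))); left.
  by apply: (part_sub (fun y => ~ S (sval y))); right.
- by exists x0; rewrite /part (asboolT S0).
- by exists x; rewrite /part (asboolT nS).
- move=> y; rewrite /part; have [Sy|nSy] := pselect (S (sval y)).
    by rewrite (asboolT Sy) asboolF ?addv0 ?capv0 // => h; exact: h.
  by rewrite (asboolF nSy) (asboolT nSy) add0v cap0v.
Qed.
End Restriction.

Section FiniteFixed.
Variables (k : fieldType) (L0 : Type) (V : L0 -> L0 -> lmodType k).
Variables (G : finGroupType) (rho : forall x y : L0, linact G (V x y)).
Hypothesis fin : finitely_objects (@finite_rep_type k) (freecat V).
Variable A : set L0.
Hypothesis A_fin : finite_set [set: {x | A x}].

Let bridge (e : edge (fquiver rho)) : ~ nonbridge e.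
Proof. exact: (finite_type_bridge (ffree rho) fin). Qed.

Let all_forest x : forest rho x. Proof. by move=> e _. Qed.

Let nb_deg e v : @nonbridge (fquiver rho) e -> linked (Q := fquiver rho) (src e) v ->
  deg_le2 (fquiver rho) v.
Proof. by move/bridge. Qed.

Let K := @fullsub k (fixcat (homogeneous rho)) A.

Let cls (u : {x | A x}) : set L0 := [set x | A x /\ same_pot rho (sval u) x].

Let clsA u : cls u `<=` A. Proof. by move=> x []. Qed.

Lemma class_fixed u (x y : L0) (f : hom (freecat V) x y) : cls u x -> cls u y ->
  f \in fixed_pred (hact_linact rho x y).
Proof.
move=> [_ ux] [_ uy]; apply/asboolP => g; elim/(hom_ind (ffree rho)): f => [|a f f' hf hf'|p].
- exact: (lin0 (@hact_linear _ _ _ _ rho g x y)).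
- by rewrite lact_linear hf hf'.
- have fp : fixedp p by apply: same_pot_fixed => //; exact: same_pot_trans (same_pot_sym ux) uy.
  exact: fp.
Qed.

Lemma class_cut u (x y : obj K) (f : hom K x y) : ~ (cls u (sval x) <-> cls u (sval y)) -> f = 0.
Proof.
move=> ncls; apply: val_inj; apply: (coord_inj (fb := ffree rho)).
rewrite [val 0]/(0 : hom (freecat V) (sval x) (sval y)) (lin0 (coord_linear _ (y := _))).
apply: dsumP => p; apply: contrapT => fp; apply: ncls.
have fixp : fixedp p.
  apply: (fixed_support nb_deg _ fp) => g.
  by have /asboolP h := fixvalP f; exact: h.
have xy := fixed_same_pot (@all_forest _) fixp.
split=> -[_ h]; split; try exact: svalP.
  exact: same_pot_trans h xy.
exact: same_pot_trans h (same_pot_sym xy).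
Qed.

(** An indecomposable module is labelled by a level set that carries it and by the class of its
    restriction there, an indecomposable module over a full subcategory of [freecat V]. There are
    finitely many labels, and by [extend_iso] a label determines the module. *)
Theorem fix_finite_type : finite_rep_type K.
Proof.
have [n [c c_surj]] := finite_setT_enum A_fin.
have cls_fin u : finite_set [set: {x | cls u x}] := sub_finite A_fin (@clsA u).
pose m i := sval (cid (fin (cls_fin (c i)))).
have NP i := svalP (cid (fin (cls_fin (c i)))).
pose N i := sval (cid (NP i)); have NE i := svalP (cid (NP i)).
pose rs i := restrict (@clsA (c i)) (@class_fixed (c i)).
apply: (@finite_rep_type_of k K {i : 'I_n & 'I_(m i)} (fun M t =>
  supported (cls (c (tag t))) M /\ mod_iso (rs (tag t) M) (N (tag t) (tagged t)))).
- move=> M iM; have [[x0 nz] _] := iM; have [i ei] := c_surj x0.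
  have sM : supported (cls (c i)) M.
    apply: (indecomposable_supported (@class_cut (c i)) iM); exists x0; split=> //.
    by split; [exact: svalP|rewrite ei; exact: same_pot_refl].
  have [j iso] := NE i _ (res_indecomposable (@clsA (c i)) (@class_fixed (c i)) sM iM).
  by exists (Tagged (fun i => 'I_(m i)) j).
- move=> M M' [i j] /= [sM iM] [sM' iM'].
  apply: (extend_iso (SA := @clsA (c i)) (S_fixed := @class_fixed (c i)) sM sM').
  exact: mod_iso_trans iM (mod_iso_sym iM').
Qed.
End FiniteFixed.

Theorem theorem5p16 (k : fieldType) (L0 : Type) (V : L0 -> L0 -> lmodType k)
    (G : finGroupType) (rho : forall x y : L0, linact G (V x y)) :
  (finitely_objects (@finite_rep_type k) (freecat V) ->
     finitely_objects (@finite_rep_type k) (fixcat (homogeneous rho))) /\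
  (finitely_objects (@tame_rep_type k) (freecat V) ->
     finitely_objects (@tame_rep_type k) (fixcat (homogeneous rho))).
Proof.
split=> hyp A A_fin; first exact: (fix_finite_type rho hyp A_fin).
exact: (fix_tame rho hyp A_fin).
Qed.
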